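(* Let $H\in\mathcal C^\infty((\mathbb R^d)^*;\mathbb R)$. Suppose $(\tau_h)$ and $(\tau'_h)$ are time scales tending to infinity as $h\to0^+$ and such that $\tau'_h\ll\tau_h$ (i.e. $\tau'_h/\tau_h\to0$). Then $$\mathcal M(\infty)\subseteq\mathcal M(\tau)\subseteq L^\infty(\mathbb R;\mathcal M_{\mathrm{av}}(\tau')),$$ where elements of $\mathcal M(\infty)\subset\mathcal P(\mathbb T^d)$ are regarded as constant functions of $t$.
   Context: $\mathbb T^d=(\mathbb R/2\pi\mathbb Z)^d$; $\mathcal P$ denotes Radon probability measures. $H(hD_x)$ acts on $e^{ik\cdot x}$, $k\in\mathbb Z^d$, as multiplication by $H(hk)$, and $S_h^t=e^{-i\frac th H(hD_x)}$. A time scale is a function $h\mapsto\tau_h\in(0,\infty)$, $h>0$. A family $(u_h)$ in $L^2(\mathbb T^d)$ is normalised if $\|u_h\|_{L^2}=1$, and $h$-oscillating if $\limsup_{h\to0^+}\|\mathbf 1_{[R,\infty)}(-h^2\Delta)u_h\|_{L^2}\to0$ as $R\to\infty$. $\mathcal M(\tau)$ is the set of $\nu\in L^\infty(\mathbb R;\mathcal P(\mathbb T^d))$ for which there exist $h_n\to0^+$ and a normalised $h_n$-oscillating sequence $(u_{h_n})$ such that $\lim_n\int_a^b\int_{\mathbb T^d}\chi(x)|S_{h_n}^{\tau_{h_n}t}u_{h_n}(x)|^2dx\,dt=\int_a^b\int_{\mathbb T^d}\chi(x)\nu(t,dx)\,dt$ for all $a<b$, $\chi\in\mathcal C(\mathbb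 T^d)$. $\mathcal M(\infty)$ is the set of accumulation points in $\mathcal P(\mathbb T^d)$ (weak-$*$, as $h\to0^+$) of sequences $|u_h|^2dx$, where $(u_h)$ varies among all $h$-oscillating sequences of normalised eigenfunctions of $H(hD_x)$. $\mathcal M_{\mathrm{av}}(\tau)$ is the subset of $\mathcal P(\mathbb T^d)$ of measures of the form $\int_0^1\nu(t,\cdot)\,dt$ with $\nu\in\overline{\operatorname{Conv}\mathcal M(\tau)}$, the closed convex hull of $\mathcal M(\tau)$ in $L^\infty(\mathbb R;\mathcal P(\mathbb T^d))$ for the weak-$*$ topology. *)

(* Defs.v *)
From HB Require Import structures.
From mathcomp Require Import all_boot all_order all_algebra.
From mathcomp Require Import generic_quotient complex.
From mathcomp Require Import all_classical all_reals all_analysis.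
From mathcomp Require Import measurable_realfun.
Import numFieldNormedType.Exports ComplexField.Normc.
Import Order.TTheory GRing.Theory Num.Theory.
Set Implicit Arguments.
Unset Strict Implicit.
Unset Printing Implicit Defensive.
Local Open Scope quotient_scope.
Local Open Scope classical_set_scope.
Local Open Scope ring_scope.

Section torus.
Context (R : realType) (d : nat).

(* Equality modulo [(2 pi Z)^d]. *)
Definition lattice_rel (x y : 'rV[R]_d) : bool :=
  [forall i, (x ord0 i - y ord0 i) / (2 * pi) \is a Num.int].

Lemma lattice_rel_refl : reflexive lattice_rel.
Proof. by move=> x; apply/forallP => i; rewrite subrr mul0r rpred0. Qed.

Lemma lattice_rel_sym : symmetric lattice_rel.
Proof.
by move=> x y; apply/forallP/forallP => h i; rewrite -opprB mulNr rpredN.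
Qed.

Lemma lattice_rel_trans : transitive lattice_rel.
Proof.
move=> y x z /forallP hxy /forallP hyz; apply/forallP => i.
by rewrite -(subrKA (y ord0 i)) mulrDl rpredD.
Qed.

Definition lattice_eqv :=
  EquivRel lattice_rel lattice_rel_refl lattice_rel_sym lattice_rel_trans.

Definition torus := {eq_quot lattice_eqv}.

HB.instance Definition _ := Topological.copy torus (quotient_topology torus).
HB.instance Definition _ := Quotient.on torus.
HB.instance Definition _ := isPointed.Build torus (\pi_torus 0).

(* Borel sigma-algebra. *)
HB.instance Definition _ :=
  Measurable.copy torus (g_sigma_algebraType (@open torus)).

Definition torus_of_tuple (x : d.-tuple R) : torus :=
  \pi_torus (\row_i tnth x i).

Lemma measurable_torus_of_tuple :
  measurable_fun [set: d.-tuple R] torus_of_tuple.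
Proof.
apply: (@measurability _ _ _ _ _ _ (@open torus)) => // _ [U oU <-].
rewrite setTI.
have {}oU : open (\pi_torus @^-1` U) by exact: oU.
pose V := \pi_torus @^-1` U : set 'rV[R]_d.
pose B (q : 'rV[rat]_d) (n : nat) : set (d.-tuple R) := \bigcap_(i : 'I_d)
  [set x | `|ratr (q ord0 i) - tnth x i| < n.+1%:R^-1].
have mB q n : measurable (B q n).
  apply: fin_bigcap_measurable => [|i _]; first exact: finite_finset.
  have : measurable_fun [set: d.-tuple R]
      (fun x : d.-tuple R => `|ratr (q ord0 i) - tnth x i|).
    apply: measurableT_comp => //; apply: measurable_funB => //.
    exact: measurable_tnth.
  move=> /(_ measurableT `]-oo, n.+1%:R^-1[%classic (measurable_itv _)).
  by rewrite setTI; congr measurable; apply/seteqP; split => x /=; rewrite in_itv.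
have BP q n x : B q n x <->
    ball (map_mx ratr q : 'rV[R]_d) n.+1%:R^-1 (\row_i tnth x i : 'rV[R]_d).
  split=> [h|[_ h] i _].
    by split=> [|i j]; rewrite ?invr_gt0// ord1 /ball/= !mxE; exact: h.
  by have := h ord0 i; rewrite /ball/= !mxE.
pose F (p : 'rV[rat]_d * nat) := [set x | B p.1 p.2 x /\
  ball (map_mx ratr p.1 : 'rV[R]_d) p.2.+1%:R^-1 `<=` V].
rewrite (_ : _ @^-1` U = \bigcup_p F p); last first.
  apply/seteqP; split=> [x Ux|x [[q n] _ [/BP Bx]]]; last exact.
  have : nbhs (\row_i tnth x i : 'rV[R]_d) V by exact: open_nbhs_nbhs.
  move=> /nbhs_ballP[e /= e0 eV].
  have [n ne] : exists n : nat, n.+1%:R^-1 < e / 2.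
    exists (Num.trunc (e / 2)^-1); rewrite invf_plt ?posrE ?divr_gt0//.
    exact: truncnS_gt.
  have /choice[q hq] i : exists q : rat, `|ratr q - tnth x i| < n.+1%:R^-1.
    have : tnth x i - n.+1%:R^-1 < tnth x i + n.+1%:R^-1.
      by rewrite ltrD2l -subr_gt0 opprK addr_gt0// invr_gt0.
    move=> /rat_in_itvoo[q]; rewrite in_itv/= => /andP[q1 q2]; exists q.
    by rewrite ltr_norml ltrBrDr addrC q1 ltrBlDr addrC q2.
  exists (\row_i q i, n) => //=; split=> [i _|y /=]; first by rewrite /= !mxE.
  have /BP /ball_sym xq : B (\row_i q i) n x by move=> i _; rewrite /= !mxE.
  move=> /(ball_triangle xq) xy; apply: eV.
  by apply: le_ball xy; rewrite (splitr e) lerD// ltW.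
apply: countable_bigcupT_measurable => // -[q n]; rewrite /F.
have [h|h] := pselect (ball (map_mx ratr q : 'rV[R]_d) n.+1%:R^-1 `<=` V).
  by rewrite (_ : mkset _ = B q n)//; apply/seteqP; split=> x; [case|split].
by rewrite (_ : mkset _ = set0)//; apply/seteqP; split=> x // -[].
Qed.

End torus.


Definition image_measure d1 d2 (T1 : measurableType d1) (T2 : measurableType d2)
    (R : realType) (m : {measure set T1 -> \bar R}) (f : T1 -> T2)
    (mf : measurable_fun [set: T1] f) : {measure set T2 -> \bar R} :=
  @measure_function_pushforward__canonical__measure_function_Measure
    _ _ _ _ _ m f mf.

Section torus_measure.
Context (R : realType).

Lemma measurable_cons_tuple n : measurable_fun [set: n.-tuple R * R]
  (fun p => [the n.+1.-tuple R of p.2 :: p.1]).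
Proof. exact: measurable_cons. Qed.

(* Lebesgue measure on [R^n]. *)
Fixpoint lebesgue_tuple n : {measure set (n.-tuple R) -> \bar R} :=
  if n is m.+1 return {measure set (n.-tuple R) -> \bar R} then
    image_measure (lebesgue_tuple m \x lebesgue_measure)%E
      (@measurable_cons_tuple m)
  else \d_ [tuple].

Definition fundamental_box d : set (d.-tuple R) :=
  \bigcap_(i : 'I_d) [set x | tnth x i \in `[0, 2 * pi[].

Lemma measurable_fundamental_box d : measurable (@fundamental_box d).
Proof.
apply: fin_bigcap_measurable => [|i _]; first exact: finite_finset.
rewrite -[X in measurable X]setTI.
exact: (measurable_tnth i measurableT (measurable_itv `[0, 2 * pi[)).
Qed.

(* The measure [dx], of total mass [(2 * pi) ^+ d]. *)
Definition torus_measure d : {measure set (torus R d) -> \bar R} :=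
  image_measure (mrestr (lebesgue_tuple d) (@measurable_fundamental_box d))
    (@measurable_torus_of_tuple R d).

End torus_measure.

Section fourier.
Context (R : realType) (d : nat).
Local Notation T := (torus R d).
Local Notation dx := (@torus_measure R d).
Local Open Scope complex_scope.
Implicit Types (u v : T -> R[i]) (k : 'rV[int]_d).

Definition expi (a : R) : R[i] := cos a +i* sin a.

(* [x |-> e^{i k.x}]; independent of the representative of [x]. *)
Definition torus_char k (x : T) : R[i] :=
  expi (\sum_(i < d) (k ord0 i)%:~R * repr x ord0 i).

Definition normL2 u : \bar R := Lnorm dx 2%:E (fun x => (normc (u x))%:E).

Definition is_L2 u := [/\ measurable_fun [set: T] (fun x => complex.Re (u x)),
  measurable_fun [set: T] (fun x => complex.Im (u x)) & (normL2 u < +oo)%E].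

Definition normalised u := is_L2 u /\ normL2 u = 1%E.

(* Not divided by [(2 * pi) ^+ d]. *)
Definition fourier_coef u k : R[i] :=
  (\int[dx]_x complex.Re (u x * torus_char (- k) x)) +i*
  (\int[dx]_x complex.Im (u x * torus_char (- k) x)).

(* [v] is the image of [u] by the Fourier multiplier of symbol [m], that is, by
   the operator on [L^2] acting on [e^{i k.x}] as multiplication by [m k] (with
   its maximal domain if [m] is unbounded). Functions are not identified up to
   null sets, so that [v] is only determined almost everywhere. *)
Definition is_multiplier (m : 'rV[int]_d -> R[i]) u v :=
  is_L2 v /\ forall k, fourier_coef v k = m k * fourier_coef u k.

Definition scaled_freq (h : R) k : 'rV[R]_d := \row_i (h * (k ord0 i)%:~R).

Definition is_H_hD (H : 'rV[R]_d -> R) (h : R) :=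
  is_multiplier (fun k => (H (scaled_freq h k))%:C).

Definition is_propagator (H : 'rV[R]_d -> R) (h t : R) :=
  is_multiplier (fun k => expi (- (t / h) * H (scaled_freq h k))).

(* [1_{[r, oo)} (- h^2 Laplacian)] *)
Definition is_high_freq (h r : R) :=
  is_multiplier (fun k =>
    if r <= \sum_(i < d) scaled_freq h k ord0 i ^+ 2 then 1 else 0).

Definition oscillating (h : nat -> R) (u : nat -> T -> R[i]) :=
  exists w : R -> nat -> T -> R[i],
    (forall r n, is_high_freq (h n) r (u n) (w r n)) /\
    limn_esup (fun n => normL2 (w r n)) @[r --> +oo] --> 0%E.

End fourier.

Section weak_star.
Context (R : realType) (d : nat).
Local Notation T := (torus R d).
Local Notation lambda := (@lebesgue_measure R).

(* [P(T^d)] is [probability T R]: as [T^d] is compact and metrizable, Borel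
   probability measures are Radon. *)
Definition prob_pairing (mu : probability T R) :
    {ptws continuousType T R -> R} :=
  fun chi => \int[mu]_x chi x.

Definition weak_star_prob := initial_topology prob_pairing.

(* [L^oo(R; P(T^d))]: weakly-* measurable families of probability measures are
   probability kernels. Almost everywhere equal families are not identified;
   all the sets of families below are invariant under such a change. *)
Definition Linfty_prob : Type := R.-pker R ~> T.

HB.instance Definition _ := gen_eqMixin Linfty_prob.
HB.instance Definition _ := gen_choiceMixin Linfty_prob.

(* [L^1(R; C(T^d))], the predual of [L^oo(R; M(T^d))]: as [C(T^d)] is separable,
   strong measurability amounts to measurability of all the evaluations. *)
Definition L1_cont := {phi : R -> T -> R | [/\
  forall t, continuous (phi t),
  forall x, measurable_fun [set: R] (phi ^~ x) &
  exists2 g : R -> R, lambda.-integrable [set: R] (EFin \o g) &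
    forall t x, `|phi t x| <= g t]}.

Definition Linfty_pairing (nu : Linfty_prob) : {ptws L1_cont -> R} :=
  fun phi => \int[lambda]_t \int[nu t]_x sval phi t x.

Definition weak_star_Linfty := initial_topology Linfty_pairing.

Definition convex_hull (A : set Linfty_prob) : set Linfty_prob :=
  [set nu : Linfty_prob | exists n (w : 'I_n -> R) (nus : 'I_n -> Linfty_prob),
    [/\ forall i, 0 <= w i, \sum_(i < n) w i = 1, forall i, A (nus i) &
      {ae lambda, forall t, forall B, measurable B ->
        nu t B = (\sum_(i < n) (w i)%:E * nus i t B)%E}]].

Definition closed_convex_hull (A : set Linfty_prob) : set Linfty_prob :=
  closure (convex_hull A : set weak_star_Linfty).

Definition const_Linfty (mu : probability T R) : Linfty_prob :=
  kprobability (measurable_cst (mu : pprobability T R)).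

Definition Linfty_valued_in (S : set (probability T R)) : set Linfty_prob :=
  [set nu : Linfty_prob | {ae lambda, forall t, exists2 mu, S mu &
    forall B, measurable B -> nu t B = mu B}].

End weak_star.

Section time_scales.
Context (R : realType) (d : nat).
Local Notation T := (torus R d).
Local Notation dx := (@torus_measure R d).
Local Notation lambda := (@lebesgue_measure R).
Implicit Types (H : 'rV[R]_d -> R) (tau : R -> R).

Definition smooth H := forall s : seq 'I_d,
  let f := foldr (fun i g => 'D_(delta_mx ord0 i) g) H s in
  continuous f /\ forall i x, derivable f x (delta_mx ord0 i).

Definition time_scale tau := forall h, 0 < h -> 0 < tau h.

Definition M_set H tau : set (Linfty_prob R d) :=
  [set nu : Linfty_prob R d | exists (h : nat -> R) (u : nat -> T -> R[i])
      (v : nat -> R -> T -> R[i]),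
    [/\ forall n, 0 < h n, h @ \oo --> 0,
        forall n, normalised (u n), oscillating h u &
        (forall n t, is_propagator H (h n) (tau (h n) * t) (u n) (v n t)) /\
        forall (a b : R) (chi : T -> R), a < b -> continuous chi ->
          \int[lambda]_(t in `[a, b]) (\int[dx]_x
            (chi x * normc (v n t x) ^+ 2)) @[n --> \oo] -->
          \int[lambda]_(t in `[a, b]) (\int[nu t]_x chi x)]].

(* The [e n] are eigenvalues of a self-adjoint operator, hence real; [rho n] is
   the measure [|u n|^2 dx]. *)
Definition M_infty H : set (probability T R) :=
  [set mu : probability T R | exists (h : nat -> R) (u : nat -> T -> R[i]) (e : nat -> R)
      (rho : nat -> probability T R),
    [/\ forall n, 0 < h n, h @ \oo --> 0,
        forall n, normalised (u n) /\
          is_H_hD H (h n) (u n) (fun x => (e n)%:C%C * u n x),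
        oscillating h u &
        (forall n B, measurable B ->
          rho n B = (\int[dx]_(x in B) (normc (u n x) ^+ 2)%:E)%E) /\
        cluster ((rho : nat -> weak_star_prob R d) @ \oo) mu]].

Definition M_av H tau : set (probability T R) :=
  [set mu : probability T R | exists2 nu, closed_convex_hull (M_set H tau) nu &
    forall B, measurable B ->
      mu B = (\int[lambda]_(t in `[0%R, 1%R]) nu t B)%E].

End time_scales.

(* Main.v *)
(* Eigenfunctions are stationary up to a phase, so a measure of [M(oo)], realised
   along a subsequence, is a constant element of [M(tau)].

   For the second inclusion, let [nu] be a limit of [|v_n(t)|^2], where [v_n(t)] is
   the evolution of [u_n] at the time scale [tau], and let [t0] be a Lebesgue point
   of [t |-> int chi dnu(t)] for all [chi] in a countable total family. Put
   [dl_n = tau'(h_n) / tau(h_n)], which tends to 0. The functions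
   [s |-> v_n(t + dl_n s)] are the evolutions at the time scale [tau'] of the data
   [v_n(t)], which are normalised and oscillating; by weak-* compactness of
   [L^oo(R; P(T^d))], for [n] large their densities are close to [M(tau')],
   uniformly in [t]. Averaging them over equidistributed points [t] of
   [t0, t0 + eta] gives a convex combination that is close to the average of
   [|v_n|^2] over [t0, t0 + eta], since [v_n] is uniformly continuous in time and
   the shift [dl_n s] is negligible. Letting [n] tend to infinity and then [eta] to
   0, the constant family [nu(t0)] is in the closed convex hull of [M(tau')].

   Compactness is obtained without the Riesz representation theorem: a measure on
   the torus is described by the masses of its dyadic cells, a mass distribution on
   the binary tree; weak-* limits of such families of masses in [L^oo(R; [0, 1])]
   are again mass distributions, and the limit kernel is the law of a random branch
   of the tree. *)
From HB Require Import structures.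
Require Import Defs.
From mathcomp Require Import all_boot all_order all_algebra.
From mathcomp Require Import generic_quotient complex.
From mathcomp Require Import all_classical all_reals all_analysis.
From mathcomp Require Import measurable_realfun.
From mathcomp Require Import ring lra zify.
Import numFieldNormedType.Exports ComplexField.Normc.
Import Order.TTheory GRing.Theory Num.Theory.
Set Implicit Arguments.
Unset Strict Implicit.
Unset Printing Implicit Defensive.
Local Open Scope quotient_scope.
Local Open Scope classical_set_scope.
Local Open Scope ring_scope.

(** * Integration against densities *)

(** The order of the choices is forced. Each [v n] is uniformly continuous in time, but with no rate
    uniform in [n], since the phases [tau t H / h] speed up as [h] tends to 0; so [n] is fixed
    before the number of averaging points is sent to infinity. Conversely, these points become more
    numerous after [n] is fixed, so closeness to [M(tau')] must already hold at every base time.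
    This is possible because zooming in time respects the group law around any base point, while
    normalisation and oscillation only involve moduli of Fourier coefficients. As multipliers are
    specified by coefficients alone, Parseval's identity is what connects them with norms and
    densities. Completeness of the characters and the reduction of all weak-* tests to countably
    many rest on the same explicit tool, a partition of unity by products of Fejer kernels. Constant
    families suffice at the end because averaging one over [0, 1] gives back its value. *)

Section measurable_induction.
Context d0 (X : measurableType d0) (R : realType).
Local Open Scope ereal_scope.

Import HBNNSimple.

(** Approximation by increasing simple functions, packaged as an induction so that density formulas
    reduce to indicators, sums, scalings and monotone limits. *)
Lemma ge0_measurable_ind (P : (X -> \bar R) -> Prop) :
  (forall A, measurable A -> P (fun x => (\1_A x)%:E)) ->
  (forall f g, measurable_fun [set: X] f -> measurable_fun [set: X] g ->
    (forall x, 0 <= f x) -> (forall x, 0 <= g x) -> P f -> P g ->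
    P (fun x => f x + g x)) ->
  (forall (k : R) f, measurable_fun [set: X] f -> (0 <= k)%R ->
    (forall x, 0 <= f x) -> P f -> P (fun x => k%:E * f x)) ->
  (forall f_ : nat -> X -> \bar R, (forall n, measurable_fun [set: X] (f_ n)) ->
    (forall n x, 0 <= f_ n x) ->
    (forall x, {homo f_ ^~ x : n m / (n <= m)%N >-> n <= m}) ->
    (forall n, P (f_ n)) -> P (fun x => limn (f_ ^~ x))) ->
  forall f, measurable_fun [set: X] f -> (forall x, 0 <= f x) -> P f.
Proof.
move=> P1 PD PZ Plim f mf f0.
pose f_ n : X -> \bar R := fun x => (nnsfun_approx measurableT mf n x)%:E.
have -> : f = fun x => limn (f_ ^~ x).
  apply/funext => x; apply/esym/cvg_lim => //.
  exact: (@cvg_nnsfun_approx _ _ _ _ measurableT _ mf (fun x _ => f0 x) x I).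
apply: Plim => [n|n x|x n m nm|n].
- exact/measurable_EFinP.
- by rewrite lee_fin.
- by rewrite lee_fin; exact/lefP/nd_nnsfun_approx.
rewrite /f_; set h := nnsfun_approx _ _ _.
pose s := finmap.enum_fset (fset_set (range h)).
have hE : (fun x => (h x)%:E) =
    (fun x => (\sum_(y <- s) (y * \1_(h @^-1` [set y]) x)%R%:E)).
  apply/funext => x; rewrite sumEFin; congr EFin.
  by rewrite fimfunEord (big_nth 0%R) big_mkord.
rewrite hE.
have s0 : {in s, forall y, (0 <= y)%R}.
  move=> y /[!in_fset_set]// /[!inE] -[x _ <-].
  exact: fun_ge0.
have mh y : measurable (h @^-1` [set y]) by exact: measurable_sfunP.
(* Measurability and nonnegativity of the partial sums are carried along because the clause of [P]
   for sums demands them. *)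
suff [] : [/\ measurable_fun [set: X] (fun x => (\sum_(y <- s) (y * \1_(h @^-1` [set y]) x)%R%:E)),
   (forall x, 0 <= (\sum_(y <- s) (y * \1_(h @^-1` [set y]) x)%R%:E)) &
   P (fun x => (\sum_(y <- s) (y * \1_(h @^-1` [set y]) x)%R%:E))] by [].
elim: s s0 {hE} => [_|y s IH s0].
  under eq_fun do rewrite big_nil.
  split => //.
    by move=> x; rewrite big_nil.
  by have := P1 set0 measurable0; congr P; apply/funext => x; rewrite indic0.
have [|m1 p1 P2] := IH; first by move=> z zs; apply: s0; rewrite in_cons zs orbT.
have y0 : (0 <= y)%R by apply: s0; rewrite in_cons eqxx.
have m2 : measurable_fun [set: X] (fun x => (\1_(h @^-1` [set y]) x)%:E : \bar R).
  by apply/measurable_EFinP; exact: measurable_indic.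
have m3 : measurable_fun [set: X] (fun x => y%:E * (\1_(h @^-1` [set y]) x)%:E : \bar R).
  exact: measurable_funeM.
under eq_fun do rewrite big_cons EFinM.
split.
- exact: emeasurable_funD.
- by move=> x; rewrite big_cons EFinM adde_ge0// mule_ge0// lee_fin.
- apply: PD => //.
  + by move=> x; rewrite mule_ge0// lee_fin.
  + by apply: PZ => //; exact: P1.
Qed.

Lemma integral_limn (mu : {measure set X -> \bar R}) (f_ : nat -> X -> \bar R) :
  (forall n, measurable_fun [set: X] (f_ n)) ->
  (forall n x, 0 <= f_ n x) ->
  (forall x, {homo f_ ^~ x : n m / (n <= m)%N >-> n <= m}) ->
  \int[mu]_x limn (f_ ^~ x) = limn (fun n => \int[mu]_x f_ n x).
Proof. by move=> mf f0 nd; exact: monotone_convergence. Qed.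

Lemma ge0_integral_density (mu nu : {measure set X -> \bar R}) (f : X -> R) :
  measurable_fun [set: X] f -> (forall x, 0 <= f x)%R ->
  (forall B, measurable B -> nu B = \int[mu]_(x in B) (f x)%:E) ->
  forall g, measurable_fun [set: X] g -> (forall x, 0 <= g x) ->
  \int[nu]_x g x = \int[mu]_x (g x * (f x)%:E).
Proof.
move=> mf f0 nuE; have mf' : measurable_fun [set: X] (EFin \o f) by exact/measurable_EFinP.
apply: ge0_measurable_ind.
- move=> A mA; rewrite integral_indic// setIT nuE// integral_mkcond.
  by apply: eq_integral => x _; rewrite patchE indicE; case: ifP => _; rewrite ?mul1e ?mul0e.
- move=> g h mg mh g0 h0 Pg Ph; rewrite ge0_integralD// Pg Ph -ge0_integralD//.
  + by apply: eq_integral => x _; rewrite ge0_muleDl.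
  + by move=> x _; rewrite mule_ge0// lee_fin.
  + exact: emeasurable_funM.
  + by move=> x _; rewrite mule_ge0// lee_fin.
  + exact: emeasurable_funM.
- move=> k g mg k0 g0 Pg; rewrite ge0_integralZl// Pg -ge0_integralZl//.
  + by apply: eq_integral => x _; rewrite muleA.
  + exact: emeasurable_funM.
  + by move=> x _; rewrite mule_ge0// lee_fin.
- move=> g_ mg g0 nd Pg; rewrite integral_limn//.
  transitivity (limn (fun n => \int[mu]_x (g_ n x * (f x)%:E))).
    by congr (limn _); apply/funext => n; rewrite Pg.
  rewrite -integral_limn.
  + apply: eq_integral => x _; rewrite limeMr//.
    by apply: ereal_nondecreasing_is_cvgn; exact: nd.
  + by move=> n; exact: emeasurable_funM.
  + by move=> n x; rewrite mule_ge0// lee_fin.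
  + by move=> x n m nm; rewrite lee_wpmul2r ?lee_fin// nd.
Qed.

End measurable_induction.

Section bounded_density.
Context d0 (X : measurableType d0) (R : realType).
Variables (mu nu : {measure set X -> \bar R}) (f : X -> R).
Hypotheses (mf : measurable_fun [set: X] f) (f0 : forall x, 0 <= f x).
Hypothesis nuE : forall B, measurable B -> nu B = (\int[mu]_(x in B) (f x)%:E)%E.

(** As [f] is nonnegative, multiplication by [f] commutes with positive and negative parts, which
    reduces the signed case to [ge0_integral_density]. *)
Lemma integral_density (g : X -> R) : measurable_fun [set: X] g ->
  mu.-integrable [set: X] (EFin \o (fun x => g x * f x)) ->
  nu.-integrable [set: X] (EFin \o g) /\
  \int[nu]_x g x = \int[mu]_x (g x * f x).
Proof.
move=> mg ig.
have mg' : measurable_fun [set: X] (EFin \o g) by exact/measurable_EFinP.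
have H h : measurable_fun [set: X] h -> (forall x, (0 <= h x)%E) ->
  (\int[nu]_x h x = \int[mu]_x (h x * (f x)%:E))%E.
  by move=> mh h0; exact: (ge0_integral_density mf).
have ing : nu.-integrable [set: X] (EFin \o g).
  apply/integrableP; split=> //; rewrite H//; last exact: measurableT_comp.
  have /integrableP[_] := ig; congr (_ < _)%E; apply: eq_integral => x _ /=.
  by rewrite normrM (ger0_norm (f0 x)) EFinM.
split=> //; rewrite /Rintegral; congr fine.
have ig' : mu.-integrable [set: X] (fun x => (EFin \o g) x * (f x)%:E)%E by [].
rewrite integralE [in RHS]integralE; congr (_ - _)%E.
  rewrite H//; last exact: measurable_funepos.
  apply: eq_integral => x _; rewrite !funeposE/= -!EFin_max -EFinM.
  by rewrite maxr_pMl// mul0r.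
rewrite H//; last exact: measurable_funeneg.
apply: eq_integral => x _; rewrite !funenegE/= -!EFin_max -EFinM.
by rewrite maxr_pMl// mul0r mulNr.
Qed.

End bounded_density.

(** * Topology of the torus *)

Lemma cvg_bigsum (I J : Type) (F : set_system I) (FF : Filter F)
    (R : numFieldType) (r : seq J) (P : pred J) (f : J -> I -> R^o) (l : J -> R^o) :
  (forall j, P j -> f j i @[i --> F] --> l j) ->
  \sum_(j <- r | P j) f j i @[i --> F] --> \sum_(j <- r | P j) l j.
Proof.
move=> fl; elim: r => [|j r IH].
  by rewrite big_nil; under eq_fun do rewrite big_nil; exact: cvg_cst.
rewrite big_cons; under eq_fun do rewrite big_cons.
by case: (boolP (P j)) => // Pj; apply: cvgD => //; exact: fl.
Qed.

Lemma continuous_bigsum (X : topologicalType) (J : Type) (R : numFieldType)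
    (r : seq J) (P : pred J) (f : J -> X -> R^o) :
  (forall j, P j -> continuous (f j)) ->
  continuous (fun x => \sum_(j <- r | P j) f j x).
Proof.
by move=> cf x; apply: (@cvg_bigsum _ _ (nbhs x)) => j Pj; exact: cf.
Qed.

Lemma continuous_bigprod (X : topologicalType) (J : Type) (R : numFieldType)
    (r : seq J) (P : pred J) (f : J -> X -> R) :
  (forall j, P j -> continuous (f j)) ->
  continuous (fun x => \prod_(j <- r | P j) f j x).
Proof.
move=> cf; elim: r => [|j r IH] x.
  by under eq_fun do rewrite big_nil; exact: cvg_cst.
rewrite /continuous_at big_cons; under eq_fun do rewrite big_cons.
case: (boolP (P j)) => Pj; last exact: IH.
by apply: cvgM; [exact: cf|exact: IH].
Qed.

Section torus_topology.
Context (R : realType) (d : nat).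
Local Notation T := (torus R d).
Implicit Types (x y : T) (a b : 'rV[R]_d).

Definition tpi a : T := \pi_(torus R d) a.

Lemma tpi_repr x : tpi (repr x) = x.
Proof. exact: reprK. Qed.

Lemma tpi_continuous : continuous tpi.
Proof. exact: pi_continuous. Qed.

Lemma tpi_eqP a b : (tpi a = tpi b) <-> lattice_rel a b.
Proof.
have E : (a == b %[mod {eq_quot (lattice_eqv R d)}]) = lattice_rel a b.
  exact: eqmodE.
split=> h; first by move: E => <-; apply/eqP; exact: h.
by move: h; rewrite -E => /eqP.
Qed.

Lemma torus_continuous (U : topologicalType) (f : T -> U) :
  continuous (f \o tpi) -> continuous f.
Proof.
move=> cf; apply/continuousP => A oA.
by have /continuousP /(_ _ oA) := cf.
Qed.

Lemma cos_int_periodic (a : R) (n : int) : cos (a + n%:~R * (2 * pi)) = cos a.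
Proof.
have cn (m : nat) c : cos (c + m%:R * (2 * pi)) = cos c :> R.
  elim: m c => [|m IH] c; first by rewrite mul0r addr0.
  rewrite -addn1 natrD mulrDl mul1r addrA.
  by rewrite [X in _ + X]mulr_natl cosD2pi IH.
case: n => n; first exact: cn.
by rewrite NegzE mulrNz mulNr -[in RHS](subrK (n.+1%:R * (2 * pi)) a) cn.
Qed.

Lemma sin_int_periodic (a : R) (n : int) : sin (a + n%:~R * (2 * pi)) = sin a.
Proof.
have h c : sin c = cos (c - pi / 2) :> R.
  by rewrite -cosN opprB -[pi / 2 - c]addrC cosDpihalf sinN opprK.
by rewrite !h addrAC cos_int_periodic.
Qed.

(** Modulo the period the angle is some [b] in [0, 2 pi[, and [cos b = 1 - 2 sin(b/2)^2] with
    [sin(b/2)] positive unless [b = 0]. *)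
Lemma cos_eq1 (a : R) : cos a = 1 -> a / (2 * pi) \is a Num.int.
Proof.
have pi2 : 0 < 2 * pi :> R by rewrite mulr_gt0// pi_gt0.
pose n := Num.floor (a / (2 * pi)).
pose b := a - n%:~R * (2 * pi).
have -> : a = b + n%:~R * (2 * pi) by rewrite subrK.
rewrite cos_int_periodic => cb.
have /andP[b0 b2] : 0 <= b < 2 * pi.
  have /andP[h1 h2] := floor_itv (a / (2 * pi)).
  rewrite /b subr_ge0 -ler_pdivlMr// h1/= ltrBlDr.
  rewrite -[X in X + _]mul1r -mulrDl -ltr_pdivrMr// addrC.
  by move: h2; rewrite intrD.
have [b0'|bn0] := eqVneq b 0.
  by rewrite b0' add0r mulfK ?gt_eqF// intr_int.
have : 0 < sin (b / 2).
  apply: sin_gt0_pi; apply/andP; split; last by rewrite ltr_pdivrMr// mulrC.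
  by rewrite divr_gt0// lt_neqAle b0 andbT eq_sym.
have h2 : cos b = 1 - sin (b / 2) ^+ 2 *+ 2.
  rewrite [in LHS](splitr b) -mulr2n cos_mulr2n.
  by have := cos2Dsin2 (b / 2); lra.
move: h2; rewrite cb => /eqP; rewrite -subr_eq0 opprB addrCA subrr addr0.
by rewrite mulrn_eq0/= sqrf_eq0 => /eqP ->; rewrite ltxx.
Qed.

Lemma cos_dist_le (a b : R) : `|cos a - cos b| <= `|a - b|.
Proof.
wlog ab : a b / b <= a.
  move=> h; have [/h//|/ltW/h] := leP b a.
  by rewrite distrC [leRHS]distrC.
have [|c _ ->] := @MVT_segment R (@cos R) (fun z => - sin z) b a ab
  (fun z _ => is_derive_cos z).
- by apply: continuous_subspaceT; exact: continuous_cos.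
- rewrite normrM normrN ler_piMl//.
  rewrite ler_norml sin_le1 andbT lerNl; have := sin_le1 (- c).
  by rewrite sinN => ->.
Qed.

(** [repr] is an arbitrary choice of representative; functions of [repr x] become intrinsic by
    absorbing this multiple of the period. *)
Lemma repr_tpi a i : exists n : int,
  repr (tpi a) ord0 i = a ord0 i + n%:~R * (2 * pi).
Proof.
have /forallP/(_ i)/intrP[n] : lattice_rel (repr (tpi a)) a.
  by apply/tpi_eqP; rewrite tpi_repr.
move=> /(canRL (mulfVK _)) h; exists n.
by rewrite -h ?subrKC// mulf_neq0// gt_eqF ?pi_gt0.
Qed.

Lemma torus_fun_continuous (U : topologicalType) (g : 'rV[R]_d -> U) :
  continuous g -> (forall a, g (repr (tpi a)) = g a) ->
  continuous (fun x : T => g (repr x)).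
Proof.
move=> cg gP; apply: torus_continuous.
by rewrite (_ : _ \o _ = g)//; apply/funext => a /=.
Qed.

Definition phase (k : 'rV[int]_d) (a : 'rV[R]_d) : R :=
  \sum_(i < d) (k ord0 i)%:~R * a ord0 i.

Lemma phase_repr_tpi k a : exists n : int,
  phase k (repr (tpi a)) = phase k a + n%:~R * (2 * pi).
Proof.
have /choice[n hn] := repr_tpi a.
exists (\sum_(i < d) k ord0 i * n i).
rewrite raddf_sum/= mulr_suml -big_split/=; apply: eq_bigr => i _.
by rewrite hn mulrDr intrM mulrA.
Qed.

Lemma coord_continuous_rV i : continuous (fun a : 'rV[R]_d => a ord0 i).
Proof. exact: coord_continuous. Qed.

Lemma phase_continuous k : continuous (phase k).
Proof.
apply: continuous_bigsum => i _ a.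
by apply: continuousM; [exact: cst_continuous|exact: coord_continuous_rV].
Qed.

(** The shift [c] lets one statement serve cosines and, with [c = - (pi / 2)], sines. *)
Lemma cos_phase_continuous k (c : R) :
  continuous (fun x : T => cos (phase k (repr x) + c)).
Proof.
apply: (@torus_fun_continuous _ (fun a => cos (phase k a + c))) => a.
  apply: continuous_comp; last exact: continuous_cos.
  by apply: continuousD; [exact: phase_continuous|exact: cst_continuous].
by have [n ->] := phase_repr_tpi k a; rewrite addrAC cos_int_periodic.
Qed.

Lemma cos_coord_continuous i (l : int) (c : R) :
  continuous (fun x : T => cos (l%:~R * repr x ord0 i + c)).
Proof.
rewrite (_ : (fun x => _) =
  fun x => cos (phase (l *: delta_mx ord0 i) (repr x) + c)).
  exact: cos_phase_continuous.
apply/funext => x; congr (cos (_ + _)); apply/esym.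
rewrite /phase (bigD1 i)//= big1 ?addr0 ?mxE ?eqxx ?mulr1// => j ji.
by rewrite !mxE eqxx/= (negbTE ji) mulr0 mul0r.
Qed.

Lemma torus_compact : compact [set: T].
Proof.
have pi2 : 0 < 2 * pi :> R by rewrite mulr_gt0// pi_gt0.
pose B := [set v : 'rV[R]_d | forall i, [set` `[0, 2 * pi]] (v ord0 i)].
have cB : compact B.
  apply: (@rV_compact R d (fun=> [set` `[0, 2 * pi]])) => i.
  exact: segment_compact.
rewrite (_ : setT = tpi @` B).
  apply: continuous_compact => //; apply: continuous_subspaceT.
  exact: tpi_continuous.
apply/esym/seteqP; split=> // x _.
pose n i := Num.floor (repr x ord0 i / (2 * pi)).
exists (\row_i (repr x ord0 i - (n i)%:~R * (2 * pi))) => [i|].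
  rewrite /= mxE in_itv/=.
  have /andP[h1 h2] := floor_itv (repr x ord0 i / (2 * pi)).
  rewrite subr_ge0 -ler_pdivlMr// h1/= lerBlDr.
  rewrite -[X in X + _]mul1r -mulrDl -ler_pdivrMr// addrC.
  by move/ltW: h2; rewrite intrD.
rewrite -[RHS]tpi_repr; apply/tpi_eqP/forallP => i; rewrite mxE.
by rewrite addrAC subrr add0r mulNr mulfK ?gt_eqF// rpredN intr_int.
Qed.

Lemma torus_bounded (f : T -> R) : continuous f ->
  exists2 M : R, 0 <= M & forall x, `|f x| <= M.
Proof.
move=> cf; have T0 : [set: T] !=set0 by exists point.
have [|c _ hc] := @compact_EVT_max _ _ (fun x => `|f x|) setT T0 torus_compact.
  apply: continuous_subspaceT => x; apply: continuous_comp; first exact: cf.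
  exact: norm_continuous.
by exists (`|f c|) => // x; apply: hc; rewrite inE.
Qed.

Lemma torus_open_measurable (U : set T) : open U -> measurable U.
Proof. by move=> oU; exact: sub_sigma_algebra. Qed.

Lemma torus_continuous_measurable (f : T -> R) : continuous f ->
  measurable_fun [set: T] f.
Proof.
move=> /continuousP cf; apply: (measurability (@RGenOpens.G R)).
  exact: RGenOpens.measurableE.
move=> _ [_ [a [b ->]] <-]; rewrite setTI; apply: torus_open_measurable.
exact/cf/interval_open.
Qed.

(** Not a metric, but a continuous gauge vanishing exactly on the diagonal. It behaves like half the
    squared distance near the diagonal and, being trigonometric, has explicit moments against Fejer
    kernels. *)
Definition tdist (x y : T) : R :=
  \sum_(i < d) (1 - cos (repr x ord0 i - repr y ord0 i)).

Lemma tdist_ge0 x y : 0 <= tdist x y.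
Proof. by apply: sumr_ge0 => i _; rewrite subr_ge0 cos_le1. Qed.

Lemma tdist_eq0 x y : tdist x y = 0 -> x = y.
Proof.
move=> /eqP; rewrite psumr_eq0 => [|i _]; last by rewrite subr_ge0 cos_le1.
move=> /allP h; rewrite -[x]tpi_repr -[y]tpi_repr; apply/tpi_eqP/forallP => i.
apply: cos_eq1; have /= := h i (mem_index_enum i).
by rewrite subr_eq0 => /eqP <-.
Qed.

Lemma tdist_continuous : continuous (fun p : T * T => tdist p.1 p.2).
Proof.
pose c (e : R) i (x : T) := cos (1%:~R * repr x ord0 i + e).
have cc e i : continuous (c e i) by exact: cos_coord_continuous.
have -> : (fun p : T * T => tdist p.1 p.2) = fun p => \sum_(i < d)
    (1 - (c 0 i p.1 * c 0 i p.2 + c (- (pi / 2)) i p.1 * c (- (pi / 2)) i p.2)).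
  apply/funext => p; apply: eq_bigr => i _; congr (_ - _).
  by rewrite cosB /c !mul1r !addr0 !cosBpihalf.
apply: continuous_bigsum => i _ p.
have c1 e : {for p, continuous (fun p : T * T => c e i p.1)}.
  by apply: (@continuous_comp _ _ _ fst (c e i)); [exact: cvg_fst|exact: cc].
have c2 e : {for p, continuous (fun p : T * T => c e i p.2)}.
  by apply: (@continuous_comp _ _ _ snd (c e i)); [exact: cvg_snd|exact: cc].
apply: (@cvgB _ R^o) => /=; first exact: cvg_cst.
by apply: (@cvgD _ R^o) => /=; apply: cvgM; (exact: c1 || exact: c2).
Qed.

(** Uniform continuity in a form that can be averaged. On the compact set where
    [|chi x - chi y| >= e] the gauge has a positive minimum [m], and the oscillation, at most [2 M],
    is there at most [2 M / m * tdist x y]. *)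
Lemma continuous_tdist_le (chi : T -> R) (e : R) : continuous chi -> 0 < e ->
  exists2 C : R, 0 <= C & forall x y, `|chi x - chi y| <= e + C * tdist x y.
Proof.
move=> cchi e0; have [M M0 hM] := torus_bounded cchi.
pose F (p : T * T) := `|chi p.1 - chi p.2|.
have cF : continuous F.
  move=> p; apply: (@continuous_comp _ _ _ (fun p : T * T => chi p.1 - chi p.2)
    Num.norm); last exact: norm_continuous.
  apply: continuousB.
    by apply: (@continuous_comp _ _ _ fst chi); [exact: cvg_fst|exact: cchi].
  by apply: (@continuous_comp _ _ _ snd chi); [exact: cvg_snd|exact: cchi].
pose A := [set p | e <= F p].
have [A0|] := pselect (A !=set0); last first.
  move=> A0; exists 0 => // x y; rewrite mul0r addr0 leNgt; apply/negP => h.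
  by apply: A0; exists (x, y); exact: ltW.
have cA : compact A.
  apply: (@subclosed_compact _ _ [set: T * T]) => //.
    exact: (closed_comp (fun p _ => cF p) (@closed_ge _ e)).
  by rewrite -setXTT; apply: compact_setX; exact: torus_compact.
have [|p /set_mem pA hp] := @compact_EVT_min _ _ (fun p => tdist p.1 p.2) A A0 cA.
  by apply: continuous_subspaceT; exact: tdist_continuous.
have m0 : 0 < tdist p.1 p.2.
  rewrite lt_neqAle tdist_ge0 andbT eq_sym; apply/eqP => /tdist_eq0 h.
  by move: pA; rewrite /A/= /F h subrr normr0 leNgt e0.
exists (2 * M / tdist p.1 p.2) => [|x y].
  by rewrite divr_ge0 ?mulr_ge0// ltW.
have [h|h] := leP e `|chi x - chi y|; last first.
  by rewrite (le_trans (ltW h))// lerDl mulr_ge0 ?tdist_ge0// divr_ge0 ?mulr_ge0// ltW.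
have := hp (x, y); rewrite inE => /(_ h) /= hxy.
apply: (le_trans (ler_normB _ _)); rewrite -[leLHS]add0r lerD ?(ltW e0)//.
apply: (@le_trans _ _ (2 * M)); first by have := hM x; have := hM y; lra.
by rewrite mulrAC ler_pdivlMr// ler_wpM2l// mulr_ge0.
Qed.

End torus_topology.

(** * Fejer partition of unity *)

Section fejer.
Context (R : realType).
Implicit Types (s : R) (n : nat).

Let C n s : R := \sum_(a < n) cos (a%:R * s).
Let S n s : R := \sum_(a < n) sin (a%:R * s).

(** [C + i S] is the sum of [e^{i a s}] over [a < n]. Its squared modulus divided by [n] is the
    Fejer kernel; the factor [n + 1] normalises it for summation over [n + 1] equidistant nodes. *)
Definition fejer n s := (C n s ^+ 2 + S n s ^+ 2) / (n.+1%:R * n%:R).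

Lemma fejer_ge0 n s : 0 <= fejer n s.
Proof. by rewrite divr_ge0// addr_ge0// sqr_ge0. Qed.

(** Real part of [(1 - e^{is}) (C + i S) = 1 - e^{ins}]; [telescope_S] is the imaginary part. *)
Let telescope_C n s : (1 - cos s) * C n s + sin s * S n s = 1 - cos (n%:R * s).
Proof.
elim: n => [|n IH]; first by rewrite /C /S !big_ord0 mul0r cos0; lra.
rewrite /C /S !big_ord_recr/= -/(C n s) -/(S n s).
have -> : n.+1%:R * s = n%:R * s + s by rewrite -natr1; ring.
rewrite cosD.
by move: IH; set c := C _ _; set e := S _ _; nra.
Qed.

Let telescope_S n s : (1 - cos s) * S n s - sin s * C n s = - sin (n%:R * s).
Proof.
elim: n => [|n IH]; first by rewrite /C /S !big_ord0 mul0r sin0; lra.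
rewrite /C /S !big_ord_recr/= -/(C n s) -/(S n s).
have -> : n.+1%:R * s = n%:R * s + s by rewrite -natr1; ring.
rewrite sinD.
by move: IH; set c := C _ _; set e := S _ _; nra.
Qed.

(** Squared moduli in the telescoped geometric sum, with [|1 - e^{is}|^2 = 2 (1 - cos s)]. The
    numerator on the right stays bounded, whence the concentration at 0. *)
Lemma fejer_moment n s :
  fejer n s * (1 - cos s) = (1 - cos (n%:R * s)) / (n.+1%:R * n%:R).
Proof.
rewrite /fejer mulrAC; congr (_ / _).
have h1 := telescope_C n s; have h2 := telescope_S n s.
have h3 : (C n s ^+ 2 + S n s ^+ 2) * ((1 - cos s) ^+ 2 + sin s ^+ 2) =
    (1 - cos (n%:R * s)) ^+ 2 + sin (n%:R * s) ^+ 2.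
  by rewrite -h1 -(sqrrN (sin (n%:R * s))) -h2; ring.
have t1 := cos2Dsin2 s; have t2 := cos2Dsin2 (n%:R * s).
have e1 : (1 - cos s) ^+ 2 + sin s ^+ 2 = 2 * (1 - cos s) by move: t1; nra.
have e2 : (1 - cos (n%:R * s)) ^+ 2 + sin (n%:R * s) ^+ 2 =
  2 * (1 - cos (n%:R * s)) by move: t2; nra.
by move: h3; rewrite e1 e2; lra.
Qed.

Lemma sum_cos_arith (x h : R) n :
  2 * sin h * \sum_(j < n) cos (x + j%:R * (2 * h)) =
  sin (x - h + n%:R * (2 * h)) - sin (x - h).
Proof.
elim: n => [|n IH]; first by rewrite big_ord0 mul0r addr0 subrr mulr0.
rewrite big_ord_recr/= mulrDr IH.
set y := x + n%:R * (2 * h).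
have -> : x - h + n%:R * (2 * h) = y - h by rewrite /y; ring.
have -> : x - h + n.+1%:R * (2 * h) = y + h by rewrite /y -addn1 natrD; ring.
by rewrite (sinB y) (sinD y); ring.
Qed.

Lemma sum_cos_roots (x : R) (l N : nat) : (0 < l < N)%N ->
  \sum_(j < N) cos (x + l%:R * (2 * pi * j%:R / N%:R)) = 0.
Proof.
move=> /andP[l0 lN].
have N0 : 0 < N%:R :> R by rewrite ltr0n (leq_ltn_trans _ lN).
(* With this half step the [N] terms run through [l] full turns, so the telescoped difference
   vanishes while [sin h] is positive. *)
pose h : R := pi * l%:R / N%:R.
have sh : 0 < sin h.
  apply: sin_gt0_pi; apply/andP; split.
    by rewrite /h divr_gt0// mulr_gt0 ?pi_gt0// ltr0n.
  by rewrite /h ltr_pdivrMr// ltr_pM2l ?pi_gt0// ltr_nat.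
have := sum_cos_arith x h N.
have -> : x - h + N%:R * (2 * h) = x - h + l%:Z%:~R * (2 * pi).
  by rewrite /h; field; rewrite gt_eqF.
rewrite sin_int_periodic subrr => /eqP; rewrite !mulf_eq0 pnatr_eq0/=.
rewrite (gt_eqF sh)/= => /eqP hs; rewrite -[RHS]hs; apply: eq_bigr => j _.
by congr cos; rewrite /h; field; rewrite gt_eqF.
Qed.

(** Expanding the squares gives the frequencies [a - b], with [|a - b| < n]. Summation over [n + 1]
    nodes kills all of them except the [n] diagonal ones, which contribute [n + 1] each. *)
Lemma fejer_sum1 n s : (0 < n)%N ->
  \sum_(j < n.+1) fejer n (s - 2 * pi * j%:R / n.+1%:R) = 1.
Proof.
move=> n0; rewrite /fejer -mulr_suml.
have hE t : C n t ^+ 2 + S n t ^+ 2 = \sum_(a < n) \sum_(b < n) cos ((a%:R - b%:R) * t).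
  rewrite !expr2 /C /S !mulr_suml -big_split/=; apply: eq_bigr => a _.
  rewrite !mulr_sumr -big_split/=; apply: eq_bigr => b _.
  by rewrite mulrBl cosB.
under eq_bigr do rewrite hE.
rewrite exchange_big/=.
transitivity (\sum_(a < n) (n.+1%:R : R) / (n.+1%:R * n%:R)); last first.
  rewrite sumr_const card_ord -[_ *+ n]mulr_natr mulrAC.
  by rewrite divff// mulf_neq0// pnatr_eq0// -lt0n.
rewrite -!mulr_suml; congr (_ / _); apply: eq_bigr => a _.
rewrite exchange_big/= (bigD1 a)//= [X in _ + X]big1 ?addr0.
  under eq_bigr do rewrite subrr mul0r cos0.
  by rewrite sumr_const card_ord.
move=> b ba.
have [ab|ab] := ltnP a b.
  have := @sum_cos_roots ((a%:R - b%:R) * s) (b - a)%N n.+1.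
  rewrite subn_gt0 ab/= (leq_ltn_trans (leq_subr _ _)) ?ltnS 1?ltnW//=.
  move=> /(_ isT) h; rewrite -[RHS]h; apply: eq_bigr => j _; congr cos.
  by rewrite natrB 1?ltnW//; ring.
have {}ab : (b < a)%N by rewrite ltn_neqAle ba.
have := @sum_cos_roots (- ((a%:R - b%:R) * s)) (a - b)%N n.+1.
rewrite subn_gt0 ab/= (leq_ltn_trans (leq_subr _ _)) ?ltnS 1?ltnW//=.
move=> /(_ isT) h; rewrite -[RHS]h; apply: eq_bigr => j _; rewrite -cosN; congr cos.
by rewrite natrB 1?ltnW//; ring.
Qed.

Lemma fejer_moment_sum n s : (0 < n)%N ->
  \sum_(j < n.+1) fejer n (s - 2 * pi * j%:R / n.+1%:R) *
    (1 - cos (s - 2 * pi * j%:R / n.+1%:R)) <= 2 / n%:R.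
Proof.
move=> n0; under eq_bigr do rewrite fejer_moment.
apply: (@le_trans _ _ (\sum_(j < n.+1) 2 / (n.+1%:R * n%:R))).
  apply: ler_sum => j _; rewrite ler_pM2r ?invr_gt0 ?mulr_gt0 ?ltr0n//.
  set t := _ * _; have : -1 <= cos t by exact: cos_geN1.
  by lra.
rewrite sumr_const card_ord -[leLHS]mulr_natr.
by rewrite invfM mulrA mulrAC mulrVK ?unitfE ?pnatr_eq0// mulrC.
Qed.

End fejer.

Section partition_of_unity.
Context (R : realType) (d : nat).
Local Notation T := (torus R d).
Implicit Types (x y : T) (n : nat).

(** Nodes for [fejer n.+1], whose order is positive for every [n]; there is one node more than the
    order. *)
Definition grid_index n := {ffun 'I_d -> 'I_n.+2}.

Definition grid_coord n (j : 'I_n.+2) : R := 2 * pi * j%:R / n.+2%:R.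

Definition grid_pt n (J : grid_index n) : T := tpi (\row_i grid_coord (J i)).

(* Products of Fejer kernels centred at the points of a regular grid: a partition
   of unity by trigonometric polynomials, concentrating as [n] grows. *)
Definition bump n (J : grid_index n) x : R :=
  \prod_(i < d) fejer n.+1 (repr x ord0 i - grid_coord (J i)).

Lemma bump_ge0 n J x : 0 <= @bump n J x.
Proof. by apply: prodr_ge0 => i _; exact: fejer_ge0. Qed.

Lemma bump_sum1 n x : \sum_J @bump n J x = 1.
Proof.
rewrite -(bigA_distr_bigA
  (fun i (j : 'I_n.+2) => fejer n.+1 (repr x ord0 i - grid_coord j)))/=.
by apply: big1 => i _; exact: fejer_sum1.
Qed.

Lemma bump_le1 n J x : @bump n J x <= 1.
Proof.
by rewrite -(bump_sum1 n x) (bigD1 J)//= lerDl sumr_ge0// => *; exact: bump_ge0.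
Qed.

Lemma fejer_coord_continuous n i (c : R) :
  continuous (fun x : T => fejer n (repr x ord0 i - c)).
Proof.
have cc (a : nat) (e : R) : continuous (fun x : T => cos (a%:R * repr x ord0 i + e)).
  exact: (@cos_coord_continuous _ _ i a%:Z).
have cC : continuous (fun x : T => \sum_(a < n) cos (a%:R * (repr x ord0 i - c))).
  apply: continuous_bigsum => a _ /=.
  by under eq_fun do rewrite mulrBr; exact: cc.
have cS : continuous (fun x : T => \sum_(a < n) sin (a%:R * (repr x ord0 i - c))).
  apply: continuous_bigsum => a _ /=.
  by under eq_fun do rewrite mulrBr -cosBpihalf -addrA; exact: cc.
move=> x; unfold fejer.
apply: (@cvgM _ _ (nbhs x)); last exact: cvg_cst.
by apply: (@cvgD _ R^o _ (nbhs x)); apply: (@cvgM _ _ (nbhs x)); (exact: cC || exact: cS).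
Qed.

Lemma bump_continuous n J : continuous (@bump n J).
Proof.
by apply: continuous_bigprod => i _; exact: fejer_coord_continuous.
Qed.

Lemma tdist_tpi x (a : 'rV[R]_d) :
  tdist x (tpi a) = \sum_(i < d) (1 - cos (repr x ord0 i - a ord0 i)).
Proof.
apply: eq_bigr => i _; have [m ->] := repr_tpi a i.
by rewrite opprD addrA -mulNr -mulrNz cos_int_periodic.
Qed.

Lemma bump_moment n x :
  \sum_J @bump n J x * tdist x (grid_pt J) <= 2 * d%:R / n.+1%:R.
Proof.
under eq_bigr do rewrite tdist_tpi mulr_sumr.
rewrite exchange_big/=.
apply: (@le_trans _ _ (\sum_(i < d) 2 / n.+1%:R)); last first.
  by rewrite sumr_const card_ord -[leLHS]mulr_natr mulrAC.
apply: ler_sum => i _.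
(* The weight [1 - cos] sits in the factor [k = i] only; the sum over [J] then factors into one
   moment and [d - 1] sums equal to 1. *)
pose F k (j : 'I_n.+2) : R := fejer n.+1 (repr x ord0 k - grid_coord j) *
  (if k == i then 1 - cos (repr x ord0 k - grid_coord j) else 1).
rewrite [leLHS](_ : _ = \prod_(k < d) \sum_j F k j).
  rewrite (bigD1 i)//= [X in _ * X]big1 ?mulr1 => [|k /negbTE ki].
    by rewrite /F eqxx; exact: fejer_moment_sum.
  by rewrite /F ki; under eq_bigr do rewrite mulr1; exact: fejer_sum1.
rewrite bigA_distr_bigA; apply: eq_bigr => J _.
rewrite /F big_split/=; congr (_ * _).
by rewrite -big_mkcond/= big_pred1_eq mxE.
Qed.

Definition bump_approx n (chi : T -> R) x : R :=
  \sum_(J : grid_index n) chi (grid_pt J) * bump J x.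

(** Bernstein's argument: the bumps are weights of total mass 1, so the error is an average of
    [chi x - chi (grid_pt J)]. By [continuous_tdist_le] it is at most [e / 2] plus a multiple of the
    moment, which is of order [1 / n]. *)
Lemma bump_approx_cvg (chi : T -> R) (e : R) : continuous chi -> 0 < e ->
  \forall n \near \oo, forall x, `|chi x - bump_approx n chi x| <= e.
Proof.
move=> cchi e0; have e20 : 0 < e / 2 by rewrite divr_gt0.
have [C C0 hC] := continuous_tdist_le cchi e20.
near=> n => x.
have -> : chi x - bump_approx n chi x =
    \sum_(J : grid_index n) (chi x - chi (grid_pt J)) * bump J x.
  rewrite -[in LHS](mulr1 (chi x)) -(bump_sum1 n x) mulr_sumr -sumrB.
  by apply: eq_bigr => J _; rewrite mulrBl.
apply: (le_trans (ler_norm_sum _ _ _)).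
apply: (@le_trans _ _ (\sum_(J : grid_index n)
    (e / 2 * bump J x + C * (bump J x * tdist x (grid_pt J))))).
  apply: ler_sum => J _; rewrite normrM (ger0_norm (bump_ge0 _ _)).
  rewrite [C * _]mulrCA [bump J x * _]mulrC -mulrDl.
  by rewrite ler_wpM2r ?bump_ge0.
rewrite big_split/= -!mulr_sumr bump_sum1 mulr1 [leRHS]splitr lerD2l.
apply: (@le_trans _ _ (C * (2 * d%:R / n.+1%:R))).
  by rewrite ler_wpM2l// bump_moment.
rewrite mulrA ler_pdivrMr// -ler_pdivrMl//.
apply: (@le_trans _ _ (n%:R : R)); last by rewrite ler_nat.
by near: n; exact: nbhs_infty_ger.
Unshelve. all: by end_near. Qed.

End partition_of_unity.

(** * Square-integrable functions *)

Section square_integrable.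
Context d0 (X : measurableType d0) (R : realType) (mu : {measure set X -> \bar R}).
Implicit Types (f g h : X -> R).

Definition sqint f := measurable_fun [set: X] f /\
  mu.-integrable [set: X] (EFin \o (fun x => f x ^+ 2)).

Lemma integrable_dominated f g : measurable_fun [set: X] f ->
  (forall x, `|f x| <= g x) -> mu.-integrable [set: X] (EFin \o g) ->
  mu.-integrable [set: X] (EFin \o f).
Proof.
move=> mf fg; apply: le_integrable => //; first exact/measurable_EFinP.
by move=> x _ /=; rewrite lee_fin (le_trans (fg x))// ler_norm.
Qed.

Lemma integrableD_EFin f g : mu.-integrable [set: X] (EFin \o f) ->
  mu.-integrable [set: X] (EFin \o g) ->
  mu.-integrable [set: X] (EFin \o (fun x => f x + g x)).
Proof. by move=> h1 h2; have := integrableD measurableT h1 h2. Qed.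

Lemma integrableB_EFin f g : mu.-integrable [set: X] (EFin \o f) ->
  mu.-integrable [set: X] (EFin \o g) ->
  mu.-integrable [set: X] (EFin \o (fun x => f x - g x)).
Proof. by move=> h1 h2; have := integrableB measurableT h1 h2. Qed.

Lemma integrableZ_EFin f (k : R) : mu.-integrable [set: X] (EFin \o f) ->
  mu.-integrable [set: X] (EFin \o (fun x => k * f x)).
Proof. by move=> h1; have := integrableZl measurableT k h1. Qed.

Lemma integrable_measurable f : mu.-integrable [set: X] (EFin \o f) ->
  measurable_fun [set: X] f.
Proof. by move=> fi; apply/measurable_EFinP; exact: measurable_int fi. Qed.

Lemma Rintegral_dist_le f g F : mu.-integrable [set: X] (EFin \o f) ->
  mu.-integrable [set: X] (EFin \o g) -> mu.-integrable [set: X] (EFin \o F) ->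
  (forall x, `|f x - g x| <= F x) ->
  `|\int[mu]_x f x - \int[mu]_x g x| <= \int[mu]_x F x.
Proof.
move=> fi gi Fi fgF; rewrite -RintegralB//.
have di := integrableB_EFin fi gi.
apply: le_trans (le_normr_Rintegral _ _) _ => //.
apply: le_Rintegral => //; apply: (integrable_dominated _ _ Fi) => [|x].
  by apply: measurableT_comp => //; exact: integrable_measurable di.
by rewrite normr_id.
Qed.

Lemma sqintM f g : sqint f -> sqint g ->
  mu.-integrable [set: X] (EFin \o (fun x => f x * g x)).
Proof.
move=> [mf f2] [mg g2].
apply: (@integrable_dominated _ (fun x => f x ^+ 2 + g x ^+ 2)).
- exact: measurable_funM.
- move=> x; rewrite ler_norml; have := sqr_ge0 (f x - g x).
  by have := sqr_ge0 (f x + g x); rewrite !expr2; nra.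
- exact: integrableD_EFin.
Qed.

Lemma sqintD f g : sqint f -> sqint g -> sqint (fun x => f x + g x).
Proof.
move=> [mf f2] [mg g2]; split; first exact: measurable_funD.
apply: (@integrable_dominated _ (fun x => 2 * (f x ^+ 2 + g x ^+ 2))).
- by apply: measurable_funX; exact: measurable_funD.
- move=> x; rewrite ger0_norm ?sqr_ge0//.
  by have := sqr_ge0 (f x - g x); rewrite !expr2; nra.
- by apply: integrableZ_EFin; exact: integrableD_EFin.
Qed.

Lemma sqintZ f (k : R) : sqint f -> sqint (fun x => k * f x).
Proof.
move=> [mf f2]; split; first exact: measurable_funM.
rewrite [X in _ \o X](_ : _ = fun x => k ^+ 2 * f x ^+ 2).
  exact: integrableZ_EFin.
by apply/funext => x; rewrite exprMn.
Qed.

Lemma sqintN f : sqint f -> sqint (fun x => - f x).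
Proof.
by move=> /(sqintZ (-1)); congr sqint; apply/funext => x; rewrite mulN1r.
Qed.

Lemma sqintB f g : sqint f -> sqint g -> sqint (fun x => f x - g x).
Proof. by move=> hf /sqintN; exact: sqintD. Qed.

Lemma sqint_le f g : measurable_fun [set: X] f -> sqint g ->
  (forall x, `|f x| <= `|g x|) -> sqint f.
Proof.
move=> mf [mg g2] fg; split => //.
apply: (integrable_dominated _ _ g2); first exact: measurable_funX.
move=> x; rewrite ger0_norm ?sqr_ge0// -[leLHS]real_normK ?num_real//.
by rewrite -[leRHS]real_normK ?num_real// lerXn2r ?nnegrE.
Qed.

Lemma sqint0 : sqint (fun=> 0).
Proof.
split => //; under [X in _ \o X]eq_fun do rewrite expr0n.
exact: integrable0.
Qed.

End square_integrable.

Section hermitian.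
Context d0 (X : measurableType d0) (R : realType) (mu : {measure set X -> \bar R}).
Local Notation Rf u := (fun x => complex.Re (u x)).
Local Notation If u := (fun x => complex.Im (u x)).
Implicit Types (u v w : X -> R[i]).

Definition sqintC u := sqint mu (Rf u) /\ sqint mu (If u).

(** The inner product [int u conj(v)], split into real and imaginary parts as two integrals of real
    functions. *)
Definition herm u v : R[i] :=
  (\int[mu]_x (complex.Re (u x) * complex.Re (v x) + complex.Im (u x) * complex.Im (v x)) +i*
   \int[mu]_x (complex.Im (u x) * complex.Re (v x) - complex.Re (u x) * complex.Im (v x)))%C.

Definition energy u : R := \int[mu]_x (complex.Re (u x) ^+ 2 + complex.Im (u x) ^+ 2).

Lemma ReM (x y : R[i]) : complex.Re (x * y) = complex.Re x * complex.Re y - complex.Im x *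
  complex.Im y.
Proof. by case: x y => [a b] [a' b']. Qed.

Lemma ImM (x y : R[i]) : complex.Im (x * y) = complex.Re x * complex.Im y + complex.Im x *
  complex.Re y.
Proof. by case: x y => [a b] [a' b']. Qed.

Lemma ReD (x y : R[i]) : complex.Re (x + y) = complex.Re x + complex.Re y.
Proof. by case: x y => [a b] [a' b']. Qed.

Lemma ImD (x y : R[i]) : complex.Im (x + y) = complex.Im x + complex.Im y.
Proof. by case: x y => [a b] [a' b']. Qed.

Lemma ReN (x : R[i]) : complex.Re (- x) = - complex.Re x.
Proof. by case: x. Qed.

Lemma ImN (x : R[i]) : complex.Im (- x) = - complex.Im x.
Proof. by case: x. Qed.

Lemma complex_eq (x y : R[i]) :
  complex.Re x = complex.Re y -> complex.Im x = complex.Im y -> x = y.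
Proof. by case: x y => [a b] [a' b'] /= -> ->. Qed.

Lemma normc_sqr (x : R[i]) : normc x ^+ 2 = complex.Re x ^+ 2 + complex.Im x ^+ 2.
Proof. by case: x => [a b] /=; rewrite sqr_sqrtr// addr_ge0// sqr_ge0. Qed.

Lemma sqintCD u v : sqintC u -> sqintC v -> sqintC (fun x => u x + v x).
Proof.
move=> [u1 u2] [v1 v2]; split.
  by under eq_fun do rewrite ReD; exact: sqintD.
by under eq_fun do rewrite ImD; exact: sqintD.
Qed.

Lemma sqintCZ (c : R[i]) u : sqintC u -> sqintC (fun x => c * u x).
Proof.
move=> [u1 u2]; split.
  by under eq_fun do rewrite ReM; apply: sqintB; exact: sqintZ.
by under eq_fun do rewrite ImM; apply: sqintD; exact: sqintZ.
Qed.

Lemma sqintCB u v : sqintC u -> sqintC v -> sqintC (fun x => u x - v x).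
Proof.
move=> [u1 u2] [v1 v2]; split.
  by under eq_fun do rewrite ReD ReN; exact: sqintB.
by under eq_fun do rewrite ImD ImN; exact: sqintB.
Qed.

Lemma sqintC0 : sqintC (fun=> 0).
Proof. by split; exact: sqint0. Qed.

Lemma sqintC_sum (I : Type) (r : seq I) (F : I -> X -> R[i]) :
  (forall i, sqintC (F i)) -> sqintC (fun x => \sum_(i <- r) F i x).
Proof.
move=> hF; elim: r => [|i r IH].
  by under eq_fun do rewrite big_nil; exact: sqintC0.
by under eq_fun do rewrite big_cons; exact: sqintCD.
Qed.

Let int1 u v : sqintC u -> sqintC v -> mu.-integrable [set: X]
  (EFin \o (fun x => complex.Re (u x) * complex.Re (v x) + complex.Im (u x) * complex.Im (v x))).
Proof. by move=> [? ?] [? ?]; apply: integrableD_EFin; exact: sqintM. Qed.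

Let int2 u v : sqintC u -> sqintC v -> mu.-integrable [set: X]
  (EFin \o (fun x => complex.Im (u x) * complex.Re (v x) - complex.Re (u x) * complex.Im (v x))).
Proof. by move=> [? ?] [? ?]; apply: integrableB_EFin; exact: sqintM. Qed.

Lemma integrable_energy u : sqintC u -> mu.-integrable [set: X]
  (EFin \o (fun x => complex.Re (u x) ^+ 2 + complex.Im (u x) ^+ 2)).
Proof. by move=> [[_ ?] [_ ?]]; exact: integrableD_EFin. Qed.

Lemma energy_ge0 u : 0 <= energy u.
Proof. by apply: Rintegral_ge0 => x _; rewrite addr_ge0// sqr_ge0. Qed.

Lemma hermD u v w : sqintC u -> sqintC v -> sqintC w ->
  herm (fun x => u x + v x) w = herm u w + herm v w.
Proof.
move=> hu hv hw; apply: complex_eq; rewrite ?ReD ?ImD/=.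
  rewrite -RintegralD//; [|exact: int1|exact: int1].
  by apply: eq_Rintegral => x _; rewrite ReD ImD; ring.
rewrite -RintegralD//; [|exact: int2|exact: int2].
by apply: eq_Rintegral => x _; rewrite ReD ImD; ring.
Qed.

Lemma hermZ (c : R[i]) u w : sqintC u -> sqintC w ->
  herm (fun x => c * u x) w = c * herm u w.
Proof.
move=> hu hw; apply: complex_eq; rewrite ?ReM ?ImM/=.
  rewrite -!RintegralZl//; [|exact: int2|exact: int1].
  rewrite -RintegralB//; [|by apply: integrableZ_EFin; exact: int1|
    by apply: integrableZ_EFin; exact: int2].
  by apply: eq_Rintegral => x _; rewrite ReM ImM; ring.
rewrite -!RintegralZl//; [|exact: int1|exact: int2].
rewrite -RintegralD//; [|by apply: integrableZ_EFin; exact: int2|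
  by apply: integrableZ_EFin; exact: int1].
by apply: eq_Rintegral => x _; rewrite ReM ImM; ring.
Qed.

Lemma hermB u v w : sqintC u -> sqintC v -> sqintC w ->
  herm (fun x => u x - v x) w = herm u w - herm v w.
Proof.
move=> hu hv hw; rewrite -[X in _ = _ + X]mulN1r -hermZ// -hermD//.
  by congr herm; apply/funext => x; rewrite mulN1r.
exact: sqintCZ.
Qed.

Lemma herm_sum (I : Type) (r : seq I) (c : I -> R[i]) (F : I -> X -> R[i]) w :
  (forall i, sqintC (F i)) -> sqintC w ->
  herm (fun x => \sum_(i <- r) c i * F i x) w = \sum_(i <- r) c i * herm (F i) w.
Proof.
move=> hF hw; elim: r => [|i r IH].
  rewrite big_nil; under eq_fun do rewrite big_nil.
  rewrite -[RHS](mul0r (herm (fun=> 0) w)) -(hermZ 0 sqintC0 hw).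
  by congr herm; apply/funext => x; rewrite mulr0.
rewrite big_cons -IH -hermZ// -hermD//; [|exact: sqintCZ|].
  by congr herm; apply/funext => x; rewrite big_cons.
by apply: sqintC_sum => j; exact: sqintCZ.
Qed.

Lemma hermC u v : sqintC u -> sqintC v -> herm u v = conjc (herm v u).
Proof.
move=> hu hv; apply: complex_eq => /=; first by apply: eq_Rintegral => x _; ring.
rewrite -mulN1r -RintegralZl//; last exact: int2.
by apply: eq_Rintegral => x _; ring.
Qed.

Lemma herm_diag u : herm u u = (energy u)%:C%C.
Proof.
apply: complex_eq => /=; first by apply: eq_Rintegral => x _; rewrite !expr2.
under eq_Rintegral do rewrite mulrC subrr.
by rewrite Rintegral_cst// mul0r.
Qed.

Lemma energyD u v : sqintC u -> sqintC v ->
  energy (fun x => u x + v x) = energy u + energy v + 2 * complex.Re (herm u v).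
Proof.
move=> hu hv; rewrite /energy /=.
rewrite -RintegralZl//; last exact: int1.
rewrite -RintegralD//; [|exact: integrable_energy|exact: integrable_energy].
rewrite -RintegralD//.
- by apply: eq_Rintegral => x _; rewrite ReD ImD; ring.
- by apply: integrableD_EFin; exact: integrable_energy.
- by apply: integrableZ_EFin; exact: int1.
Qed.

(** The right-hand side exceeds the left by the energy of [u - v]. *)
Lemma energyD_le u v : sqintC u -> sqintC v ->
  energy (fun x => u x + v x) <= 2 * energy u + 2 * energy v.
Proof.
move=> hu hv; rewrite /energy -!RintegralZl//; try exact: integrable_energy.
rewrite -RintegralD//; try by apply: integrableZ_EFin; exact: integrable_energy.
apply: le_Rintegral => //.
- by apply: integrable_energy; exact: sqintCD.
- by apply: integrableD_EFin; apply: integrableZ_EFin; exact: integrable_energy.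
- move=> x _; rewrite ReD ImD -subr_ge0.
  rewrite [leRHS](_ : _ = (complex.Re (u x) - complex.Re (v x)) ^+ 2 +
    (complex.Im (u x) - complex.Im (v x)) ^+ 2); last by ring.
  by rewrite addr_ge0// sqr_ge0.
Qed.

Lemma energyZ (c : R[i]) u : sqintC u ->
  energy (fun x => c * u x) = normc c ^+ 2 * energy u.
Proof.
move=> hu; rewrite normc_sqr /energy -RintegralZl//; last exact: integrable_energy.
by apply: eq_Rintegral => x _; rewrite ReM ImM; ring.
Qed.

Lemma energy_orth u v : sqintC u -> sqintC v -> herm u v = 0 ->
  energy (fun x => u x + v x) = energy u + energy v.
Proof. by move=> hu hv h; rewrite energyD// h mulr0 addr0. Qed.

End hermitian.

(** * Fourier coefficients and Parseval's identity *)

Section torus_measure_integral.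
Context (R : realType).
Local Notation lambda := (@lebesgue_measure R).

Let box_measure n : {measure set (n.-tuple R) -> \bar R} :=
  mrestr (lebesgue_tuple R n) (@measurable_fundamental_box R n).

Let I2pi : set (measurableTypeR R) := [set` `[0, 2 * pi[].
Let mI2pi : measurable I2pi. Proof. exact: measurable_itv. Qed.
Let I2pi_fin : (lambda I2pi < +oo)%E.
Proof.
by rewrite /I2pi lebesgue_measure_itv/= lte_fin mulr_gt0 ?pi_gt0// oppr0 adde0 ltry.
Qed.
Let circle_measure : {finite_measure set (measurableTypeR R) -> \bar R} :=
  mfrestr mI2pi I2pi_fin.

Let circle_measureT : circle_measure setT = (2 * pi)%:E.
Proof.
rewrite /circle_measure/= /mfrestr /mrestr setTI /I2pi lebesgue_measure_itv/= lte_fin.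
by rewrite mulr_gt0 ?pi_gt0// oppr0 adde0.
Qed.

Let box_measure0 : box_measure 0 setT = 1%E.
Proof.
rewrite /box_measure/= /mrestr setTI diracE mem_set//=.
by move=> [].
Qed.

Let consR n (p : n.-tuple R * measurableTypeR R) : n.+1.-tuple R :=
  [tuple of p.2 :: p.1].

Let measurable_consR n : measurable_fun [set: n.-tuple R * measurableTypeR R] (@consR n).
Proof. exact: (@measurable_cons_tuple R n). Qed.

Let box_cons n (x : n.-tuple R) (y : R) :
  @fundamental_box R n.+1 (consR (x, y)) <-> fundamental_box x /\ I2pi y.
Proof.
split=> [h|[h1 h2] i _].
  split=> [i _|]; last exact: (h ord0 I).
  by have := h (lift ord0 i) I; rewrite /= tnthS.
by rewrite /=; case: (unliftP ord0 i) => [j|] ->; rewrite ?tnthS ?tnth0//; exact: h1.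
Qed.

Let box_measureE n (h : n.-tuple R -> \bar R) : measurable_fun [set: n.-tuple R] h ->
  (forall x, 0 <= h x)%E ->
  (\int[box_measure n]_x h x = \int[lebesgue_tuple R n]_x (h x * (\1_(@fundamental_box R n)
    x)%:E))%E.
Proof.
apply: ge0_integral_density => //.
  by apply: measurable_indic; exact: measurable_fundamental_box.
move=> B mB; rewrite integral_indic//.
  by rewrite setIC.
exact: measurable_fundamental_box.
Qed.

(** Moving the restriction to the box inside the product leaves two finite measures, to which
    Fubini's theorem applies. *)
Let box_measureS_prod n (B : set (n.+1.-tuple R)) : measurable B ->
  box_measure n.+1 B = (box_measure n \x circle_measure)%E (@consR n @^-1` B).
Proof.
move=> mB; rewrite [RHS]/product_measure1.
have mcB : measurable (@consR n @^-1` B).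
  by rewrite -[X in measurable X]setTI; exact: measurable_consR.
rewrite box_measureE//; last exact: measurable_fun_xsection.
rewrite /box_measure/= /mrestr/= /image_measure/= /pushforward /product_measure1.
apply: eq_integral => x _; rewrite /= /mfrestr /mrestr.
rewrite indicE; case: (boolP (x \in _)) => xb; rewrite ?mule1 ?mule0.
  congr (lambda _); apply/seteqP; split => y; rewrite /xsection/= !inE/=.
    by move=> [By /box_cons[]].
  by move=> [By yI]; split=> //; apply/box_cons; split=> //; exact: set_mem.
rewrite (_ : xsection _ _ = set0) ?measure0//.
apply/seteqP; split => y //; rewrite /xsection/= !inE/= => -[_ /box_cons[/= h _]].
by rewrite mem_set in xb.
Qed.

Let box_measure_lty n : (box_measure n setT < +oo)%E.
Proof.
elim: n => [|n IH]; first by rewrite box_measure0 ltry.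
rewrite box_measureS_prod// preimage_setT -setXTT product_measure1E//.
rewrite [X in (_ * X)%E](_ : _ = (2 * pi)%:E); last exact: circle_measureT.
by rewrite lte_mul_pinfty// ?ge0_fin_numE// ltry.
Qed.

Let box_fin n : (lebesgue_tuple R n (@fundamental_box R n) < +oo)%E.
Proof. by have := box_measure_lty n; rewrite /box_measure/= /mrestr setTI. Qed.

Let box_fmeasure n : {finite_measure set (n.-tuple R) -> \bar R} :=
  mfrestr (@measurable_fundamental_box R n) (@box_fin n).

Let box_measureT n : box_measure n setT = ((2 * pi) ^+ n)%:E.
Proof.
elim: n => [|n IH]; first by rewrite box_measure0.
rewrite box_measureS_prod// preimage_setT -setXTT product_measure1E//.
rewrite [X in (_ * X)%E](_ : _ = (2 * pi)%:E); last exact: circle_measureT.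
by rewrite IH -EFinM exprSr.
Qed.

Let tphase n (k : 'I_n -> int) (x : n.-tuple R) : R := \sum_i (k i)%:~R * tnth x i.

Let measurable_tphase n (k : 'I_n -> int) : measurable_fun setT (@tphase n k).
Proof.
apply: measurable_sum => i; apply: measurable_funM => //.
exact: measurable_tnth.
Qed.

Let measurable_cos : measurable_fun setT (@cos R).
Proof. by apply: continuous_measurable_fun; exact: continuous_cos. Qed.

Let int_cos_circle (k : int) (c : R) :
  \int[circle_measure]_x cos (k%:~R * x + c) = if k == 0 then 2 * pi * cos c else 0.
Proof.
have [->|k0] := eqVneq k 0.
  under eq_Rintegral do rewrite mul0r add0r.
  by rewrite Rintegral_cst// [X in fine X]circle_measureT mulrC.
have kR0 : k%:~R != 0 :> R by rewrite intr_eq0.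
have ccos : continuous (fun x : R => cos (k%:~R * x + c)).
  move=> x; apply: (@continuous_comp R R R (fun x => k%:~R * x + c) (@cos R)).
    by apply: cvgD; [apply: cvgM; [exact: cvg_cst|exact: cvg_id]|exact: cvg_cst].
  exact: continuous_cos.
have mcos : measurable_fun setT (fun x : measurableTypeR R => cos (k%:~R * x + c)).
  exact: continuous_measurable_fun.
have cI : (lambda.-integrable `[0%R, 2 * pi] (EFin \o (fun x => cos (k%:~R * x + c)))).
  apply: continuous_compact_integrable; first exact: segment_compact.
  exact: continuous_subspaceT.
have pi20 : 0 < 2 * pi :> R by rewrite mulr_gt0// pi_gt0.
have mI : measurable_fun setT (\1_I2pi : measurableTypeR R -> R).
  exact: measurable_indic.
have [] := @integral_density _ _ R lambda circle_measure \1_I2pi mI _ _ _ mcos.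
- by move=> x.
- move=> B mB; rewrite integral_indic//= /mfrestr /mrestr setIC//.
- rewrite (_ : _ \o _ = (EFin \o (fun x => cos (k%:~R * x + c))) \_ I2pi).
    rewrite -integrable_mkcond//.
    apply: (integrableS _ mI2pi _ cI) => //.
    by move=> x; rewrite /I2pi/= !in_itv/= => /andP[-> /ltW].
  apply/funext => x /=; rewrite patchE indicE; case: ifP => _; by rewrite ?mulr1 ?mulr0.
move=> _ ->.
transitivity (\int[lambda]_(x in I2pi) cos (k%:~R * x + c)).
  rewrite [RHS]Rintegral_mkcond; apply: eq_Rintegral => x _.
  by rewrite patchE indicE; case: ifP => _; rewrite ?mulr1 ?mulr0.
rewrite Rintegral_itv_bndo_bndc; last first.
  apply: integrableS cI => //.
  by move=> x; rewrite /I2pi/= !in_itv/= => /andP[-> /ltW].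
have dF (x : R) : is_derive x 1 (fun x : R => k%:~R^-1 * sin (k%:~R * x + c)) (cos (k%:~R * x + c)).
  have h1 : is_derive x 1 (fun x : R => k%:~R * x + c) k%:~R.
    apply: is_derive_eq; rewrite /GRing.scale/= ?mulr1 ?mul0r ?mulr0 ?addr0//.
  have h2 : is_derive x 1 (fun x : R => sin (k%:~R * x + c)) (k%:~R * cos (k%:~R * x + c)).
    have := @is_derive1_comp _ (@sin R) (fun x : R => k%:~R * x + c) x _ _ (is_derive_sin _) h1.
    by rewrite mulrC.
  have := @is_deriveZ _ _ _ _ (k%:~R^-1) x 1 _ h2.
  by rewrite /GRing.scale/= mulrA mulVf// mul1r.
have cF : continuous (fun x : R => k%:~R^-1 * sin (k%:~R * x + c)).
  by move=> x; apply: differentiable_continuous; apply/derivable1_diffP.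
rewrite /Rintegral (@continuous_FTC2 _ _ (fun x : R => k%:~R^-1 * sin (k%:~R * x + c)))//=.
- by rewrite mulr0 add0r [_ * (2 * pi) + c]addrC sin_int_periodic subrr.
- exact: continuous_subspaceT.
- split.
  + by move=> x _.
  + by apply: cvg_at_right_filter; exact: cF.
  + by apply: cvg_at_left_filter; exact: cF.
- by move=> x _; rewrite derive1E; exact: derive_val.
Qed.

Let tphaseS n (k : 'I_n.+1 -> int) (x : n.-tuple R) (y : R) :
  tphase k (consR (x, y)) = tphase (fun i => k (lift ord0 i)) x + (k ord0)%:~R * y.
Proof.
rewrite /tphase big_ord_recl/= addrC; congr (_ + _).
by apply: eq_bigr => i _; rewrite tnthS.
Qed.

(** The free phase [c] carries the induction: once the head coordinate [y] is fixed, [k0 y + c] is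
    the phase for the remaining ones. *)
Let int_cos_box n (k : 'I_n -> int) (c : R) :
  \int[box_measure n]_x cos (tphase k x + c) =
  if [forall i, k i == 0] then (2 * pi) ^+ n * cos c else 0.
Proof.
elim: n k c => [|n IH] k c.
  under eq_Rintegral do rewrite /tphase big_ord0 add0r.
  rewrite Rintegral_cst// [X in fine X]box_measure0 mulr1 expr0 mul1r.
  by case: ifPn => // /forallPn[[]].
have mcos m (k' : 'I_m -> int) c' : measurable_fun setT (fun x : m.-tuple R => cos (tphase k' x
  + c')).
  apply: (measurableT_comp measurable_cos).
  by apply: measurable_funD => //; exact: measurable_tphase.
transitivity (\int[image_measure (box_fmeasure n \x circle_measure)%E (@measurable_consR n)]_x
    cos (tphase k x + c)).
  rewrite /Rintegral; congr fine; apply: eq_measure_integral => A mA _.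
  exact: box_measureS_prod.
pose F (p : n.-tuple R * measurableTypeR R) := cos (tphase k (consR p) + c).
have mF : measurable_fun setT F.
  apply: (measurableT_comp (mcos _ k c)); exact: measurable_consR.
have bF p : `|F p| <= 1 by rewrite ler_norml cos_geN1 cos_le1.
have iF : ((box_fmeasure n \x circle_measure)%E).-integrable setT (EFin \o F).
  apply: measurable_bounded_integrable => //.
    have := box_measure_lty n.+1.
    by rewrite (box_measureS_prod measurableT) preimage_setT.
  by exists 1; split => // M M1 x _ /=; rewrite (le_trans (bF x))// ltW.
rewrite {1}/Rintegral (integral_pushforward (@measurable_consR n))//; last first.
  by apply/measurable_EFinP; exact: (mcos _ k c).
rewrite -(integral21_prod_meas1 iF) /fubini_G.
transitivity (\int[circle_measure]_y (if [forall i, k (lift ord0 i) == 0] then (2 * pi) ^+ n *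
  cos ((k ord0)%:~R * y + c) else 0)).
  rewrite /Rintegral; congr fine; apply: eq_integral => y _.
  rewrite -(IH (fun i => k (lift ord0 i))) /Rintegral fineK.
    by apply: eq_integral => x _; rewrite /F /= tphaseS addrA.
  apply: integrable_fin_num => //; apply: measurable_bounded_integrable => //.
  - by rewrite box_measure_lty.
  - exact: mcos.
  by exists 1; split => // M M1 x _ /=; rewrite (le_trans _ (ltW M1))// ler_norml cos_geN1 cos_le1.
have -> : [forall i, k i == 0] = (k ord0 == 0) && [forall i, k (lift ord0 i) == 0].
  apply/forallP/andP => [h|[h0 /forallP h] i]; first by split=> //; apply/forallP.
  by case: (unliftP ord0 i) => [j|] ->.
have [hk|hk] := boolP [forall i, k (lift ord0 i) == 0]; last first.
  by rewrite andbF Rintegral_cst// mul0r.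
rewrite andbT RintegralZl//; last first.
  apply: measurable_bounded_integrable => //.
  - by rewrite [X in (X < _)%E]circle_measureT ltry.
  - apply: (measurableT_comp measurable_cos).
    by apply: measurable_funD => //; exact: measurable_funM.
  by exists 1; split => // M M1 x _ /=; rewrite (le_trans _ (ltW M1))// ler_norml cos_geN1 cos_le1.
rewrite int_cos_circle; case: ifP => _; rewrite ?mulr0// exprS; ring.
Qed.

Lemma torus_measureT d : torus_measure R d setT = ((2 * pi) ^+ d)%:E.
Proof. by rewrite -box_measureT /torus_measure/= /pushforward preimage_setT. Qed.

Lemma int_cos_phase d (k : 'rV[int]_d) (c : R) :
  \int[torus_measure R d]_x cos (phase k (repr x) + c) =
  if k == 0 then (2 * pi) ^+ d * cos c else 0.
Proof.
have mT := @measurable_torus_of_tuple R d.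
have tE (x : d.-tuple R) : cos (phase k (repr (torus_of_tuple x)) + c) =
    cos (tphase (fun i => k ord0 i) x + c).
  have [n ->] := phase_repr_tpi k (\row_i tnth x i).
  rewrite addrAC cos_int_periodic; congr (cos (_ + _)).
  by apply: eq_bigr => i _; rewrite mxE.
have mcos : measurable_fun setT (fun x : d.-tuple R => cos (tphase (fun i => k ord0 i) x + c)).
  apply: (measurableT_comp measurable_cos).
  by apply: measurable_funD => //; exact: measurable_tphase.
transitivity (\int[box_measure d]_x cos (tphase (fun i => k ord0 i) x + c)).
  rewrite /Rintegral [in LHS]/torus_measure integral_pushforward//.
  - by congr fine; apply: eq_integral => x _ /=; rewrite tE.
  - apply/measurable_EFinP; apply: torus_continuous_measurable.
    exact: cos_phase_continuous.
  - rewrite (_ : _ \o _ = EFin \o (fun x : d.-tuple R => cos (tphase (fun i => k ord0 i) x + c))).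
      rewrite preimage_setT; apply: measurable_bounded_integrable => //.
        exact: (box_measure_lty d).
      by exists 1; split => // M M1 x _ /=;
        rewrite (le_trans _ (ltW M1))// ler_norml cos_geN1 cos_le1.
    by apply/funext => x /=; rewrite tE.
rewrite int_cos_box (_ : [forall i, _] = (k == 0))//.
apply/forallP/eqP => [h|-> i]; last by rewrite mxE.
by apply/rowP => i; rewrite mxE; exact/eqP.
Qed.

End torus_measure_integral.

Section torus_fourier.
Context (R : realType) (d : nat).
Local Notation T := (torus R d).
Local Notation dx := (@torus_measure R d).
Implicit Types (x : T) (u v w : T -> R[i]) (k l : 'rV[int]_d) (f g : T -> R).

Definition torus_vol : R := (2 * pi) ^+ d.

Lemma torus_vol_gt0 : 0 < torus_vol.
Proof. by rewrite exprn_gt0// mulr_gt0// pi_gt0. Qed.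

Lemma torus_measure_lty : (dx setT < +oo)%E.
Proof. by rewrite torus_measureT ltry. Qed.

Lemma torus_bounded_integrable f (M : R) : measurable_fun setT f ->
  (forall x, `|f x| <= M) -> dx.-integrable setT (EFin \o f).
Proof.
move=> mf fM; apply: measurable_bounded_integrable => //.
  exact: torus_measure_lty.
by exists M; split=> [|N MN x _ /=]; rewrite ?num_real// (le_trans (fM x))// ltW.
Qed.

Lemma sqint_bounded f (M : R) : measurable_fun setT f ->
  (forall x, `|f x| <= M) -> sqint dx f.
Proof.
move=> mf fM; split=> //; apply: (@torus_bounded_integrable _ (M ^+ 2)).
  exact: measurable_funX.
move=> x; rewrite normrX lerXn2r// ?nnegrE//.
exact: le_trans (fM x).
Qed.

Lemma sqint_continuous f : continuous f -> sqint dx f.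
Proof.
move=> cf; have [M _ hM] := torus_bounded cf.
by apply: (sqint_bounded _ hM); exact: torus_continuous_measurable.
Qed.

Lemma phaseB k l (a : 'rV[R]_d) : phase (k - l) a = phase k a - phase l a.
Proof.
rewrite /phase -sumrB; apply: eq_bigr => i _.
by rewrite !mxE intrB mulrBl.
Qed.

Lemma phaseN k (a : 'rV[R]_d) : phase (- k) a = - phase k a.
Proof. by rewrite -[- k]sub0r phaseB /phase big1 ?sub0r// => i _; rewrite mxE mul0r. Qed.

Lemma torus_charE k x : torus_char k x = expi (phase k (repr x) : R).
Proof. by []. Qed.

Lemma expiD (a b : R) : expi (a + b) = expi a * expi b.
Proof. by apply: complex_eq; rewrite ?ReM ?ImM/= ?cosD ?sinD// addrC. Qed.

Lemma expi0 : expi 0 = 1 :> R[i].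
Proof. by apply: complex_eq; rewrite /= ?cos0 ?sin0. Qed.

Lemma normc_expi (a : R) : normc (expi a) = 1.
Proof. by rewrite /normc/= cos2Dsin2 sqrtr1. Qed.

Lemma torus_charD k l x : torus_char (k + l) x = torus_char k x * torus_char l x.
Proof.
rewrite !torus_charE -expiD; congr expi.
by rewrite -[k + l]/(k + l) -[l in LHS]opprK phaseB phaseN opprK.
Qed.

Lemma torus_char_sqint k : sqintC dx (torus_char k).
Proof.
split; apply: sqint_continuous.
  have := @cos_phase_continuous R d k 0.
  by under eq_fun do rewrite addr0.
have := @cos_phase_continuous R d k (- (pi / 2)).
by under eq_fun do rewrite cosBpihalf.
Qed.

Lemma fourier_coefE u k : fourier_coef u k = herm dx u (torus_char k).
Proof.
apply: complex_eq => /=; apply: eq_Rintegral => x _;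
  by rewrite ?ReM ?ImM !torus_charE/= phaseN cosN sinN; ring.
Qed.

Lemma herm_char k l :
  herm dx (torus_char k) (torus_char l) = if k == l then torus_vol%:C%C else 0.
Proof.
have h c := @int_cos_phase R d (k - l) c.
rewrite subr_eq0 in h.
apply: complex_eq => /=.
  have := h 0; rewrite cos0 mulr1 => h0.
  transitivity (if k == l then (2 * pi) ^+ d else 0 : R); last by case: ifP.
  rewrite -[RHS]h0.
  by apply: eq_Rintegral => x _; rewrite addr0 phaseB cosB.
have := h (- (pi / 2)); rewrite cosN cos_pihalf mulr0 if_same => h0.
transitivity (0 : R); last by case: ifP.
rewrite -[RHS]h0.
by apply: eq_Rintegral => x _; rewrite cosBpihalf phaseB sinB.
Qed.

(** The partial Fourier sum over [K]; the volume enters because [fourier_coef] is not normalised. *)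
Definition fourier_proj (K : seq 'rV[int]_d) u x : R[i] :=
  \sum_(k <- K) (torus_vol^-1%:C%C * fourier_coef u k) * torus_char k x.

Lemma fourier_proj_sqint K u : sqintC dx (fourier_proj K u).
Proof. by apply: sqintC_sum => k; apply: sqintCZ; exact: torus_char_sqint. Qed.

Lemma fourier_coef_proj K u k : uniq K ->
  fourier_coef (fourier_proj K u) k = if k \in K then fourier_coef u k else 0.
Proof.
move=> uK; rewrite [LHS]fourier_coefE /fourier_proj herm_sum; last 2 first.
- by move=> j; exact: torus_char_sqint.
- exact: torus_char_sqint.
have volK : torus_vol^-1%:C%C * torus_vol%:C%C = 1 :> R[i].
  by rewrite -rmorphM/= mulVf ?gt_eqF ?torus_vol_gt0.
case: ifPn => kK.
  rewrite (bigD1_seq k)//= herm_char eqxx big1 ?addr0 => [|j /negbTE jk].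
    by rewrite mulrAC volK mul1r.
  by rewrite herm_char jk mulr0.
rewrite big_seq big1// => j jK; rewrite herm_char ifN ?mulr0//.
by apply: contraNneq kK => <-.
Qed.

Lemma fourier_coefB u v k : sqintC dx u -> sqintC dx v ->
  fourier_coef (fun x => u x - v x) k = fourier_coef u k - fourier_coef v k.
Proof.
by move=> hu hv; rewrite !fourier_coefE hermB//; exact: torus_char_sqint.
Qed.

Lemma fourier_coefZ (c : R[i]) u k : sqintC dx u ->
  fourier_coef (fun x => c * u x) k = c * fourier_coef u k.
Proof. by move=> hu; rewrite !fourier_coefE hermZ//; exact: torus_char_sqint. Qed.

Lemma herm_span_eq0 (I : eqType) (s : seq I) (c : I -> R[i]) (k : I -> 'rV[int]_d) w :
  sqintC dx w -> {in s, forall i, fourier_coef w (k i) = 0} ->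
  herm dx (fun x => \sum_(i <- s) c i * torus_char (k i) x) w = 0.
Proof.
move=> hw h0; rewrite herm_sum//; last by move=> i; exact: torus_char_sqint.
rewrite big_seq big1// => i /h0 hi.
rewrite hermC//; last exact: torus_char_sqint.
rewrite -fourier_coefE hi [conjc _](_ : _ = 0) ?mulr0//.
by apply: complex_eq; rewrite /= ?oppr0.
Qed.

Definition coef_energy (K : seq 'rV[int]_d) u : R :=
  \sum_(k <- K) torus_vol^-1 * normc (fourier_coef u k) ^+ 2.

Lemma energy_fourier_proj K u : uniq K ->
  energy dx (fourier_proj K u) = coef_energy K u.
Proof.
move=> uK; have hp := fourier_proj_sqint K u.
have : (energy dx (fourier_proj K u))%:C%C = (coef_energy K u)%:C%C.
  rewrite -herm_diag {1}/fourier_proj herm_sum//; last first.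
    by move=> k; exact: torus_char_sqint.
  rewrite rmorph_sum big_seq [RHS]big_seq; apply: eq_bigr => k kK.
  rewrite hermC//; last exact: torus_char_sqint.
  rewrite -fourier_coefE fourier_coef_proj// kK.
  move: (fourier_coef u k) => z; rewrite rmorphM -mulrA; congr (_ * _).
  by rewrite normc_sqr; case: z => a b; apply: complex_eq => /=; ring.
by move=> [].
Qed.

(** The remainder has zero coefficients on [K], hence is orthogonal to the partial sum. Bessel's
    inequality follows at once. *)
Lemma fourier_proj_pythagoras K u : uniq K -> sqintC dx u ->
  energy dx u = coef_energy K u + energy dx (fun x => u x - fourier_proj K u x).
Proof.
move=> uK hu; have hp := fourier_proj_sqint K u.
have hw := sqintCB hu hp.
rewrite -energy_fourier_proj// -energy_orth//.
  by congr energy; apply/funext => x; rewrite addrC subrK.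
apply: herm_span_eq0 => // k kK.
by rewrite fourier_coefB// fourier_coef_proj// kK subrr.
Qed.

Lemma coef_energy_le K u : uniq K -> sqintC dx u -> coef_energy K u <= energy dx u.
Proof.
by move=> uK hu; rewrite (fourier_proj_pythagoras uK hu) lerDl energy_ge0.
Qed.

End torus_fourier.

(** * Density of trigonometric polynomials in L^2 *)

Section torus_density.
Context (R : realType) (d : nat).
Local Notation T := (torus R d).
Local Notation dx := (@torus_measure R d).
Implicit Types (x : T) (u v w : T -> R[i]) (k l : 'rV[int]_d) (f g : T -> R).

Definition trig_poly u := exists s : seq (R[i] * 'rV[int]_d),
  u = fun x => \sum_(q <- s) q.1 * torus_char q.2 x.

Lemma trig_polyD u v : trig_poly u -> trig_poly v -> trig_poly (fun x => u x + v x).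
Proof.
by move=> [s ->] [t ->]; exists (s ++ t); apply/funext => x; rewrite big_cat.
Qed.

Lemma trig_poly0 : trig_poly (fun=> 0).
Proof. by exists [::]; apply/funext => x; rewrite big_nil. Qed.

Lemma trig_poly_sum (I : Type) (r : seq I) (F : I -> T -> R[i]) :
  (forall i, trig_poly (F i)) -> trig_poly (fun x => \sum_(i <- r) F i x).
Proof.
move=> hF; elim: r => [|i r IH].
  by under eq_fun do rewrite big_nil; exact: trig_poly0.
by under eq_fun do rewrite big_cons; exact: trig_polyD.
Qed.

Lemma trig_polyZ (c : R[i]) u : trig_poly u -> trig_poly (fun x => c * u x).
Proof.
move=> [s ->]; exists [seq (c * q.1, q.2) | q <- s]; apply/funext => x.
by rewrite big_map mulr_sumr; apply: eq_bigr => q _; rewrite mulrA.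
Qed.

Lemma trig_poly_char k : trig_poly (torus_char k).
Proof. by exists [:: (1, k)]; apply/funext => x; rewrite big_seq1 mul1r. Qed.

Lemma trig_polyM u v : trig_poly u -> trig_poly v -> trig_poly (fun x => u x * v x).
Proof.
move=> [s ->] [t ->]; exists [seq (q.1 * r.1, q.2 + r.2) | q <- s, r <- t].
apply/funext => x; rewrite big_flatten big_map mulr_suml; apply: eq_bigr => q _.
by rewrite big_map mulr_sumr; apply: eq_bigr => r _ /=; rewrite torus_charD; ring.
Qed.

Lemma trig_poly_cst (c : R[i]) : trig_poly (fun=> c).
Proof.
exists [:: (c, 0)]; apply/funext => x; rewrite big_seq1/=.
by rewrite torus_charE /phase big1 ?expi0 ?mulr1// => i _; rewrite mxE mul0r.
Qed.

Lemma trig_poly_prod (I : Type) (r : seq I) (F : I -> T -> R[i]) :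
  (forall i, trig_poly (F i)) -> trig_poly (fun x => \prod_(i <- r) F i x).
Proof.
move=> hF; elim: r => [|i r IH].
  by under eq_fun do rewrite big_nil; exact: trig_poly_cst.
by under eq_fun do rewrite big_cons; exact: trig_polyM.
Qed.

Lemma trig_poly_cos k (c : R) :
  trig_poly (fun x => (cos (phase k (repr x) + c))%:C%C).
Proof.
have -> : (fun x : T => (cos (phase k (repr x) + c))%:C%C) = fun x =>
    (expi c * (2^-1)%:C%C) * torus_char k x + (expi (- c) * (2^-1)%:C%C) * torus_char (- k) x.
  apply/funext => x; rewrite !torus_charE phaseN.
  move: (phase _ _) => p; apply: complex_eq => /=;
  by rewrite ?sinN ?cosN ?cosD; field.
by apply: trig_polyD; apply: trig_polyZ; exact: trig_poly_char.
Qed.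

Lemma trig_poly_cos_coord i (l : nat) (c : R) :
  trig_poly (fun x => (cos (l%:R * repr x ord0 i + c))%:C%C).
Proof.
have := @trig_poly_cos (l%:Z *: delta_mx ord0 i) c.
congr trig_poly; apply/funext => x; congr (_%:C%C); congr (cos (_ + _)).
rewrite /phase (bigD1 i)//= big1 ?addr0 ?mxE ?eqxx ?mulr1// => j ji.
by rewrite !mxE eqxx/= (negbTE ji) mulr0 mul0r.
Qed.

(** A Fejer factor is a combination of squares of sums of cosines, sines being shifted cosines, and
    trigonometric polynomials form an algebra. *)
Lemma trig_poly_bump n (J : grid_index d n) : trig_poly (fun x => (bump J x)%:C%C).
Proof.
have -> : (fun x => (bump J x)%:C%C) = fun x => \prod_(i < d)
    (fejer n.+1 (repr x ord0 i - grid_coord R (J i)))%:C%C :> R[i].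
  by apply/funext => x; rewrite /bump rmorph_prod.
apply: trig_poly_prod => i; rewrite /fejer.
set c := grid_coord _ _.
have hs (g : nat -> T -> R) : (forall a : nat, trig_poly (fun x => (g a x)%:C%C)) ->
    trig_poly (fun x => ((\sum_(a < n.+1) g a x) ^+ 2)%:C%C).
  move=> hg; under eq_fun do rewrite expr2 rmorphM rmorph_sum.
  by apply: trig_polyM; apply: trig_poly_sum => a; exact: hg.
have -> : (fun x : T => (((\sum_(a < n.+1) cos (a%:R * (repr x ord0 i - c))) ^+ 2 +
    (\sum_(a < n.+1) sin (a%:R * (repr x ord0 i - c))) ^+ 2) / (n.+2%:R * n.+1%:R))%:C%C) =
  fun x : T => (n.+2%:R * n.+1%:R)^-1%:C%C *
   (((\sum_(a < n.+1) cos (a%:R * repr x ord0 i + (- (a%:R * c)))) ^+ 2)%:C%C +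
   ((\sum_(a < n.+1) cos (a%:R * repr x ord0 i + (- (a%:R * c) - pi / 2))) ^+ 2)%:C%C).
  apply/funext => x.
  have e1 : \sum_(a < n.+1) cos (a%:R * (repr x ord0 i - c)) =
      \sum_(a < n.+1) cos (a%:R * repr x ord0 i + (- (a%:R * c))).
    by apply: eq_bigr => a _; rewrite mulrBr.
  have e2 : \sum_(a < n.+1) sin (a%:R * (repr x ord0 i - c)) =
      \sum_(a < n.+1) cos (a%:R * repr x ord0 i + (- (a%:R * c) - pi / 2)).
    by apply: eq_bigr => a _; rewrite mulrBr addrA cosBpihalf.
  by rewrite e1 e2; apply: complex_eq; rewrite ?ReM ?ImM ?ReD ?ImD/=; ring.
apply: trig_polyZ; apply: trig_polyD.
  apply: (hs (fun a x => cos (a%:R * repr x ord0 i - a%:R * c))) => a.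
  exact: trig_poly_cos_coord.
apply: (hs (fun a x => cos (a%:R * repr x ord0 i + (- (a%:R * c) - pi / 2)))) => a.
exact: trig_poly_cos_coord.
Qed.

Lemma trig_poly_sqint u : trig_poly u -> sqintC dx u.
Proof.
by move=> [s ->]; apply: sqintC_sum => q; apply: sqintCZ; exact: torus_char_sqint.
Qed.

(** Membership is extended from continuous functions to indicators of open sets, then of Borel sets,
    then to nonnegative and to all square-integrable functions. This is the completeness of the
    characters. *)
Definition trig_closure u := sqintC dx u /\
  forall e : R, 0 < e -> exists2 p, trig_poly p & energy dx (fun x => u x - p x) <= e.

Lemma trig_closure_lim u : sqintC dx u ->
  (forall e : R, 0 < e -> exists2 w, trig_closure w & energy dx (fun x => u x - w x) <= e) ->
  trig_closure u.
Proof.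
move=> hu h; split=> // e e0.
have e4 : 0 < e / 4 by rewrite divr_gt0.
have [w [hw /(_ _ e4)[p tp wp]] uw] := h _ e4.
exists p => //; have hp := trig_poly_sqint tp.
have := energyD_le (sqintCB hu hw) (sqintCB hw hp).
rewrite (_ : (fun x => _ + _) = fun x => u x - p x); last first.
  by apply/funext => x; rewrite subrKA.
by move=> /le_trans; apply; lra.
Qed.

Lemma trig_closureD u v : trig_closure u -> trig_closure v ->
  trig_closure (fun x => u x + v x).
Proof.
move=> [hu u1] [hv v1]; split; first exact: sqintCD.
move=> e e0; have e4 : 0 < e / 4 by rewrite divr_gt0.
have [p tp up] := u1 _ e4; have [q tq vq] := v1 _ e4.
exists (fun x => p x + q x); first exact: trig_polyD.
have := energyD_le (sqintCB hu (trig_poly_sqint tp)) (sqintCB hv (trig_poly_sqint tq)).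
rewrite (_ : (fun x => u x - p x + _) = fun x => u x + v x - (p x + q x)); last first.
  by apply/funext => x; rewrite opprD addrACA.
by move=> /le_trans; apply; lra.
Qed.

Lemma trig_closureZ (c : R[i]) u : trig_closure u -> trig_closure (fun x => c * u x).
Proof.
move=> [hu u1]; split; first exact: sqintCZ.
move=> e e0; pose M := normc c ^+ 2 + 1.
have M0 : 0 < M by rewrite ltr_wpDl ?sqr_ge0.
have [p tp up] := u1 _ (divr_gt0 e0 M0).
exists (fun x => c * p x); first exact: trig_polyZ.
rewrite (_ : (fun x => _) = fun x => c * (u x - p x)); last first.
  by apply/funext => x; rewrite mulrBr.
rewrite energyZ; last by apply: sqintCB => //; exact: trig_poly_sqint.
apply: (@le_trans _ _ (M * (e / M))); last by rewrite mulrCA mulfV ?mulr1// gt_eqF.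
by apply: ler_pM => //; [exact: sqr_ge0|exact: energy_ge0|rewrite lerDl].
Qed.

Lemma trig_closureB u v : trig_closure u -> trig_closure v ->
  trig_closure (fun x => u x - v x).
Proof.
move=> hu /(trig_closureZ (-1)) /(trig_closureD hu).
by congr trig_closure; apply/funext => x; rewrite mulN1r.
Qed.

Lemma trig_closure_poly u : trig_poly u -> trig_closure u.
Proof.
move=> tu; split; first exact: trig_poly_sqint.
move=> e e0; exists u => //; rewrite /energy.
under eq_Rintegral do rewrite subrr/= expr0n/= addr0.
by rewrite Rintegral_cst// mul0r ltW.
Qed.

Lemma sqintC_real f : sqint dx f -> sqintC dx (fun x => (f x)%:C%C).
Proof. by move=> hf; split => //; exact: sqint0. Qed.

Lemma energy_realB f g : energy dx (fun x => (f x)%:C%C - (g x)%:C%C) =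
  \int[dx]_x (f x - g x) ^+ 2.
Proof.
by apply: eq_Rintegral => x _; rewrite ReD ImD ReN ImN/= subrr expr0n addr0.
Qed.

(** Dominated convergence turns a pointwise limit under a square-integrable bound [g] into an L^2
    limit; the squared differences are dominated by [4 g^2] since [|f - f_n| <= 2 g]. *)
Lemma trig_closure_cvg (f_ : nat -> T -> R) f g : sqint dx g ->
  (forall n, trig_closure (fun x => (f_ n x)%:C%C)) ->
  (forall n x, `|f_ n x| <= g x) ->
  (forall x, f_ n x @[n --> \oo] --> f x) -> trig_closure (fun x => (f x)%:C%C).
Proof.
move=> [mg ig] hf fg cf.
have mf n : measurable_fun setT (f_ n) by have [[[]]] := hf n.
have mf' : measurable_fun setT f by exact: (measurable_fun_cvg mf).
have fg' x : `|f x| <= g x.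
  have c : `|f_ n x| @[n --> \oo] --> `|f x| by apply: cvg_norm; exact: cf.
  rewrite -(cvg_lim _ c)//; apply: limr_le; first by apply/cvg_ex; exists `|f x|.
  by near=> n; exact: fg.
have hf' : sqint dx f.
  by apply: (@sqint_le _ _ _ _ _ g) => // x; rewrite (le_trans (fg' x))// ler_norm.
apply: trig_closure_lim; first exact: sqintC_real.
move=> e e0.
have c0 : \int[dx]_x (f x - f_ n x) ^+ 2 @[n --> \oo] --> (0 : R).
  have [|||||_ _] := @dominated_convergence _ _ _ dx setT measurableT
    (fun n x => ((f x - f_ n x) ^+ 2)%:E) (fun=> 0%E) (fun x => (4 * g x ^+ 2)%:E).
  - by move=> n; apply/measurable_EFinP; apply: measurable_funX; exact: measurable_funB.
  - exact: measurable_cst.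
  - apply: aeW => x _; apply/fine_cvgP; split; first by near=> n.
    have h : f x - f_ n x @[n --> \oo] --> (0 : R).
      by rewrite -(subrr (f x)); apply: cvgB => //; exact: cvg_cst.
    rewrite (_ : fine \o _ = fun n => (f x - f_ n x) * (f x - f_ n x)); last exact/funext.
    by have hh := cvgM h h; rewrite mulr0 in hh; exact: hh.
  - exact: integrableZ_EFin.
  - apply: aeW => x n _ /=; rewrite lee_fin ger0_norm ?sqr_ge0//.
    have := fg n x; have := fg' x; rewrite !ler_norml => /andP[? ?] /andP[? ?].
    rewrite !expr2; nra.
  by rewrite integral0 => /fine_cvgP[].
have [n _ /(_ n (leqnn n)) hn] : \forall n \near \oo, \int[dx]_x (f x - f_ n x) ^+ 2 <= e.
  exact: cvgr_le c0 _ e0.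
by exists (fun x => (f_ n x)%:C%C) => //; rewrite energy_realB.
Unshelve. all: by end_near. Qed.

Lemma trig_closure_continuous f : continuous f -> trig_closure (fun x => (f x)%:C%C).
Proof.
move=> cf; have [M M0 hM] := torus_bounded cf.
apply: (@trig_closure_cvg (fun n => bump_approx n f) f (fun=> M)).
- by apply: (@sqint_bounded _ _ _ M) => // x; rewrite ger0_norm.
- move=> n; apply: trig_closure_poly.
  rewrite (_ : (fun x => _) = fun x => \sum_(J : grid_index d n) (f (grid_pt R J))%:C%C * (bump
    J x)%:C%C).
    by apply: trig_poly_sum => J; apply: trig_polyZ; exact: trig_poly_bump.
  by apply/funext => x; rewrite rmorph_sum; apply: eq_bigr => J _; rewrite rmorphM.
- move=> n x; apply: (le_trans (ler_norm_sum _ _ _)).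
  rewrite -[leRHS]mulr1 -(bump_sum1 n x) mulr_sumr; apply: ler_sum => J _.
  by rewrite normrM (ger0_norm (bump_ge0 _ _)) ler_wpM2r// bump_ge0.
- move=> x; apply/cvgrPdist_le => e e0.
  by have := bump_approx_cvg cf e0; apply: filterS => n; exact.
Qed.

(** Since [tdist] is not a metric, continuity of this gauge is proved upstairs on [R^d], where each
    cosine is 1-Lipschitz in the representative. *)
Let dist_compl (U : set T) x : R := inf [set tdist x y | y in ~` U].

Let tdist_lip (a b : 'rV[R]_d) (y : T) :
  `|tdist (tpi a) y - tdist (tpi b) y| <= \sum_(i < d) `|a ord0 i - b ord0 i|.
Proof.
rewrite -sumrB; apply: (le_trans (ler_norm_sum _ _ _)); apply: ler_sum => i _.
have [m ->] := repr_tpi a i; have [n ->] := repr_tpi b i.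
rewrite (addrAC _ (m%:~R * _)) (addrAC _ (n%:~R * _)) !cos_int_periodic.
rewrite (_ : _ - _ = cos (b ord0 i - repr y ord0 i) - cos (a ord0 i - repr y ord0 i)); last by ring.
by rewrite (le_trans (cos_dist_le _ _))// distrC opprB addrA subrK.
Qed.

Let dist_compl_lip (U : set T) (a b : 'rV[R]_d) : ~` U !=set0 ->
  dist_compl U (tpi a) <= dist_compl U (tpi b) + \sum_(i < d) `|a ord0 i - b ord0 i|.
Proof.
move=> U0; rewrite -lerBlDr; apply: lb_le_inf => [|_ [y yU <-]].
  by have [y yU] := U0; exists (tdist (tpi b) y); exists y.
rewrite lerBlDr; apply: (@le_trans _ _ (tdist (tpi a) y)).
  apply: ge_inf; last by exists y.
  by exists 0 => _ [z _ <-]; exact: tdist_ge0.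
rewrite addrC -lerBlDr; have := tdist_lip a b y; rewrite ler_norml => /andP[_].
by [].
Qed.

Let dist_compl_continuous (U : set T) : ~` U !=set0 -> continuous (dist_compl U).
Proof.
move=> U0; apply: torus_continuous => a.
suff : dist_compl U (tpi b) @[b --> a] --> dist_compl U (tpi a) by [].
apply/(@cvgrPdist_le _ _ _ (nbhs a)) => e e0 /=.
have c0 : \sum_(i < d) `|a ord0 i - (b : 'rV[R]_d) ord0 i| @[b --> a] --> (0 : R).
  have cc : continuous (fun b : 'rV[R]_d => \sum_(i < d) `|a ord0 i - b ord0 i|).
    apply: continuous_bigsum => i _ b.
    apply: (@continuous_comp _ _ _ (fun b : 'rV[R]_d => a ord0 i - b ord0 i) Num.norm).
      by apply: continuousB; [exact: cst_continuous|exact: coord_continuous_rV].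
    exact: norm_continuous.
  have := cc a; rewrite /continuous_at [X in _ --> X](_ : _ = 0)//.
  by rewrite big1// => i _; rewrite subrr normr0.
have H : \forall b \near nbhs a, \sum_(i < d) `|a ord0 i - (b : 'rV[R]_d) ord0 i| <= e.
  exact: (cvgr_le _ c0 _ e0).
apply: (@filterS _ (nbhs a) (nbhs_filter a) _ _ _ H) => b hb.
rewrite ler_norml; apply/andP; split.
  rewrite lerNl opprB lerBlDl; apply: (le_trans (dist_compl_lip b a U0)).
  by rewrite lerD2l (le_trans _ hb)//; apply: ler_sum => i _; rewrite distrC.
rewrite lerBlDl; apply: (le_trans (dist_compl_lip a b U0)).
by rewrite lerD2l.
Qed.

Let dist_compl_gt0 (U : set T) x : open U -> ~` U !=set0 -> U x -> 0 < dist_compl U x.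
Proof.
move=> oU U0 Ux.
have cU : compact (~` U).
  by apply: (@subclosed_compact _ _ [set: T]) => //; [exact: open_closedC|exact: torus_compact].
have [|y /set_mem yU hy] := @compact_EVT_min _ _ (tdist x) _ U0 cU.
  apply: continuous_subspaceT => z.
  apply: (@continuous_comp _ _ _ (fun z => (x, z)) (fun p => tdist p.1 p.2)).
    exact: (cvg_pair (@cvg_cst _ x _ (nbhs z) _) cvg_id).
  exact: tdist_continuous.
apply: (@lt_le_trans _ _ (tdist x y)).
  rewrite lt_neqAle tdist_ge0 andbT eq_sym; apply/eqP => /tdist_eq0 xy.
  by apply: yU; rewrite -xy.
apply: lb_le_inf => [|_ [z zU <-]]; first by have [z zU] := U0; exists (tdist x z); exists z.
by apply: hy; rewrite inE.
Qed.

Let dist_compl_out (U : set T) x : ~ U x -> dist_compl U x = 0.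
Proof.
move=> Ux; apply/eqP; rewrite eq_le; apply/andP; split.
  apply: ge_inf; first by exists 0 => _ [z _ <-]; exact: tdist_ge0.
  by exists x => //; rewrite /tdist big1// => i _; rewrite subrr cos0 subrr.
apply: lb_le_inf => [|_ [z zU <-]]; last exact: tdist_ge0.
by exists (tdist x x); exists x.
Qed.

(** The functions [min 1 (n dist)] are continuous and increase to the indicator. The full torus is
    treated apart, the infimum over its empty complement being meaningless. *)
Lemma trig_closure_open (U : set T) : open U ->
  trig_closure (fun x => (\1_U x)%:C%C).
Proof.
move=> oU; have [U0|U0] := pselect (~` U !=set0); last first.
  have -> : (fun x => (\1_U x)%:C%C) = fun=> 1 :> R[i].
    apply/funext => x; rewrite indicE mem_set//; apply: contrapT => Ux.
    by apply: U0; exists x.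
  by apply: trig_closure_poly; exact: trig_poly_cst.
pose f_ (n : nat) x : R := Num.min 1 (n%:R * dist_compl U x).
have f0 n x : 0 <= f_ n x <= 1.
  rewrite /f_ ge_min lexx/= le_min ler01/= mulr_ge0//.
  have [Ux|/dist_compl_out ->//] := pselect (U x).
  by rewrite ltW// dist_compl_gt0.
apply: (@trig_closure_cvg f_ _ (fun=> 1)).
- by apply: (@sqint_bounded _ _ _ 1) => // x; rewrite normr1.
- move=> n; apply: trig_closure_continuous => x.
  apply: (@continuous_min R T (cst 1) (fun x => n%:R * dist_compl U x) x).
    exact: cst_continuous.
  by apply: continuousM; [exact: cst_continuous|exact: dist_compl_continuous].
- by move=> n x; have /andP[? ?] := f0 n x; rewrite ger0_norm.
- move=> x; rewrite indicE; case: (boolP (x \in U)) => /=.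
    rewrite inE => Ux; have g0 := dist_compl_gt0 oU U0 Ux.
    apply: cvg_near_cst; near=> n; apply/min_idPl.
    rewrite -ler_pdivrMr//; near: n; exact: nbhs_infty_ger.
  rewrite notin_setE => Ux; apply: cvg_near_cst; near=> n.
  by rewrite /f_ dist_compl_out// mulr0; apply/min_idPr.
Unshelve. all: by end_near. Qed.

(** Dynkin's theorem with the open sets as pi-system: differences use linearity, increasing unions
    use [trig_closure_cvg]. *)
Lemma trig_closure_measurable (A : set T) : measurable A ->
  trig_closure (fun x => (\1_A x)%:C%C).
Proof.
move=> mA; pose H : set (set T) := [set A | measurable A /\ trig_closure (fun x => (\1_A x)%:C%C)].
suff : <<s setT, @open T >> `<=` H by move=> /(_ A mA) [].
apply: lambda_system_subset => //.
- by move=> U V; exact: openI.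
- split=> //.
  + split=> //; have -> : (fun x : T => (\1_setT x)%:C%C) = fun=> 1 :> R[i].
      by apply/funext => x; rewrite indicT.
    by apply: trig_closure_poly; exact: trig_poly_cst.
  + move=> B C CB [mB hB] [mC hC]; split; first exact: measurableD.
    have := trig_closureB hB hC; congr trig_closure; apply/funext => x.
    rewrite -rmorphB/=; congr (_%:C%C); rewrite !indicE in_setD.
    case: (boolP (x \in C)) => [xC|]; rewrite ?andbT ?subr0//.
    by rewrite andbF (_ : x \in B) ?subrr//; rewrite inE; apply: CB; exact: set_mem.
  + move=> F ndF hF; split; first by apply: bigcupT_measurable => n; exact: (hF n).1.
    apply: (@trig_closure_cvg (fun n => \1_(F n)) _ (fun=> 1)).
    * by apply: (@sqint_bounded _ _ _ 1) => // x; rewrite normr1.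
    * by move=> n; exact: (hF n).2.
    * by move=> n x; rewrite indicE ger0_norm// lern1 leq_b1.
    * move=> x; rewrite indicE; case: (boolP (x \in _)) => [/set_mem[m _ Fx]|Fx].
        apply: cvg_near_cst; exists m => // n mn /=; rewrite indicE mem_set//.
        by have /subsetPset := ndF _ _ mn; exact.
      apply: cvg_near_cst; near=> n; rewrite indicE; case: (boolP (x \in F n)) => //.
      by move=> /set_mem Fn; move: Fx; rewrite notin_setE; case; exists n.
- move=> U oU; split; first exact: torus_open_measurable.
  exact: trig_closure_open.
Unshelve. all: by end_near. Qed.

Import HBNNSimple.

Lemma trig_closure_ge0 f : sqint dx f -> (forall x, 0 <= f x) ->
  trig_closure (fun x => (f x)%:C%C).
Proof.
move=> hf f0; have mf : measurable_fun setT (EFin \o f) by apply/measurable_EFinP; exact: hf.1.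
pose f_ n := nnsfun_approx measurableT mf n.
apply: (@trig_closure_cvg (fun n x => f_ n x) _ f) => //.
- move=> n; pose s := finmap.enum_fset (fset_set (range (f_ n))).
  rewrite (_ : (fun x => _) = fun x => \sum_(y <- s) y%:C%C * (\1_(f_ n @^-1` [set y]) x)%:C%C).
    elim: s => [|y s IH].
      by under eq_fun do rewrite big_nil; apply: trig_closure_poly; exact: trig_poly0.
    under eq_fun do rewrite big_cons; apply: trig_closureD => //.
    apply: trig_closureZ; apply: trig_closure_measurable; exact: measurable_sfunP.
  apply/funext => x; rewrite fimfunEord rmorph_sum/= (big_nth 0%R) big_mkord.
  by apply: eq_bigr => i _; rewrite -rmorphM.
- move=> n x; rewrite ger0_norm//.
  rewrite /f_ nnsfun_approxE -lee_fin.
  by apply: (@le_approx _ _ _ setT (EFin \o f)) => // z _; rewrite lee_fin.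
- move=> x; have := @cvg_nnsfun_approx _ _ _ _ measurableT _ mf (fun x _ => f0 x) x I.
  by move=> /fine_cvgP[].
Qed.

Lemma trig_closure_all u : sqintC dx u -> trig_closure u.
Proof.
have real f : sqint dx f -> trig_closure (fun x => (f x)%:C%C).
  move=> hf; have mf := hf.1.
  have h1 : trig_closure (fun x => (Num.max (f x) 0)%:C%C).
    apply: trig_closure_ge0 => [|x]; last by rewrite le_max lexx orbT.
    apply: (sqint_le _ hf); first exact: measurable_maxr.
    move=> x; rewrite ger0_norm ?le_max ?lexx ?orbT// ge_max normr_ge0 andbT.
    exact: ler_norm.
  have h2 : trig_closure (fun x => (Num.max (- f x) 0)%:C%C).
    apply: trig_closure_ge0 => [|x]; last by rewrite le_max lexx orbT.
    apply: (sqint_le _ hf).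
      by apply: measurable_maxr => //; exact: measurableT_comp.
    move=> x; rewrite ger0_norm ?le_max ?lexx ?orbT// ge_max normr_ge0 andbT.
    by rewrite -normrN; exact: ler_norm.
  have := trig_closureB h1 h2; congr trig_closure; apply/funext => x.
  rewrite -rmorphB/=; congr (_%:C%C).
  have [f0|] := boolP (0 <= f x).
    by rewrite max_l// max_r ?subr0// oppr_le0.
  rewrite -ltNge => f0.
  by rewrite max_r ?ltW// max_l ?sub0r ?opprK// oppr_ge0 ltW.
move=> [h1 h2].
have := trig_closureD (real _ h1) (trig_closureZ ('i)%C (real _ h2)).
congr trig_closure; apply/funext => x.
by apply: complex_eq; rewrite ?ReD ?ImD ?ReM ?ImM/=; ring.
Qed.

End torus_density.

(** * Parseval's identity and the L^2 norm *)

Section parseval.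
Context (R : realType) (d : nat).
Local Notation T := (torus R d).
Local Notation dx := (@torus_measure R d).
Implicit Types (x : T) (u v w : T -> R[i]) (k l : 'rV[int]_d) (f g : T -> R).

(** Take for [K] the frequencies of a trigonometric polynomial [p] close to [u]: by Pythagoras the
    orthogonal projection on the span of these characters is at least as close to [u] as [p]. *)
Lemma fourier_proj_approx u (e : R) : sqintC dx u -> 0 < e ->
  exists2 K : seq 'rV[int]_d, uniq K & energy dx (fun x => u x - fourier_proj K u x) <= e.
Proof.
move=> hu e0; have [_ /(_ _ e0)[_ [s ->] sle]] := trig_closure_all hu.
pose K := undup [seq q.2 | q <- s].
have uK : uniq K by exact: undup_uniq.
exists K => //; have hp := fourier_proj_sqint K u.
have hw := sqintCB hu hp.
pose c (q : R[i] * 'rV[int]_d) := q.1.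
pose p x := \sum_(q <- s) q.1 * torus_char q.2 x : R[i].
have hpp : sqintC dx p by apply: trig_poly_sqint; exists s.
have w0 k : k \in K -> fourier_coef (fun x => u x - fourier_proj K u x) k = 0.
  by move=> kK; rewrite fourier_coefB// fourier_coef_proj// kK subrr.
have h1 : herm dx (fourier_proj K u) (fun x => u x - fourier_proj K u x) = 0.
  by apply: (@herm_span_eq0 _ _ _ K (fun k => (torus_vol R d)^-1%:C%C * fourier_coef u k) id).
have h2 : herm dx p (fun x => u x - fourier_proj K u x) = 0.
  apply: (@herm_span_eq0 _ _ _ s (fun q => q.1) (fun q => q.2)) => // q qs.
  by apply: w0; rewrite mem_undup; apply: map_f.
have := energy_orth (sqintCB hp hpp) hw.
rewrite hermB// h1 h2 subrr => /(_ erefl).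
rewrite (_ : (fun x => fourier_proj K u x - p x + _) = fun x => u x - p x); last first.
  by apply/funext => x; ring.
move=> E; rewrite E in sle.
by apply: le_trans sle; rewrite lerDr energy_ge0.
Qed.

Lemma energy_coef_energy u (e : R) : sqintC dx u -> 0 < e ->
  exists2 K, uniq K & energy dx u <= coef_energy K u + e.
Proof.
move=> hu e0; have [K uK h] := fourier_proj_approx hu e0.
by exists K => //; rewrite (fourier_proj_pythagoras uK hu) lerD2l.
Qed.

(** Completeness bounds the energy of [u] by finitely many coefficients up to [e], and Bessel's
    inequality bounds those of [v]; in this way no infinite sum is formed. *)
Lemma energy_le_coef u v (c : R) : 0 <= c -> sqintC dx u -> sqintC dx v ->
  (forall k, normc (fourier_coef u k) ^+ 2 <= c * normc (fourier_coef v k) ^+ 2) ->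
  energy dx u <= c * energy dx v.
Proof.
move=> c0 hu hv h; apply/ler_addgt0Pr => e e0.
have [K uK hK] := energy_coef_energy hu e0.
apply: (le_trans hK); rewrite lerD2r.
apply: (@le_trans _ _ (c * coef_energy K v)); last first.
  by rewrite ler_wpM2l// coef_energy_le.
rewrite mulr_sumr; apply: ler_sum => k _; rewrite [leRHS]mulrCA.
by rewrite ler_wpM2l// invr_ge0 ltW// torus_vol_gt0.
Qed.

Lemma energy_eq_coef u v : sqintC dx u -> sqintC dx v ->
  (forall k, normc (fourier_coef u k) = normc (fourier_coef v k)) ->
  energy dx u = energy dx v.
Proof.
move=> hu hv h; apply/eqP; rewrite eq_le -[leRHS]mul1r -[X in _ && (_ <= X)]mul1r.
by apply/andP; split; apply: energy_le_coef => // k; rewrite mul1r h.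
Qed.

Lemma is_L2P u : is_L2 u <-> sqintC dx u.
Proof.
have sE : (\int[dx]_x poweR `|(normc (u x))%:E| 2)%E =
    (\int[dx]_x (complex.Re (u x) ^+ 2 + complex.Im (u x) ^+ 2)%:E)%E.
  apply: eq_integral => x _; rewrite abse_EFin poweR_EFin; congr EFin.
  rewrite powR_mulrn// ger0_norm ?normc_sqr//.
  by case: (u x) => a b; exact: sqrtr_ge0.
have nE : normL2 u = ((\int[dx]_x (complex.Re (u x) ^+ 2 + complex.Im (u x) ^+ 2)%:E) `^
  (2^-1)%R)%E.
  by rewrite /normL2 unlock sE.
split=> [[mR mI h]|hu].
  have i0 : (0 <= \int[dx]_x (complex.Re (u x) ^+ 2 + complex.Im (u x) ^+ 2)%:E)%E.
    by apply: integral_ge0 => x _; rewrite lee_fin addr_ge0 ?sqr_ge0.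
  have iE : dx.-integrable setT (EFin \o (fun x => complex.Re (u x) ^+ 2 + complex.Im (u x) ^+ 2)).
    apply/integrableP; split.
      by apply/measurable_EFinP; apply: measurable_funD; exact: measurable_funX.
    under eq_integral do rewrite /= ger0_norm ?addr_ge0 ?sqr_ge0//.
    rewrite ltNge leye_eq; apply/eqP => E; move: h; rewrite nE E.
    by rewrite poweRyr ?invr_eq0// ltxx.
  split; split=> //; apply: integrable_dominated iE; try exact: measurable_funX.
    by move=> x; rewrite ger0_norm ?sqr_ge0// lerDl sqr_ge0.
  by move=> x; rewrite ger0_norm ?sqr_ge0// lerDr sqr_ge0.
have [[mR _] [mI _]] := hu; split=> //.
rewrite nE; have /integrable_fin_num -/(_ measurableT) := integrable_energy hu.
by move=> /fineK <-; rewrite poweR_EFin ltry.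
Qed.

Lemma normL2E u : sqintC dx u -> normL2 u = (energy dx u `^ 2^-1)%:E.
Proof.
move=> hu; rewrite /normL2 unlock -poweR_EFin; congr (_ `^ _)%E.
rewrite /energy /Rintegral fineK; last first.
  have /integrable_fin_num := integrable_energy hu.
  by apply.
apply: eq_integral => x _; rewrite abse_EFin poweR_EFin; congr EFin.
rewrite powR_mulrn// ger0_norm ?normc_sqr//.
by case: (u x) => a b; exact: sqrtr_ge0.
Qed.

Lemma normalisedP u : normalised u <-> sqintC dx u /\ energy dx u = 1.
Proof.
split=> [[/is_L2P hu]|[hu u1]].
  rewrite normL2E// => -[]; split=> //.
  have E0 : 0 <= energy dx u by exact: energy_ge0.
  by move: H; rewrite powR12_sqrt// => H; rewrite -[LHS]sqr_sqrtr// H expr1n.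
by split; [exact/is_L2P|rewrite normL2E// u1 powR1].
Qed.

End parseval.

(** * Weak-* compactness of bounded functions *)

Section extraction.
Context (R : realType).

Lemma cvgn_uniform_approx (u : nat -> R) :
  (forall e, 0 < e -> exists2 v : nat -> R, cvgn v & forall n, `|u n - v n| <= e) ->
  cvgn u.
Proof.
move=> h; apply: cauchy_cvg; apply: cauchy_exP => e e0.
have e20 : 0 < e / 2 by rewrite divr_gt0.
have [v cv hv] := h _ e20; exists (limn v).
have [N _ hN] := (cvgrPdist_lt _ _).1 cv _ e20; exists N => // n /hN hn.
rewrite /ball/= (le_lt_trans (ler_distD (v n) _ _))// [ltRHS](splitr e).
by rewrite ltr_leD// distrC.
Qed.

Lemma dist_triangle3 (A B a b e : R) :
  `|A - a| <= e / 3 -> `|a - b| <= e / 3 -> `|B - b| <= e / 3 -> `|A - B| <= e.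
Proof.
move=> h1 h2; rewrite distrC => h3.
have -> : A - B = (A - a) + (a - b) + (b - B) by ring.
apply: le_trans (ler_normD _ _) _; apply: le_trans (lerD (ler_normD _ _) h3) _.
by apply: le_trans (lerD (lerD h1 h2) (lexx _)) _; lra.
Qed.

(** The denominator [C + 1] covers the case [C = 0]; thresholds of this shape recur below. *)
Lemma mul_frac_le (C e : R) : 0 <= C -> 0 <= e -> C * (e / (C + 1)) <= e.
Proof.
by move=> C0 e0; rewrite mulrCA ler_piMr// ler_pdivrMr ?ltr_wpDl// mul1r lerDl.
Qed.

Lemma near_oo_ex (P : nat -> Prop) : (\forall n \near \oo, P n) -> exists n, P n.
Proof. by move=> [n _ /(_ n (leqnn n))]; exists n. Qed.

(** Extractions are maps [s] with [k <= s k], increasing or not: this is enough for [s k] to tend to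
    infinity. *)
Lemma cvg_comp_subseq (X : topologicalType) (f : nat -> X) (l : X) (s : nat -> nat) :
  (forall k, (k <= s k)%N) -> f n @[n --> \oo] --> l -> f (s k) @[k --> \oo] --> l.
Proof.
move=> ks fl; apply: (@cvg_comp _ _ _ s f) fl => A [N _ NA].
by exists N => // n Nn; apply: NA => /=; exact: leq_trans Nn (ks n).
Qed.

(** At stage [k] only the indices with a code below [k] are controlled, within [1 / (k + 1)]; each
    fixed index is eventually among them. *)
Lemma subseq_of_cluster (I : countType) (x : I -> nat -> R) (z : I -> R) :
  (forall (J : seq I) (e : R) (N : nat), 0 < e ->
    exists2 n, (N <= n)%N & {in J, forall i, `|z i - x i n| < e}) ->
  exists2 s : nat -> nat, forall k, (k <= s k)%N &
    forall i, x i (s k) @[k --> \oo] --> z i.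
Proof.
move=> h.
pose J k := pmap (@unpickle I) (iota 0 k).
have /choice[s hs] k : exists n, (k <= n)%N /\ {in J k, forall i, `|z i - x i n| < k.+1%:R^-1}.
  have k0 : (0 : R) < k.+1%:R^-1 by rewrite invr_gt0.
  by have [n kn hn] := h (J k) _ k k0; exists n.
exists s => [k|i]; first exact: (hs k).1.
apply/cvgrPdist_lt => e e0.
near=> k.
have iJ : i \in J k.
  rewrite mem_pmap; apply/mapP; exists (pickle i); last by rewrite pickleK.
  by rewrite mem_iota/= add0n; near: k; exact: nbhs_infty_gt.
apply: lt_trans ((hs k).2 i iJ) _.
by near: k; exact: (near_infty_natSinv_lt (PosNum e0)).
Unshelve. all: by end_near. Qed.

(** Tychonoff's theorem provides a cluster point in a product of segments, and countability of [I]
    turns it into the limit of a subsequence. *)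
Lemma diagonal_subseq (I : countType) (x : I -> nat -> R) (M : I -> R) :
  (forall i n, `|x i n| <= M i) ->
  exists2 s : nat -> nat, forall k, (k <= s k)%N &
    exists z : I -> R, forall i, x i (s k) @[k --> \oo] --> z i.
Proof.
move=> xM.
have cA := @tychonoff I (fun=> R) (fun i => [set` `[- M i, M i]])
  (fun i => @segment_compact R _ _).
pose F : set_system (prod_topology (fun _ : I => R)) := (fun n => (fun i => x i n)) @ \oo.
have [] := cA F _.
- by exists 0 => // n _ i /=; rewrite in_itv/= -ler_norml.
move=> z [_ zF].
suff [s ks cs] : exists2 s : nat -> nat, forall k, (k <= s k)%N &
    forall i, x i (s k) @[k --> \oo] --> z i by exists s => //; exists z.
apply: subseq_of_cluster => J e N e0.
pose B := [set f : prod_topology (fun _ : I => R) | {in J, forall i, `|z i - f i| < e}].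
have nB : nbhs z B.
  rewrite /B; elim: J {B} => [|j J IH].
    by apply: filterS filterT => f _ i.
  have hj : nbhs z [set f : prod_topology (fun _ : I => R) | `|z j - f j| < e].
    have : nbhs (proj j z) (ball (proj j z : R) e) by exact: nbhsx_ballx.
    by move=> /(@proj_continuous I (fun=> R) j z).
  apply: filterS2 hj IH => f h1 h2 i; rewrite in_cons => /orP[/eqP ->//|]; exact: h2.
have FN : F [set f | exists2 n, (N <= n)%N & f = (fun i => x i n)].
  by exists N => // n /= Nn; exists n.
by have [f [[n Nn ->] fB]] := zF _ _ FN nB; exists n.
Qed.

End extraction.

Section ae_lemmas.
Context d0 (X : measurableType d0) (R : realType) (mu : {measure set X -> \bar R}).

Lemma ae_ge0_of_integral (f : X -> R) : mu.-integrable setT (EFin \o f) ->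
  (forall B, measurable B -> 0 <= \int[mu]_(x in B) f x) ->
  {ae mu, forall x, 0 <= f x}.
Proof.
move=> fi f0; have mf : measurable_fun setT f by exact: (integrable_measurable fi).
pose N := [set x | f x < 0].
have mN : measurable N.
  rewrite -[N]setTI; have := mf measurableT `]-oo, 0[%classic (measurable_itv _).
  by congr measurable; apply/seteqP; split=> x [_] /=; rewrite in_itv/=.
have iN : mu.-integrable N (EFin \o f) by apply: integrableS fi.
have : (\int[mu]_(x in N) `|(EFin \o f) x|)%E = 0%E.
  transitivity (\int[mu]_(x in N) (- f x))%:E.
    rewrite /Rintegral fineK; last first.
      exact: (integrable_fin_num mN (integrableN iN)).
    by apply: eq_integral => x /set_mem xN /=; rewrite ltr0_norm.
  congr EFin; apply/eqP; rewrite eq_le; apply/andP; split; last first.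
    by apply: Rintegral_ge0 => x xN; rewrite oppr_ge0 ltW.
  rewrite (_ : \int[mu]_(x in N) (- f x) = - \int[mu]_(x in N) f x) ?oppr_le0 ?f0//.
  by under eq_Rintegral do rewrite -mulN1r; rewrite RintegralZl// mulN1r.
move=> /ae_eq_integral_abs -/(_ mN (measurable_int _ iN)).
apply: filterS => x /= hx; rewrite leNgt; apply/negP => fx.
by have [f0'] := hx fx; rewrite f0' ltxx in fx.
Qed.

Lemma integrable_sum_EFin (I : Type) (s : seq I) (F : I -> X -> R) :
  (forall i, mu.-integrable setT (EFin \o F i)) ->
  mu.-integrable setT (EFin \o (fun x => \sum_(i <- s) F i x)).
Proof.
move=> iF; elim: s => [|i s IH].
  by under [X in _ \o X]eq_fun do rewrite big_nil; exact: integrable0.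
by under [X in _ \o X]eq_fun do rewrite big_cons; exact: integrableD_EFin.
Qed.

Lemma Rintegral_sum (I : Type) (s : seq I) (F : I -> X -> R) :
  (forall i, mu.-integrable setT (EFin \o F i)) ->
  \int[mu]_x (\sum_(i <- s) F i x) = \sum_(i <- s) \int[mu]_x F i x.
Proof.
move=> iF; elim: s => [|i s IH].
  by rewrite big_nil; under eq_Rintegral do rewrite big_nil; rewrite Rintegral_cst// mul0r.
rewrite big_cons -IH; under eq_Rintegral do rewrite big_cons.
by rewrite RintegralD//; exact: integrable_sum_EFin.
Qed.

End ae_lemmas.

Section unit_valued.
Context d0 (X : measurableType d0) (R : realType).

Definition unit_valued (a : X -> R) := measurable_fun setT a /\ forall x, 0 <= a x <= 1.

Lemma integrable_unit_mul (mu : {measure set X -> \bar R}) (h b : X -> R) :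
  unit_valued b -> mu.-integrable setT (EFin \o h) ->
  mu.-integrable setT (EFin \o (fun x => h x * b x)).
Proof.
move=> [mb b01] ih; apply: (le_integrable _ _ _ ih) => //.
  by apply/measurable_EFinP; apply: measurable_funM => //; exact: integrable_measurable ih.
move=> x _; rewrite lee_fin normrM ler_piMr//.
by have /andP[b0 b1] := b01 x; rewrite ger0_norm.
Qed.

End unit_valued.

Section weak_star_bounded.
Context d0 (X : measurableType d0) (R : realType).
Variable P : {finite_measure set X -> \bar R}.
Implicit Types (B C : set X) (a : X -> R).

Lemma unit_integrable a B : unit_valued a -> measurable B -> P.-integrable B (EFin \o a).
Proof.
move=> [ma a01] mB; apply: (integrableS measurableT) => //.
apply: measurable_bounded_integrable => //; first by rewrite ltey_eq fin_num_measure.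
exists 1; split => // M M1 x _ /=; have /andP[a0 a1] := a01 x.
by rewrite ger0_norm// (le_trans a1)// ltW.
Qed.

Lemma unit_int_ge0 a B : unit_valued a -> 0 <= \int[P]_(x in B) a x.
Proof. by move=> [ma a01]; apply: Rintegral_ge0 => x _; have /andP[] := a01 x. Qed.

Lemma unit_int_le a B : unit_valued a -> measurable B ->
  \int[P]_(x in B) a x <= fine (P B).
Proof.
move=> ua mB; rewrite -[leRHS]mul1r -Rintegral_cst//.
apply: le_Rintegral => //; first exact: unit_integrable.
  exact: finite_measure_integrable_cst.
by move=> x _; have [_ /(_ x)/andP[]] := ua.
Qed.

Lemma unit_intU a B C : unit_valued a -> measurable B -> measurable C ->
  [disjoint B & C] ->
  \int[P]_(x in B `|` C) a x = \int[P]_(x in B) a x + \int[P]_(x in C) a x.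
Proof.
move=> ua mB mC BC; rewrite Rintegral_setU//.
by apply: unit_integrable => //; exact: measurableU.
Qed.

Lemma unit_intD a B C : unit_valued a -> measurable B -> measurable C -> C `<=` B ->
  \int[P]_(x in B `\` C) a x = \int[P]_(x in B) a x - \int[P]_(x in C) a x.
Proof.
move=> ua mB mC CB; have mBC : measurable (B `\` C) by exact: measurableD.
rewrite -[in X in _ = X - _](setDUK CB) unit_intU//; first by rewrite addrC addKr.
by apply/disj_setPS => x [? []].
Qed.

(** A countable pi-system generating the sigma-algebra: a single extraction secures convergence of
    the integrals over all the [G j]. *)
Variables (G : nat -> set X).
Hypotheses (mG : measurable = <<s range G>>) (GI : setI_closed (range G)) (GT : range G setT).

Lemma measurable_G j : measurable (G j).
Proof. by rewrite mG; apply: sub_sigma_algebra; exists j. Qed.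

(** Dynkin's theorem again. For an increasing union the integrals over [F k] approximate uniformly
    in [n]: since [a n <= 1], the error is at most the [P]-measure of what [F k] misses. *)
Lemma cvg_all_measurable (a : nat -> X -> R) : (forall n, unit_valued (a n)) ->
  (forall j, cvgn (fun n => \int[P]_(x in G j) a n x)) ->
  forall B, measurable B -> cvgn (fun n => \int[P]_(x in B) a n x).
Proof.
move=> ua cG B mB.
pose H : set (set X) := [set B | measurable B /\ cvgn (fun n => \int[P]_(x in B) a n x)].
suff : <<s setT, range G>> `<=` H by move=> /(_ B); rewrite -mG => /(_ mB)[].
apply: lambda_system_subset => //; last first.
  by move=> _ [j _ <-]; split; [exact: measurable_G|exact: cG].
split.
- by move=> C _ x _.
- by have [j _ <-] := GT; split; [exact: measurable_G|exact: cG].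
- move=> C D DC [mC cC] [mD cD]; split; first exact: measurableD.
  under eq_fun do rewrite unit_intD//.
  by apply/cvg_ex; eexists; apply: cvgB; [exact: cC|exact: cD].
- move=> F ndF hF; have mF n : measurable (F n) by exact: (hF n).1.
  have mU : measurable (\bigcup_n F n) by exact: bigcupT_measurable.
  split=> //; apply: cvgn_uniform_approx => e e0.
  have c0 : fine (P (F k)) @[k --> \oo] --> fine (P (\bigcup_n F n)).
    apply: fine_cvg; rewrite fineK ?fin_num_measure//.
    by apply: nondecreasing_cvg_mu => //; move=> n m nm; exact: ndF.
  have [k _ /(_ k (leqnn k)) hk] := (cvgrPdist_le _ _).1 c0 e e0.
  exists (fun n => \int[P]_(x in F k) a n x); first exact: (hF k).2.
  have FkU : F k `<=` \bigcup_n F n by exact: bigcup_sup.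
  move=> n; rewrite -unit_intD// ger0_norm ?unit_int_ge0//.
  rewrite (le_trans (unit_int_le (ua n) (measurableD mU (mF k))))//.
  rewrite (le_trans _ hk)// measureD//; last by rewrite ltey_eq fin_num_measure.
  rewrite (setIidr FkU) fineB ?fin_num_measure//.
  exact: ler_norm.
Qed.

Section limit_charge.
Variable a : nat -> X -> R.
Hypotheses (ua : forall n, unit_valued (a n))
  (ca : forall B, measurable B -> cvgn (fun n => \int[P]_(x in B) a n x)).

Definition limit_charge B : \bar R := (limn (fun n => \int[P]_(x in B) a n x))%:E.

Let limit_charge0 : limit_charge set0 = 0%E.
Proof.
rewrite /limit_charge; congr EFin; apply/cvg_lim => //.
by under eq_fun do rewrite Rintegral_set0; exact: cvg_cst.
Qed.

Lemma limit_charge_ge0 B : measurable B -> (0 <= limit_charge B)%E.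
Proof.
move=> mB; rewrite lee_fin; apply: limr_ge; first exact: ca.
by apply: nearW => n; exact: unit_int_ge0.
Qed.

Lemma limit_charge_le B : measurable B -> (limit_charge B <= P B)%E.
Proof.
move=> mB; rewrite -[leRHS]fineK ?fin_num_measure// lee_fin.
apply: limr_le; first exact: ca.
by apply: nearW => n; exact: unit_int_le.
Qed.

Let limit_chargeU B C : measurable B -> measurable C -> [disjoint B & C] ->
  limit_charge (B `|` C) = (limit_charge B + limit_charge C)%E.
Proof.
move=> mB mC BC; rewrite /limit_charge -EFinD -limD//; try exact: ca.
congr (EFin (limn _)); apply/funext => n.
by rewrite unit_intU.
Qed.

(** The limit is finitely additive and bounded by [P], so its tails are dominated by those of the
    finite measure [P]. *)
Let limit_charge_sigma : semi_sigma_additive limit_charge.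
Proof.
move=> F mF tF mUF.
have mS n : measurable (\big[setU/set0]_(i < n) F i) by exact: bigsetU_measurable.
have dS n : [disjoint \big[setU/set0]_(i < n) F i & F n].
  apply/disj_setPS => x [+ Fx]; rewrite -bigcup_mkord => -[m /= mn Fmx].
  have mE : m = n by apply: tF => //; exists x.
  by rewrite mE ltnn in mn.
have addE (mu : set X -> \bar R) : mu set0 = 0%E ->
    (forall B C, measurable B -> measurable C -> [disjoint B & C] ->
      mu (B `|` C) = (mu B + mu C)%E) ->
    forall n, (\sum_(0 <= i < n) mu (F i))%E = mu (\big[setU/set0]_(i < n) F i).
  move=> mu0 muU; elim=> [|n IH]; first by rewrite big_geq// big_ord0 mu0.
  rewrite big_nat_recr//= IH big_ord_recr/=.
  by rewrite muU; [|exact: mS|exact: mF|exact: dS].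
have lE := addE limit_charge limit_charge0 limit_chargeU.
have PE := addE P (measure0 P) _.
have {}PE n : (\sum_(0 <= i < n) P (F i))%E = P (\big[setU/set0]_(i < n) F i).
  apply: PE => B C mB mC BC; rewrite measureU//.
  by apply/seteqP; split => // x; move/disj_setPS : BC; exact.
have cP : fine (P (\big[setU/set0]_(i < n) F i)) @[n --> \oo] --> fine (P (\bigcup_n F n)).
  apply: fine_cvg; rewrite fineK ?fin_num_measure//.
  have := @measure_semi_sigma_additive _ _ _ P F mF tF mUF.
  by under eq_fun do rewrite PE.
under eq_fun do rewrite lE.
apply: cvg_EFin; first by apply: nearW.
apply/cvgrPdist_le => e e0.
have [N _ hN] := (cvgrPdist_le _ _).1 cP e e0; exists N => // n /hN {}hN /=.
move: hN => hn; set Un := \big[setU/set0]_(i < n) F i; rewrite -/Un /= -/Un in hn *.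
have UnU : Un `<=` \bigcup_n F n by rewrite /Un -bigcup_mkord; apply: bigcup_subset.
have mD : measurable (\bigcup_n F n `\` Un) by apply: measurableD => //; exact: mS.
have dE : limit_charge (\bigcup_n F n) = (limit_charge Un + limit_charge (\bigcup_n F n `\` Un))%E.
  rewrite -limit_chargeU ?setDUK//; first exact: mS.
  by apply/disj_setPS => x [? []].
have dP : P (\bigcup_n F n) = (P Un + P (\bigcup_n F n `\` Un))%E.
  rewrite -measureU ?setDUK//; first exact: mS.
  by apply/seteqP; split => // x [? []].
move: hn; rewrite dP fineD ?fin_num_measure//; last exact: mS.
rewrite addrC addKr => hn.
have := limit_charge_le mD; have := limit_charge_ge0 mD.
move: dE; rewrite /limit_charge -EFinD => -[->] /=.
rewrite lee_fin => h0; rewrite -[leRHS]fineK ?fin_num_measure// lee_fin => h1.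
rewrite addrC addKr ger0_norm// (le_trans h1)//.
by rewrite (le_trans (ler_norm _) hn).
Qed.

Let limit_charge_fin B : measurable B -> limit_charge B \is a fin_num.
Proof. by []. Qed.

HB.instance Definition _ := isCharge.Build _ X R limit_charge
  limit_charge0 limit_charge_fin limit_charge_sigma.

Let limit_charge_dominates : limit_charge `<< P.
Proof.
apply/null_content_dominatesP => A mA PA0; apply/eqP.
by rewrite eq_le limit_charge_ge0// andbT -PA0 limit_charge_le.
Qed.

(* The Radon-Nikodym density of the limit charge lies in [0, 1] only almost
   everywhere, hence the truncation. *)
Lemma limit_density : exists2 g, unit_valued g &
  forall B, measurable B ->
    \int[P]_(x in B) a n x @[n --> \oo] --> \int[P]_(x in B) g x.
Proof.
pose f := Radon_Nikodym limit_charge P.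
have f_int : P.-integrable setT f by exact: Radon_Nikodym_integrable.
have fE B : measurable B -> (\int[P]_(x in B) f x)%E = limit_charge B.
  by move=> mB; rewrite -Radon_Nikodym_integral.
have ffin x : f x \is a fin_num by exact: Radon_Nikodym_fin_num.
pose h x := fine (f x).
have hf : EFin \o h = f by apply/funext => x; rewrite /h/= fineK.
have h_int B : measurable B -> P.-integrable B (EFin \o h).
  by move=> mB; rewrite hf; apply: integrableS f_int.
have hE B : measurable B -> \int[P]_(x in B) h x = limn (fun n => \int[P]_(x in B) a n x).
  move=> mB; rewrite /Rintegral.
  under eq_integral do rewrite -[(h _)%:E]/((EFin \o h) _) hf.
  by rewrite fE.
have mh : measurable_fun setT h by apply/measurable_EFinP; rewrite hf; exact: measurable_int f_int.
pose g x := Num.max 0 (Num.min 1 (h x)).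
have mg : measurable_fun setT g by apply: measurable_maxr => //; exact: measurable_minr.
have ug : unit_valued g.
  by split => // x; rewrite /g le_max lexx/= ge_max ler01/= ge_min lexx.
have h0 : {ae P, forall x, 0 <= h x}.
  apply: ae_ge0_of_integral; first exact: h_int.
  by move=> B mB; rewrite hE// -lee_fin limit_charge_ge0.
have h1 : {ae P, forall x, 0 <= 1 - h x}.
  apply: ae_ge0_of_integral.
    by apply: integrableB_EFin; [exact: finite_measure_integrable_cst|exact: h_int].
  move=> B mB; rewrite RintegralB//; [|exact: finite_measure_integrable_cst|exact: h_int].
  rewrite Rintegral_cst// mul1r subr_ge0 hE// -lee_fin fineK ?fin_num_measure//.
  exact: limit_charge_le.
exists g => // B mB.
have -> : \int[P]_(x in B) g x = \int[P]_(x in B) h x.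
  rewrite /Rintegral; congr fine; apply: ae_eq_integral => //.
  - by apply/measurable_EFinP; exact: measurable_funTS.
  - by apply/measurable_EFinP; exact: measurable_funTS.
  - apply: filterS2 h0 h1 => x h0 h1 _; congr EFin; rewrite /g.
    by rewrite subr_ge0 in h1; rewrite (min_r h1) (max_r h0).
by rewrite hE//; exact: ca.
Qed.

End limit_charge.

Import HBSimple.

(** Tests pass from indicators to simple functions by linearity, and to all of L^1 by density, with
    an error uniform over functions valued in [0, 1]. *)
Lemma unit_int_tests (a : nat -> X -> R) (g : X -> R) :
  (forall n, unit_valued (a n)) -> unit_valued g ->
  (forall B, measurable B ->
    \int[P]_(x in B) a n x @[n --> \oo] --> \int[P]_(x in B) g x) ->
  forall h : X -> R, P.-integrable setT (EFin \o h) ->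
  \int[P]_x (h x * a n x) @[n --> \oo] --> \int[P]_x (h x * g x).
Proof.
move=> ua ug cB h ih.
have mh : measurable_fun setT h by exact: (integrable_measurable ih).
have uM b k : unit_valued b -> P.-integrable setT (EFin \o k) ->
    P.-integrable setT (EFin \o (fun x => k x * b x)).
  move=> [mb b01] ik.
  have mk : measurable_fun setT k by exact: (integrable_measurable ik).
  apply: (le_integrable _ _ _ ik) => //; first by apply/measurable_EFinP; exact: measurable_funM.
  move=> x _; rewrite lee_fin normrM ler_piMr//.
  by have /andP[b0 b1] := b01 x; rewrite ger0_norm.
have [h_ [ih_ _ hh]] := approximation_sfun_integrable measurableT ih.
have dist k b : unit_valued b -> `|\int[P]_x (h x * b x) - \int[P]_x (h_ k x * b x)| <=
    \int[P]_x `|h x - h_ k x|.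
  move=> ub; rewrite -RintegralB//; [|exact: uM|exact: uM].
  apply: (le_trans (le_normr_Rintegral _ _)) => //.
    by apply: integrableB_EFin; exact: uM.
  apply: le_Rintegral => //.
  - by apply: integrable_norm; apply: integrableB_EFin; exact: uM.
  - by apply: integrable_norm; exact: integrableB_EFin.
  - move=> x _; rewrite -mulrBl normrM ler_piMr//.
    by have [_ /(_ x)/andP[b0 b1]] := ub; rewrite ger0_norm.
have hh' : \int[P]_x `|h x - h_ k x| @[k --> \oo] --> (0 : R).
  by apply: fine_cvg; exact: hh.
have simple k : \int[P]_x (h_ k x * a n x) @[n --> \oo] --> \int[P]_x (h_ k x * g x).
  pose s := finmap.enum_fset (fset_set (range (h_ k))).
  have E b : unit_valued b -> \int[P]_x (h_ k x * b x) =
      \sum_(y <- s) y * \int[P]_(x in h_ k @^-1` [set y]) b x.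
    move=> ub.
    transitivity (\int[P]_x (\sum_(y <- s) y * (\1_(h_ k @^-1` [set y]) x * b x))).
      apply: eq_Rintegral => x _; rewrite fimfunEord mulr_suml (big_nth 0%R) big_mkord.
      by apply: eq_bigr => i _; rewrite mulrA.
    have iy y : P.-integrable setT (EFin \o (fun x => y * (\1_(h_ k @^-1` [set y]) x * b x))).
      apply: integrableZ_EFin; apply: uM => //.
      apply: (@unit_integrable _ setT) => //; split; first exact: measurable_indic.
      by move=> x; rewrite indicE; case: (_ \in _); rewrite ?lexx ler01.
    rewrite Rintegral_sum//; apply: eq_bigr => y _; rewrite RintegralZl//; last first.
      apply: uM => //; apply: (@unit_integrable _ setT) => //; split; first exact: measurable_indic.
      by move=> x; rewrite indicE; case: (_ \in _); rewrite ?lexx ler01.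
    rewrite [in RHS]Rintegral_mkcond; congr (_ * _); apply: eq_Rintegral => x _.
    by rewrite patchE indicE; case: (_ \in _); rewrite ?mul1r ?mul0r.
  under eq_fun do rewrite E//.
  rewrite E//; apply: cvg_bigsum => y _; apply: cvgM; first exact: cvg_cst.
  exact: cB.
apply/cvgrPdist_le => e e0.
have e3 : 0 < e / 3 by rewrite divr_gt0.
have [k _ /(_ k (leqnn k))] := (cvgrPdist_le _ _).1 hh' _ e3.
rewrite sub0r normrN ger0_norm; last by apply: Rintegral_ge0.
move=> hk; have [N _ hN] := (cvgrPdist_le _ _).1 (simple k) _ e3.
exists N => // n /hN {hN} hn.
have d1 := le_trans (dist k _ ug) hk; have d2 := le_trans (dist k _ (ua n)) hk.
move: d1 d2 hn; rewrite !ler_norml => /andP[? ?] /andP[? ?] /andP[? ?].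
apply/andP; split; lra.
Qed.

Lemma weak_star_compact (I : countType) (a : I -> nat -> X -> R) :
  (forall i n, unit_valued (a i n)) ->
  exists2 s : nat -> nat, forall k, (k <= s k)%N &
  exists2 g : I -> X -> R, forall i, unit_valued (g i) &
  forall i (h : X -> R), P.-integrable setT (EFin \o h) ->
  \int[P]_x (h x * a i (s n) x) @[n --> \oo] --> \int[P]_x (h x * g i x).
Proof.
move=> ua.
(* One extraction serves all pairs of a function index [i] and a generating set [G j]. *)
have [|s ks [z cz]] := @diagonal_subseq R (I * nat)%type
  (fun p n => \int[P]_(x in G p.2) a p.1 n x) (fun p => fine (P (G p.2))).
  move=> [i j] n /=; rewrite ger0_norm ?unit_int_ge0//.
  by apply: unit_int_le => //; exact: measurable_G.
exists s => //.
have H i : exists g, unit_valued g /\ forall B, measurable B ->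
    \int[P]_(x in B) a i (s n) x @[n --> \oo] --> \int[P]_(x in B) g x.
  have [|g ug cg] := @limit_density (fun n => a i (s n)) (fun n => ua i (s n)).
    apply: cvg_all_measurable => // j; apply/cvg_ex; exists (z (i, j)).
    exact: (cz (i, j)).
  by exists g.
have /choice[g hg] := H.
exists g => [i|i h ih]; first exact: (hg i).1.
exact: (unit_int_tests (fun n => ua i (s n)) (hg i).1 (hg i).2).
Qed.

End weak_star_bounded.

Section kernel_of_family.
Context d1 d2 (X : measurableType d1) (Y : measurableType d2) (R : realType).
Variable P : X -> probability Y R.

(** The measurability proof is carried by the term, so that the kernel structures below can be
    attached to it. *)
Definition family_kernel
    (mP : forall B, measurable B -> measurable_fun [set: X] (fun x => P x B)) :
  X -> {measure set Y -> \bar R} := P.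

Hypothesis mP : forall B, measurable B -> measurable_fun [set: X] (fun x => P x B).

HB.instance Definition _ := @isKernel.Build _ _ X Y R (family_kernel mP) mP.

Let family_kernelT x : family_kernel mP x setT = 1%E.
Proof. by rewrite /family_kernel/= probability_setT. Qed.

HB.instance Definition _ :=
  @Kernel_isProbability.Build _ _ X Y R (family_kernel mP) family_kernelT.

End kernel_of_family.

Section density_probability.
Context d0 (X : measurableType d0) (R : realType).
Variables (mu : {measure set X -> \bar R}) (f : X -> R).
Local Open Scope ereal_scope.

Definition density_measure (mf : measurable_fun [set: X] f)
    (f0 : forall x, (0 <= f x)%R) (f1 : \int[mu]_x (f x)%:E = 1) (B : set X) :=
  \int[mu]_(x in B) (f x)%:E.

Hypotheses (mf : measurable_fun [set: X] f) (f0 : forall x, (0 <= f x)%R)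
  (f1 : \int[mu]_x (f x)%:E = 1).

Let density0 : density_measure mf f0 f1 set0 = 0.
Proof. by rewrite /density_measure integral_set0. Qed.

Let density_ge0 B : 0 <= density_measure mf f0 f1 B.
Proof. by apply: integral_ge0 => x _; rewrite lee_fin. Qed.

Let density_sigma_additive : semi_sigma_additive (density_measure mf f0 f1).
Proof.
move=> F mF tF mUF; rewrite /density_measure ge0_integral_bigcup//=.
- by apply: is_cvg_ereal_nneg_natsum_cond => n _ _; exact: density_ge0.
- by apply/measurable_EFinP; exact: measurable_funTS.
- by move=> x _; rewrite lee_fin.
Qed.

HB.instance Definition _ := isMeasure.Build _ X R (density_measure mf f0 f1)
  density0 density_ge0 density_sigma_additive.

Let densityT : density_measure mf f0 f1 setT = 1.
Proof. exact: f1. Qed.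

HB.instance Definition _ :=
  @Measure_isProbability.Build _ X R (density_measure mf f0 f1) densityT.

End density_probability.

Section weak_star_line.
Context (R : realType).
Local Notation lambda := (@lebesgue_measure R).
Local Notation RR := (measurableTypeR R).

(** [Some q] codes a ray with rational end point and [None] the whole line, which the pi-system has
    to contain. *)
Let rat_ray (j : nat) : set RR :=
  if unpickle j is Some (Some q) then [set` `]-oo, (ratr q : R)[] else setT.

Let rat_rayE (q : rat) : rat_ray (pickle (Some q)) = [set` `]-oo, (ratr q : R)[].
Proof. by rewrite /rat_ray pickleK. Qed.

Let measurable_rat_ray j : measurable (rat_ray j).
Proof. by rewrite /rat_ray; case: unpickle => [[q|]|]//; exact: measurable_itv. Qed.

Let rat_ray_generates : @measurable _ RR = <<s range rat_ray>>.
Proof.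
apply/seteqP; split; last first.
  by apply: smallest_sub; [exact: sigma_algebra_measurable|move=> _ [j _ <-];
    exact: measurable_rat_ray].
rewrite [X in X `<=` _](RGenInftyO.measurableE R).
apply: smallest_sub; first exact: smallest_sigma_algebra.
move=> _ [x ->].
have -> : `]-oo, x[%classic = \bigcup_(q in [set q : rat | ratr q < x]) [set` `]-oo, (ratr q : R)[].
  apply/seteqP; split=> y /=; rewrite in_itv/=.
    move=> yx; have [q] := rat_in_itvoo yx; rewrite in_itv/= => /andP[yq qx].
    by exists q => //=; rewrite in_itv.
  by move=> [q /= qx]; rewrite in_itv/= => yq; exact: lt_trans qx.
have [_ _ sU] := @smallest_sigma_algebra RR setT (range rat_ray).
rewrite bigcup_mkcond.
pose f (j : nat) : set RR := if unpickle j is Some (Some q) then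
  (if (ratr q : R) < x then [set` `]-oo, (ratr q : R)[] else set0) else set0.
rewrite (_ : \bigcup_q _ = \bigcup_j f j); last first.
  apply/seteqP; split=> [y [q _]|y [j _]].
    case: ifPn => [/set_mem/= qx yq|_ []]; exists (pickle (Some q)); first exact: I.
    by rewrite /f pickleK qx.
  rewrite /f; case: unpickle => [[q|[]]|[]]; case: ifPn => [qx yq|_ []].
  by exists q; [exact: I|rewrite mem_set].
apply: sU => j; rewrite /f; case: unpickle => [[q|]|];
  [|exact: sigma_algebra0|exact: sigma_algebra0].
case: ifPn => _; last exact: sigma_algebra0.
by apply: sub_sigma_algebra; exists (pickle (Some q)) => //; rewrite rat_rayE.
Qed.

Let rat_rayT : range rat_ray setT.
Proof.
by exists (pickle (None : option rat)); [exact: I|rewrite /rat_ray pickleK].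
Qed.

Let rat_rayI : setI_closed (range rat_ray).
Proof.
move=> _ _ [i _ <-] [j _ <-]; rewrite [rat_ray i]/rat_ray.
case: unpickle => [[p|]|]; last 2 first.
- by rewrite setTI; exists j.
- by rewrite setTI; exists j.
rewrite [rat_ray j]/rat_ray; case: unpickle => [[q|]|]; last 2 first.
- by rewrite setIT; exists (pickle (Some p)); [exact: I|rewrite /rat_ray pickleK].
- by rewrite setIT; exists (pickle (Some p)); [exact: I|rewrite /rat_ray pickleK].
have [pq|qp] := leP (ratr p : R) (ratr q).
  exists (pickle (Some p)); first exact: I.
  rewrite rat_rayE; apply/seteqP; split=> x /=; rewrite !in_itv/=; last by case.
  by move=> xp; split=> //; exact: lt_le_trans pq.
exists (pickle (Some q)); first exact: I.
rewrite rat_rayE; apply/seteqP; split=> x /=; rewrite !in_itv/=; last by case.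
by move=> xq; split=> //; exact: lt_trans qp.
Qed.

(* Lebesgue measure is not finite, but has a positive density with respect to the
   standard normal law, to which [weak_star_compact] applies. *)
Lemma weak_star_compact_line (I : countType) (a : I -> nat -> RR -> R) :
  (forall i n, unit_valued (a i n)) ->
  exists2 s : nat -> nat, forall k, (k <= s k)%N &
  exists2 g : I -> RR -> R, forall i, unit_valued (g i) &
  forall i (h : RR -> R), lambda.-integrable setT (EFin \o h) ->
  \int[lambda]_t (h t * a i (s n) t) @[n --> \oo] --> \int[lambda]_t (h t * g i t).
Proof.
move=> ua; pose P : probability RR R := normal_prob (0 : R) 1.
have [s ks [g ug cg]] := weak_star_compact P rat_ray_generates rat_rayI rat_rayT ua.
exists s => //; exists g => // i h ih.
pose p : RR -> R := normal_pdf 0 1.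
have p0 t : 0 < p t.
  by rewrite /p normal_pdfE ?oner_eq0// mulr_gt0 ?normal_peak_gt0 ?oner_eq0// expR_gt0.
have mp : measurable_fun setT p by exact: measurable_normal_pdf.
have mh : measurable_fun setT h by exact: (integrable_measurable ih).
have PE B : measurable B -> P B = (\int[lambda]_(x in B) (p x)%:E)%E by [].
have mhp : measurable_fun setT (fun t => h t / p t).
  apply: measurable_funM => //; apply: continuous_measurable_fun => t.
  by apply: cvgV; [rewrite gt_eqF|exact: continuous_normal_pdf (oner_neq0 _) t].
have hp b t : h t / p t * b t * p t = h t * b t.
  by rewrite mulrAC divfK ?gt_eqF.
have iM b : unit_valued b -> lambda.-integrable setT (EFin \o (fun t => h t / p t * b t * p t)).
  by move=> ub; under [X in _ \o X]eq_fun do rewrite hp; exact: integrable_unit_mul.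
have u1 : @unit_valued _ RR R (fun=> 1).
  by split=> [|z]; [exact: measurable_cst|rewrite ler01 lexx].
have PEi b : unit_valued b ->
    P.-integrable setT (EFin \o (fun t => h t / p t * b t)) /\
    \int[P]_t (h t / p t * b t) = \int[lambda]_t (h t * b t).
  move=> ub; have [] := @integral_density _ _ R lambda P p mp (fun t => ltW (p0 t)) PE
    (fun t => h t / p t * b t) _ (iM _ ub).
    by apply: measurable_funM => //; have [] := ub.
  move=> ? ->; split=> //; apply: eq_Rintegral => t _; exact: hp.
have iP : P.-integrable setT (EFin \o (fun t => h t / p t)).
  by have [+ _] := PEi _ u1; under [X in _ \o X]eq_fun do rewrite mulr1.
have := cg i _ iP; rewrite (PEi _ (ug i)).2.
by under eq_fun do rewrite (PEi _ (ua _ _)).2.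
Qed.

End weak_star_line.

(** * Probability kernels from masses of dyadic cells *)

Section trees.
Context (R : realType).
Local Notation lambda := (@lebesgue_measure R).
Local Notation RR := (measurableTypeR R).
Implicit Types (g : seq bool -> R) (w : seq bool).

(* Mass distributions on the infinite binary tree: [g w] is the mass of the set
   of branches that start with [w]. *)
Definition tree_mass g := g [::] = 1 /\
  forall w, 0 <= g w /\ g w = g (rcons w false) + g (rcons w true).

Lemma tree_mass_le1 g w : tree_mass g -> g w <= 1.
Proof.
move=> [g1 gw]; elim/last_ind: w => [|w b IH]; first by rewrite g1.
apply: le_trans IH; have [_ ->] := gw w.
have [h0 _] := gw (rcons w false); have [h1 _] := gw (rcons w true).
by case: b; rewrite ?lerDl ?lerDr.
Qed.

(* The limit masses are additive only for almost every [t]; on the exceptional set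
   they are replaced by the mass of a single branch. *)
Lemma tree_mass_compact (a : nat -> RR -> seq bool -> R) :
  (forall n t, tree_mass (a n t)) ->
  (forall n w, measurable_fun setT (fun t => a n t w)) ->
  exists2 s : nat -> nat, forall k, (k <= s k)%N &
  exists g : RR -> seq bool -> R, [/\ forall t, tree_mass (g t),
    forall w, measurable_fun setT (fun t => g t w) &
    forall w (h : RR -> R), lambda.-integrable setT (EFin \o h) ->
      \int[lambda]_t (h t * a (s n) t w) @[n --> \oo] --> \int[lambda]_t (h t * g t w)].
Proof.
move=> ta ma.
have ua w n : unit_valued (fun t => a n t w).
  split=> // t; rewrite tree_mass_le1// andbT.
  by have [_ /(_ w)[]] := ta n t.
have [s ks [g0 ug cg]] := weak_star_compact_line ua.
exists s => //.
have iM (b h : RR -> R) : unit_valued b -> lambda.-integrable setT (EFin \o h) ->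
    lambda.-integrable setT (EFin \o (fun t => h t * b t)) by exact: integrable_unit_mul.
pose dflt w : R := (w == nseq (size w) false)%:R.
have td : tree_mass dflt.
  split=> // w; split; first by rewrite /dflt ler0n.
  have E b : (rcons w b == nseq (size (rcons w b)) false) = (w == nseq (size w) false) && (b ==
    false).
    by rewrite size_rcons -addn1 nseqD cats1 eqseq_rcons.
  by rewrite /dflt !E andbT andbF addr0.
pose def0 t := g0 [::] t - 1; pose def w t := g0 w t - (g0 (rcons w false) t + g0 (rcons w true) t).
pose p : RR -> R := normal_pdf 0 1.
have p0 t : 0 < p t.
  by rewrite /p normal_pdfE ?oner_eq0// mulr_gt0 ?normal_peak_gt0 ?oner_eq0// expR_gt0.
have ip : lambda.-integrable setT (EFin \o p) by exact: integrable_normal_pdf.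
have mp : measurable_fun setT p by exact: measurable_normal_pdf.
have mg w : measurable_fun setT (g0 w) by have [] := ug w.
(* A bounded [f] orthogonal to L^1 vanishes almost everywhere: the normal density [p] makes [p f]
   integrable, and testing [f] against it shows that [p f^2] has integral 0. *)
have zero (f : RR -> R) : measurable_fun setT f -> (forall t, `|f t| <= 2) ->
    (forall h, lambda.-integrable setT (EFin \o h) -> \int[lambda]_t (h t * f t) = 0) ->
    {ae lambda, forall t, f t = 0}.
  move=> mf f2 hf.
  have ih : lambda.-integrable setT (EFin \o (fun t => p t * f t)).
    apply: (le_integrable _ _ _ (integrableZ_EFin 2 ip)) => //.
      by apply/measurable_EFinP; exact: measurable_funM.
    by move=> t _ /=; rewrite lee_fin !normrM mulrC ler_pM// [X in _ <= X]ger0_norm.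
  have := hf _ ih => h0.
  have i2 : lambda.-integrable setT (EFin \o (fun t => p t * f t * f t)).
    apply: (le_integrable _ _ _ (integrableZ_EFin 2 ih)) => //.
      by apply/measurable_EFinP; apply: measurable_funM => //; exact: measurable_funM.
    by move=> t _ /=; rewrite lee_fin normrM [leRHS]normrM mulrC ler_pM// [X in _ <= X]ger0_norm.
  have : (\int[lambda]_t `|(EFin \o (fun t : RR => p t * f t * f t)%R) t|)%E = 0%E.
    transitivity (\int[lambda]_t (p t * f t * f t))%:E; last by rewrite h0.
    rewrite /Rintegral fineK; last exact: integrable_fin_num.
    apply: eq_integral => t _ /=; congr EFin; rewrite ger0_norm//.
    by rewrite -mulrA mulr_ge0 ?(ltW (p0 t))// -expr2 sqr_ge0.
  move=> /ae_eq_integral_abs -/(_ measurableT (measurable_int _ i2)).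
  apply: filterS => t /(_ I)[] /eqP; rewrite -mulrA mulf_eq0 gt_eqF//= mulf_eq0 orbb.
  by move=> /eqP.
have ae0 : {ae lambda, forall t, def0 t = 0}.
  apply: zero; first exact: measurable_funB.
    move=> t; have [_ /(_ t)/andP[h0 h1]] := ug [::].
    by rewrite /def0 ler_norml; apply/andP; split; lra.
  move=> h ih; under eq_Rintegral do rewrite mulrBr mulr1.
  rewrite RintegralB//; last exact: iM.
  apply/eqP; rewrite subr_eq0; apply/eqP.
  have c1 := cg [::] h ih.
  have c2 : \int[lambda]_t (h t * a (s n) t [::]) @[n --> \oo] --> \int[lambda]_t h t.
    rewrite (_ : (fun n => _) = fun=> \int[lambda]_t h t); first exact: cvg_cst.
    by apply/funext => n; apply: eq_Rintegral => t _; have [-> _] := ta (s n) t; rewrite mulr1.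
  by rewrite -(cvg_lim _ c1)// -(cvg_lim _ c2).
have aew w : {ae lambda, forall t, def w t = 0}.
  apply: zero; first by apply: measurable_funB => //; exact: measurable_funD.
    move=> t; have [_ /(_ t)/andP[? ?]] := ug w; have [_ /(_ t)/andP[? ?]] := ug (rcons w false).
    have [_ /(_ t)/andP[? ?]] := ug (rcons w true).
    by rewrite /def ler_norml; apply/andP; split; lra.
  move=> h ih; under eq_Rintegral do rewrite mulrBr mulrDr.
  rewrite RintegralB//; [|exact: iM|by apply: integrableD_EFin; exact: iM].
  rewrite RintegralD//; [|exact: iM|exact: iM].
  apply/eqP; rewrite subr_eq0; apply/eqP.
  have c1 := cg w h ih.
  have c2 : (fun n => \int[lambda]_t (h t * a (s n) t (rcons w false)) +
      \int[lambda]_t (h t * a (s n) t (rcons w true))) @ \oo -->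
    \int[lambda]_t (h t * g0 (rcons w false) t) + \int[lambda]_t (h t * g0 (rcons w true) t).
    by apply: (@cvgD _ R^o); exact: cg.
  rewrite -(cvg_lim _ c1)// -(cvg_lim _ c2)//; congr (limn _); apply/funext => n.
  rewrite /= -RintegralD//; [|by apply: iM|by apply: iM].
  by apply: eq_Rintegral => t _; have [_ /(_ w)[_ ->]] := ta (s n) t; rewrite mulrDr.
pose E : set RR := [set t | def0 t = 0] `&` \bigcap_j
  [set t | if unpickle j is Some w then def w t = 0 else True].
have mzero (f : RR -> R) : measurable_fun setT f -> measurable [set t | f t = 0].
  move=> mf; rewrite (_ : [set t | f t = 0] = setT `&` f @^-1` [set 0]); first exact: mf.
  by rewrite setTI.
have mE : measurable E.
  apply: measurableI; first by apply: mzero; exact: measurable_funB.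
  apply: bigcapT_measurable => j; case: unpickle => [w|]; last exact: measurableT.
  by apply: mzero; apply: measurable_funB => //; exact: measurable_funD.
have aeE : {ae lambda, forall t, E t}.
  pose Q (j : nat) (t : RR) : Prop := if unpickle j is Some w then def w t = 0 else True.
  have : {ae lambda, forall t, forall j, Q j t}.
    apply: (@ae_foralln _ _ _ lambda Q) => j.
    by rewrite /Q; case: (unpickle j) => [w|]; [exact: aew|exact: aeW].
  move=> aeQ; apply: filterS2 ae0 aeQ => t h0 h; split; first exact: h0.
  by move=> j _; exact: h.
pose g t w := if t \in E then g0 w t else dflt w.
have mi : measurable_fun setT (\1_E : RR -> R) by exact: measurable_indic.
have mgg w : measurable_fun setT (fun t => g t w).
  rewrite (_ : (fun t => _) = fun t => g0 w t * \1_E t + dflt w * (1 - \1_E t)).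
    apply: measurable_funD; apply: measurable_funM => //.
    exact: measurable_funB.
  by apply/funext => t; rewrite /g indicE; case: (t \in E) => /=; ring.
exists g; split.
- move=> t; rewrite /g; have [tE|tE] := boolP (t \in E); last exact: td.
  have [t0 tw] := set_mem tE; split.
    by apply/eqP; rewrite -subr_eq0; apply/eqP.
  move=> w; split; first by have [_ /(_ t)/andP[]] := ug w.
  have := tw (pickle w) I; rewrite pickleK => /eqP; rewrite subr_eq0 => /eqP.
  by [].
- exact: mgg.
- move=> w h ih.
  rewrite (_ : \int[lambda]_t (h t * g t w) = \int[lambda]_t (h t * g0 w t)); first exact: cg.
  have mh : measurable_fun setT h by exact: (integrable_measurable ih).
  rewrite /Rintegral; congr fine; apply: ae_eq_integral => //.
  + by apply/measurable_EFinP; exact: measurable_funM.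
  + by apply/measurable_EFinP; exact: measurable_funM.
  + by apply: filterS aeE => t tE _; rewrite /g mem_set.
Qed.

Fixpoint tree_left_aux g (u w : seq bool) : R :=
  if w is b :: w' then
    (if b then g (rcons u false) else 0) + tree_left_aux g (rcons u b) w'
  else 0.

(* Left end point of the interval of length [g w] attached to [w] when the
   children of every node split its interval from left to right. *)
Definition tree_left g w := tree_left_aux g [::] w.

Lemma tree_left_rcons g w b :
  tree_left g (rcons w b) = tree_left g w + (if b then g (rcons w false) else 0).
Proof.
rewrite /tree_left -[X in rcons X false]cat0s.
elim: w {1 2 3}[::] => [|c w IH] u /=.
  by rewrite cats0 addr0 add0r.
by rewrite IH cat_rcons addrA.
Qed.

(** Descent of the tree guided by [o]: the right child is taken as soon as [o] lies beyond the
    interval of the left child. *)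
Fixpoint branch g (o : R) m : seq bool :=
  if m is m'.+1 then let w := branch g o m' in
    rcons w (tree_left g w + g (rcons w false) <= o)
  else [::].

Lemma size_branch g o m : size (branch g o m) = m.
Proof. by elim: m => //= m IH; rewrite size_rcons IH. Qed.

Lemma tree_left_itv g w : tree_mass g -> 0 <= tree_left g w /\ tree_left g w + g w <= 1.
Proof.
move=> tg; have [g1 gw] := tg.
elim/last_ind: w => [|w b [h0 h1]]; first by rewrite /tree_left/= g1 add0r.
have [_ E] := gw w; have [g0 _] := gw (rcons w false); have [g0' _] := gw (rcons w true).
rewrite tree_left_rcons; case: b; split.
- by rewrite addr_ge0.
- by rewrite -addrA -E.
- by rewrite addr0.
- by rewrite addr0 (le_trans _ h1)// lerD2l E lerDl.
Qed.

(** Half-open intervals split exactly, so the [o] whose branch starts with [w] form an interval of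
    length [g w], empty when the mass is 0. A uniform [o] therefore gives a random branch with the
    prescribed masses. *)
Lemma branchP g (o : R) w : tree_mass g -> 0 <= o < 1 ->
  (branch g o (size w) == w) = (tree_left g w <= o < tree_left g w + g w).
Proof.
move=> tg o01; have [g1 gw] := tg.
elim/last_ind: w => [|w b IH]; first by rewrite /tree_left/= g1 add0r o01 eqxx.
rewrite size_rcons/= eqseq_rcons IH tree_left_rcons.
have [_ E] := gw w; have [g0 _] := gw (rcons w false); have [g0' _] := gw (rcons w true).
have [e|bw] := eqVneq (branch g o (size w)) w.
  rewrite e eqxx in IH; have /andP[h1 h2] := esym IH; rewrite h1 h2 e/=.
  rewrite E addrA in h2.
  case: b; first by rewrite h2 andbT eqb_id.
  by rewrite addr0 h1/= eqbF_neg ltNge.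
rewrite -IH (negbTE bw)/=; apply/esym/negP => /andP[h1 h2].
have : tree_left g w <= o < tree_left g w + g w.
  rewrite E; move: h1 h2; case: (b) => h1 h2; apply/andP; split; lra.
by rewrite -IH (negbTE bw).
Qed.

End trees.

(** * Binary digits of angles *)

Section dyadic_angles.
Context (R : realType).

Definition turn (a : R) : R := a / (2 * pi) - (Num.floor (a / (2 * pi)))%:~R.

(** The first binary digit of [turn a], written with sine and cosine so that it is periodic and
    measurable on the torus. The clause [cos a == -1] puts the exact half turn in the upper half. *)
Definition half_turn (a : R) := (sin a < 0) || (cos a == -1).

Let pi2_gt0 : 0 < 2 * pi :> R. Proof. by rewrite mulr_gt0// pi_gt0. Qed.

Lemma turn_itv a : 0 <= turn a < 1.
Proof.
have /andP[h1 h2] := floor_itv (a / (2 * pi)).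
by rewrite /turn subr_ge0 h1/= ltrBlDr addrC -[X in _ + X]/(1%:~R) -intrD.
Qed.

Lemma turnE a : a = 2 * pi * turn a + (Num.floor (a / (2 * pi)))%:~R * (2 * pi).
Proof. by rewrite /turn mulrBr mulrC divfK ?gt_eqF// [X in _ - X]mulrC subrK. Qed.

Lemma half_turnE a : half_turn a = (2^-1 <= turn a).
Proof.
rewrite /half_turn {1 2}(turnE a) sin_int_periodic cos_int_periodic.
have /andP[t0 t1] := turn_itv a; set s := 2 * pi * turn a.
have s0 : 0 <= s by rewrite mulr_ge0// ltW.
have [h|h] := leP 2^-1 (turn a); last first.
  have sp : s < pi.
    by rewrite /s mulrC mulrA -ltr_pdivlMr ?pi_gt0// divff ?gt_eqF ?pi_gt0//; lra.
  rewrite ltNge sin_ge0_pi ?s0 ?ltW//=; apply/negP => /eqP cs.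
  (* Then [turn a + 1/2] would be an integer strictly between 0 and 1. *)
  have : cos (s + pi) = 1 by rewrite cosDpi cs opprK.
  move=> /cos_eq1; have -> : (s + pi) / (2 * pi) = turn a + 2^-1.
      have p2 : 2 * pi != 0 :> R by rewrite gt_eqF.
    by apply: (mulIf p2); rewrite divfK// mulrDl mulKf// mulrC.
  move=> /intrP[n hn].
  have n0 : (0 < n%:~R :> R) by rewrite -hn; lra.
  have n1 : (n%:~R < 1%:~R :> R) by rewrite -hn; lra.
  by move: n0 n1; rewrite ltr0z ltr_int; lia.
have sp : pi <= s.
  by rewrite /s mulrC mulrA -ler_pdivrMr ?pi_gt0// divff ?gt_eqF ?pi_gt0//; lra.
have s2 : s < 2 * pi by rewrite /s gtr_pMr.
have [->|sp'] := eqVneq s pi; first by rewrite cospi eqxx orbT.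
apply/orP; left; rewrite -(subrK pi s) sinDpi oppr_lt0 sin_gt0_pi//.
by rewrite subr_gt0 lt_neqAle eq_sym sp' sp/= ltrBlDr -mulr2n -mulr_natl.
Qed.

(** Doubling the angle shifts its binary expansion; later digits are thus read by [half_turn] from
    multiples by powers of 2. *)
Lemma turn_double a : turn (2 * a) = 2 * turn a - (half_turn a)%:R.
Proof.
have /andP[t0 t1] := turn_itv a.
have -> : (half_turn a)%:R = (half_turn a : nat)%:Z%:~R :> R by [].
suff h : Num.floor (2 * a / (2 * pi)) = 2 * Num.floor (a / (2 * pi)) + (half_turn a : nat)%:Z.
  rewrite /turn h intrD intrM; ring.
have : a / (2 * pi) = turn a + (Num.floor (a / (2 * pi)))%:~R by rewrite /turn subrK.
set n := Num.floor _ => E.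
apply: Num.Theory.floor_def; rewrite -mulrA E !intrD intrM half_turnE.
by have [h|h] := leP 2^-1 (turn a) => /=; apply/andP; split; lra.
Qed.

End dyadic_angles.

Section torus_code.
Context (R : realType) (d : nat).
Local Notation T := (torus R d).
Implicit Types (x y : T) (i : 'I_d) (w : seq bool).

(* The number of the first [m] binary digits that concern the coordinate [i],
   when the digits of the [d] coordinates are interlaced. *)
Definition digit_rank i m := ((m + (d.-1 - i)) %/ d)%N.

Lemma digit_rankS i m : digit_rank i m.+1 = ((m %% d == i)%N + digit_rank i m)%N.
Proof.
have d0 : (0 < d)%N by exact: leq_ltn_trans (ltn_ord i).
rewrite /digit_rank addSn divnS//; congr (nat_of_bool _ + _)%N.
have id := ltn_ord i; rewrite {1}(divn_eq m d).
have md := ltn_pmod m d0.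
have -> : (m %/ d * d + m %% d + (d.-1 - i)).+1 = (m %/ d * d + (m %% d + d - i))%N by lia.
rewrite dvdn_addr ?dvdn_mull//; apply/idP/eqP => [|->]; last by rewrite addnC addnK.
move=> /dvdnP[[|[|q]]]; lia.
Qed.

Lemma digit_rank_ge i m : (m %/ d <= digit_rank i m)%N.
Proof. by rewrite leq_div2r// leq_addr. Qed.

(** The coordinate is found by an existential because [m %% d] names an element of ['I_d] only when
    [d] is positive. *)
Definition digit x m := [exists i : 'I_d, (m %% d == i)%N &&
  half_turn (2 ^+ digit_rank i m * repr x ord0 i)].

Definition torus_code x m := mkseq (digit x) m.

Lemma digitE x m i : (m %% d)%N = i ->
  digit x m = half_turn (2 ^+ digit_rank i m * repr x ord0 i).
Proof.
move=> mi; apply/existsP/idP => [[j /andP[/eqP mj]]|h].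
  by have -> : j = i by apply: val_inj; rewrite /= -mi.
by exists i; rewrite mi eqxx.
Qed.

(** Lower corner, in the coordinate [i], of the box of angles whose interlaced digits start with
    [w]; [word_err] is the side of that box. *)
Definition word_coord i w : R := \sum_(l < size w)
  if (l %% d == i)%N then 2 * pi / 2 ^+ (digit_rank i l).+1 * (nth false w l)%:R else 0.

Definition word_err i m : R := 2 * pi / 2 ^+ digit_rank i m.

Definition word_pt w : T := tpi (\row_i word_coord i w).

Let half_pow (k : nat) : 2 * pi / 2 ^+ k.+1 = 2 * pi / 2 ^+ k / 2 :> R.
Proof. by rewrite exprS invfM [2^-1 * _]mulrC mulrA. Qed.

Lemma word_coord_rcons i w b : word_coord i (rcons w b) = word_coord i w +
  if (size w %% d == i)%N then word_err i (size w) / 2 * b%:R else 0.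
Proof.
rewrite /word_coord size_rcons big_ord_recr/=; congr (_ + _).
  by apply: eq_bigr => l _; rewrite nth_rcons ltn_ord.
by rewrite nth_rcons ltnn eqxx /word_err half_pow.
Qed.

Lemma word_errS i m : word_err i m.+1 = if (m %% d == i)%N then word_err i m / 2 else word_err i m.
Proof.
rewrite /word_err digit_rankS; by case: eqP.
Qed.

Lemma word_err_ge0 i m : 0 <= word_err i m.
Proof. by rewrite /word_err divr_ge0 ?exprn_ge0// mulr_ge0// pi_ge0. Qed.

(** Exact remainder after [m] digits: the turn of the angle multiplied by a power of 2, rescaled to
    the box. Each new digit is one use of [turn_double]. *)
Lemma word_coord_code x i m :
  word_coord i (torus_code x m) + word_err i m * turn (2 ^+ digit_rank i m * repr x ord0 i) =
  2 * pi * turn (repr x ord0 i).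
Proof.
elim: m => [|m <-].
  have r0 : digit_rank i 0 = 0%N.
    by rewrite /digit_rank add0n divn_small//; have := ltn_ord i; lia.
  by rewrite /word_coord/= big_ord0 add0r /word_err r0 expr0 divr1 mul1r.
rewrite /torus_code mkseqS word_coord_rcons size_mkseq word_errS digit_rankS.
case: eqP => [mi|_]; last by rewrite addr0 add0n.
by rewrite -[(true + _)%N]/(digit_rank i m).+1 exprS -[2 * _ * _]mulrA turn_double (digitE _
  mi); field.
Qed.

Lemma word_coord_code_itv x i m :
  word_coord i (torus_code x m) <= 2 * pi * turn (repr x ord0 i) <=
  word_coord i (torus_code x m) + word_err i m.
Proof.
have /andP[t0 t1] := turn_itv (2 ^+ digit_rank i m * repr x ord0 i).
rewrite -(word_coord_code x i m) lerDl mulr_ge0 ?word_err_ge0//= lerD2l.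
by rewrite ler_piMr ?word_err_ge0// ltW.
Qed.

(** Valid for every word, not only for codes of points: the boxes along any branch are nested, so
    their corners converge. *)
Lemma word_coord_step i w b : word_coord i w <= word_coord i (rcons w b) /\
  word_coord i (rcons w b) + word_err i (size (rcons w b)) <= word_coord i w + word_err i (size w).
Proof.
have := word_err_ge0 i (size w).
rewrite word_coord_rcons size_rcons word_errS; case: eqP => _; case: b => /= h; split; lra.
Qed.

Definition word_eps m : R := d%:R * (2 * pi / 2 ^+ (m %/ d)).

Lemma word_err_le i m : word_err i m <= 2 * pi / 2 ^+ (m %/ d).
Proof.
rewrite /word_err ler_wpM2l ?mulr_ge0 ?pi_ge0// lef_pV2 ?posrE ?exprn_gt0//.
by rewrite ler_weXn2l ?digit_rank_ge// ler1n.
Qed.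

Lemma word_eps_cvg0 : (0 < d)%N -> word_eps m @[m --> \oo] --> 0.
Proof.
move=> d0; apply/cvgrPdist_le => e e0.
pose C : R := d%:R * (2 * pi).
have C0 : 0 < C by rewrite mulr_gt0 ?ltr0n// mulr_gt0// pi_gt0.
near=> m; rewrite sub0r normrN ger0_norm; last first.
  by rewrite /word_eps mulr_ge0// divr_ge0 ?exprn_ge0// mulr_ge0// pi_ge0.
rewrite /word_eps mulrA ler_pdivrMr ?exprn_gt0// -ler_pdivrMl//.
apply: (@le_trans _ _ ((m %/ d)%:R : R)); last first.
  by rewrite -natrX ler_nat ltnW// ltn_expl.
apply: (@le_trans _ _ ((Num.trunc (e^-1 * C)).+1%:R)); first by rewrite ltW// truncnS_gt.
rewrite ler_nat leq_divRL//; near: m; exact: nbhs_infty_ge.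
Unshelve. all: by end_near. Qed.

(** Closed boxes and free angles [a] are needed because the limit of a branch may be the right end
    point of its boxes, which never happens for the code of a point. *)
Lemma tdist_word_pt x w (a : 'I_d -> R) :
  (forall i, word_coord i w <= a i <= word_coord i w + word_err i (size w)) ->
  (forall i, exists n : int, repr x ord0 i = a i + n%:~R * (2 * pi)) ->
  tdist x (word_pt w) <= word_eps (size w).
Proof.
move=> ha hx; rewrite tdist_tpi /word_eps.
apply: (@le_trans _ _ (\sum_(i < d) 2 * pi / 2 ^+ (size w %/ d))); last first.
  by rewrite sumr_const card_ord -[leLHS]mulr_natl.
apply: ler_sum => i _; rewrite mxE; have [n ->] := hx i.
rewrite addrAC cos_int_periodic.
apply: le_trans (word_err_le i (size w)).
have /andP[h1 h2] := ha i.
have := cos_dist_le 0 (a i - word_coord i w); rewrite cos0 sub0r normrN.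
by move=> /ler_normlP[_]; rewrite ger0_norm ?subr_ge0// => h; lra.
Qed.

Lemma tdist_code x m : tdist x (word_pt (torus_code x m)) <= word_eps m.
Proof.
rewrite -[m in word_eps m](size_mkseq (digit x)).
apply: (tdist_word_pt (a := fun i => 2 * pi * turn (repr x ord0 i))) => i.
  by rewrite size_mkseq; exact: word_coord_code_itv.
by exists (Num.floor (repr x ord0 i / (2 * pi))); exact: turnE.
Qed.

Definition cell w : set T := [set x | torus_code x (size w) = w].

Lemma half_turn_measurable i (k : nat) :
  measurable [set x : T | half_turn (2 ^+ k * repr x ord0 i)].
Proof.
pose c (e : R) (x : T) := cos ((2 ^+ k)%:~R * repr x ord0 i + e).
have mc e : measurable_fun setT (c e).
  by apply: torus_continuous_measurable; exact: cos_coord_continuous.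
rewrite (_ : [set x | _] = [set x | c (- (pi / 2)) x < 0] `|` [set x | c 0 x = -1]).
  apply: measurableU.
    rewrite -[X in measurable X]setTI.
    rewrite (_ : [set x | _] = c (- (pi / 2)) @^-1` [set` `]-oo, 0[]); first exact: mc.
    by apply/seteqP; split=> x /=; rewrite in_itv.
  rewrite -[X in measurable X]setTI.
  rewrite (_ : [set x | _] = c 0 @^-1` [set -1]); first exact: mc.
  by apply/seteqP; split.
apply/seteqP; split=> x; rewrite /half_turn /c /= cosBpihalf addr0 rmorphXn/=.
  by move=> /orP[|/eqP]; [left|right].
by move=> [->//|->]; rewrite eqxx orbT.
Qed.

Lemma digit_measurable m : measurable [set x : T | digit x m].
Proof.
rewrite (_ : [set x | _] = \bigcup_(i in [set i : 'I_d | (m %% d == i)%N])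
    [set x : T | half_turn (2 ^+ digit_rank i m * repr x ord0 i)]).
  apply: fin_bigcup_measurable => [|i _]; first exact: finite_finset.
  exact: half_turn_measurable.
apply/seteqP; split=> x /=.
  by move=> /existsP[i /andP[h1 h2]]; exists i.
by move=> [i /= h1 h2]; apply/existsP; exists i; rewrite h1.
Qed.

Lemma cell_rcons w b : cell (rcons w b) = cell w `&` [set x | digit x (size w) = b].
Proof.
apply/seteqP; split=> x; rewrite /cell/= size_rcons /torus_code mkseqS.
  by move=> /eqP; rewrite eqseq_rcons => /andP[/eqP h1 /eqP h2].
by move=> [-> ->].
Qed.

Lemma cell_measurable w : measurable (cell w).
Proof.
elim/last_ind: w => [|w b IH].
  by rewrite (_ : cell _ = setT)//; apply/seteqP; split.
rewrite cell_rcons; apply: measurableI => //.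
case: b; first exact: digit_measurable.
rewrite (_ : [set x | _] = ~` [set x | digit x (size w)]).
  by apply: measurableC; exact: digit_measurable.
apply/seteqP; split=> x /=; first by move=> ->.
by move=> /negP/negbTE.
Qed.

Lemma cell_tree_mass (P : probability T R) : tree_mass (fun w => fine (P (cell w))).
Proof.
split; first by rewrite (_ : cell _ = setT) ?probability_setT//; apply/seteqP; split.
move=> w; split; first by rewrite fine_ge0.
rewrite -fineD ?fin_num_measure//; try exact: cell_measurable.
rewrite -measureU//; try exact: cell_measurable.
  congr (fine (P _)); rewrite !cell_rcons -setIUr.
  by rewrite (_ : _ `|` _ = setT) ?setIT//; apply/seteqP; split=> x //= _; case: digit;
    [right|left].
by rewrite !cell_rcons; apply/seteqP; split=> x // [[_ /= ->] [_]].
Qed.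

End torus_code.

Lemma prob_bounded_integrable d0 (X : measurableType d0) (R : realType)
    (P : probability X R) (f : X -> R) (M : R) : measurable_fun [set: X] f ->
  (forall x, `|f x| <= M) -> P.-integrable [set: X] (EFin \o f).
Proof.
move=> mf fM; apply: measurable_bounded_integrable => //.
  by rewrite ltey_eq fin_num_measure.
by exists M; split=> [|N MN x _ /=]; rewrite ?num_real// (le_trans (fM x))// ltW.
Qed.

Lemma prob_int_cst d0 (X : measurableType d0) (R : realType) (P : probability X R) (c : R) :
  \int[P]_x c = c.
Proof. by rewrite Rintegral_cst// [fine _](congr1 fine (probability_setT P)) /= mulr1. Qed.

Section law.
Context d1 d2 (X : measurableType d1) (Y : measurableType d2) (R : realType).
Variables (P : probability X R) (f : X -> Y).

Definition law (mf : measurable_fun [set: X] f) : set Y -> \bar R := image_measure P mf.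

Hypothesis mf : measurable_fun [set: X] f.

HB.instance Definition _ := Measure.copy (law mf) (image_measure P mf).

Let lawT : law mf setT = 1%E.
Proof. by rewrite /law/image_measure/= /pushforward preimage_setT probability_setT. Qed.

HB.instance Definition _ := @Measure_isProbability.Build _ Y R (law mf) lawT.

Lemma integral_law (g : Y -> R) (M : R) : measurable_fun [set: Y] g ->
  (forall y, `|g y| <= M) -> \int[law mf]_y g y = \int[P]_x g (f x).
Proof.
move=> mg gM.
rewrite /Rintegral/= (@integral_pushforward _ _ X Y R f mf P setT (EFin \o g))//.
- exact/measurable_EFinP.
- rewrite preimage_setT; apply: (@prob_bounded_integrable _ _ _ P (fun x => g (f x)) M) => //.
  exact: measurableT_comp.
Qed.

End law.

Section word_integral.
Context d0 (X : measurableType d0) (R : realType) (P : probability X R).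
Variables (m : nat) (f : X -> seq bool).
Hypothesis fm : forall x, size (f x) = m.
Hypothesis mf : forall w, measurable [set x | f x = w].

Let bnd (F : seq bool -> R) x : F (f x) = \sum_(w : m.-tuple bool) F w * \1_[set x | f x = w] x.
Proof.
have sx : size (f x) == m by apply/eqP.
rewrite (bigD1 (Tuple sx))//= [X in _ + X]big1 ?addr0 => [|w wx].
  by rewrite indicE mem_set// mulr1.
rewrite indicE memNset ?mulr0//= => fw; case/eqP: wx.
by apply: val_inj.
Qed.

(** Compares an integral with a sum over words weighted by their masses. It is applied both to cells
    under a given probability and to random branches under the uniform law. *)
Lemma word_integral_le (F : seq bool -> R) (g : X -> R) (e : R) :
  measurable_fun [set: X] g -> (forall x, `|g x - F (f x)| <= e) ->
  `|\int[P]_x g x - \sum_(w : m.-tuple bool) F w * fine (P [set x | f x = w])| <= e.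
Proof.
move=> mg gF.
have i1 w : P.-integrable setT (EFin \o (\1_[set x | f x = w] : X -> R)).
  apply: (@prob_bounded_integrable _ _ _ P _ 1) => [|x]; first exact: measurable_indic.
  by rewrite indicE; case: (_ \in _); rewrite ?normr1 ?normr0.
have i2 (w : seq bool) : P.-integrable setT (EFin \o (fun x => F w * \1_[set x | f x = w] x)).
  exact: (integrableZ_EFin (F w) (i1 w)).
have iF : P.-integrable setT (EFin \o (fun x => F (f x))).
  rewrite (_ : EFin \o _ = EFin \o (fun x => \sum_(w : m.-tuple bool) F w * \1_[set x | f x = w]
    x)).
    by apply: integrable_sum_EFin => w; exact: i2.
  by apply/funext => x /=; rewrite bnd.
have id : P.-integrable setT (EFin \o (fun x => g x - F (f x))).
  apply: (@prob_bounded_integrable _ _ _ P _ e) => //; apply: measurable_funB => //.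
  by exact: (integrable_measurable iF).
have ig : P.-integrable setT (EFin \o g).
  rewrite (_ : EFin \o g = EFin \o (fun x => (g x - F (f x)) + F (f x))).
    exact: integrableD_EFin.
  by apply/funext => x /=; rewrite subrK.
have -> : \sum_(w : m.-tuple bool) F w * fine (P [set x | f x = w]) = \int[P]_x F (f x).
  under [RHS]eq_Rintegral do rewrite bnd.
  rewrite Rintegral_sum => [|w]; last exact: i2.
  apply: eq_bigr => w _; rewrite RintegralZl//; congr (_ * _).
  by rewrite /Rintegral integral_indic// setIT.
rewrite -[leRHS](prob_int_cst P); apply: Rintegral_dist_le => //.
by apply: (@prob_bounded_integrable _ _ _ P _ `|e|).
Qed.

End word_integral.

Section tree_kernel.
Context (R : realType) (d : nat).
Local Notation lambda := (@lebesgue_measure R).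
Local Notation RR := (measurableTypeR R).
Local Notation T := (torus R d).
Variable g : RR -> seq bool -> R.
Hypotheses (tg : forall t, tree_mass (g t)) (mg : forall w, measurable_fun setT (fun t => g t w)).

Lemma measurable_tree_left w : measurable_fun setT (fun t => tree_left (g t) w).
Proof.
elim/last_ind: w => [|w b IH]; first exact: measurable_cst.
under eq_fun do rewrite tree_left_rcons.
by apply: measurable_funD => //; case: b => //; exact: measurable_cst.
Qed.

(** Quantifying over [F] makes the induction possible: the next bit compares [p.2] with a function
    of the branch built so far, itself of the form [F]. *)
Lemma measurable_branch (F : RR -> seq bool -> R) m :
  (forall w, measurable_fun setT (fun t => F t w)) ->
  measurable_fun setT (fun p : RR * RR => F p.1 (branch (g p.1) p.2 m)).
Proof.
elim: m F => [|m IH] F mF /=.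
  exact: (measurableT_comp (mF [::]) measurable_fst).
pose L (t : RR) w := tree_left (g t) w + g t (rcons w false).
rewrite (_ : (fun p => _) = fun p : RR * RR =>
    if L p.1 (branch (g p.1) p.2 m) <= p.2 then F p.1 (rcons (branch (g p.1) p.2 m) true)
    else F p.1 (rcons (branch (g p.1) p.2 m) false)); last first.
  by apply/funext => p; rewrite /L; case: (_ <= _).
apply: measurable_fun_ifT.
- apply: measurable_fun_ler; last exact: measurable_snd.
  apply: (IH L) => w; apply: measurable_funD; last exact: mg.
  exact: measurable_tree_left.
- by apply: (IH (fun t w => F t (rcons w true))).
- by apply: (IH (fun t w => F t (rcons w false))).
Qed.

Definition branch_coord (i : 'I_d) (p : RR * RR) : R :=
  limn (fun m => word_coord R i (branch (g p.1) p.2 m)).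

Lemma branch_coord_itv i p m :
  (word_coord R i (branch (g p.1) p.2 m)) @[m --> \oo] --> branch_coord i p /\
  word_coord R i (branch (g p.1) p.2 m) <= branch_coord i p <=
    word_coord R i (branch (g p.1) p.2 m) + word_err R i m.
Proof.
set u := fun m => word_coord R i (branch (g p.1) p.2 m).
have st k : u k <= u k.+1 /\ u k.+1 + word_err R i k.+1 <= u k + word_err R i k.
  rewrite /u /=.
  set b := (_ <= p.2); have := word_coord_step R i (branch (g p.1) p.2 k) b.
  by rewrite size_rcons size_branch.
have ndu : nondecreasing_seq u by apply/nondecreasing_seqP => k; have [] := st k.
have niu : nonincreasing_seq (fun k => u k + word_err R i k).
  by apply/nonincreasing_seqP => k; have [_] := st k.
have ub k : u k <= u m + word_err R i m.
  have [km|mk] := leqP k m.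
    by rewrite (le_trans (ndu _ _ km))// lerDl word_err_ge0.
  apply: le_trans (niu _ _ (ltnW mk)); by rewrite lerDl word_err_ge0.
have cu : cvgn u.
  by apply: nondecreasing_is_cvgn => //; exists (u m + word_err R i m) => _ [k _ <-].
split; first exact: cu.
apply/andP; split; first exact: nondecreasing_cvgn_le.
apply: limr_le; first exact: cu.
by exists 0%N => // k _; exact: ub.
Qed.

Definition branch_pt (p : RR * RR) : T := torus_of_tuple [tuple branch_coord i p | i < d].

Lemma measurable_branch_pt : measurable_fun setT branch_pt.
Proof.
apply: (measurableT_comp (@measurable_torus_of_tuple R d)).
apply/measurable_fun_tnthP => i.
rewrite (_ : _ \o _ = branch_coord i); last by apply/funext => p /=; rewrite tnth_mktuple.
apply: (@measurable_fun_cvg _ _ _ _ (fun m (p : RR * RR) => word_coord R i (branch (g p.1) p.2 m))).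
  by move=> m; apply: (measurable_branch (F := fun=> word_coord R i)) => w; exact: measurable_cst.
by move=> p _; have [] := branch_coord_itv i p 0.
Qed.

Lemma tdist_branch_pt p m : tdist (branch_pt p) (word_pt R d (branch (g p.1) p.2 m)) <= word_eps
  R d m.
Proof.
rewrite -{2}(size_branch (g p.1) p.2 m).
apply: (tdist_word_pt (a := fun i => branch_coord i p)) => i.
  by rewrite size_branch; have [] := branch_coord_itv i p m.
rewrite /branch_pt /torus_of_tuple.
have [n] := repr_tpi (\row_i tnth [tuple branch_coord i p | i < d] i) i.
by rewrite mxE tnth_mktuple; exists n.
Qed.

Let f (o : RR) : R := \1_(`[0, 1[%classic : set RR) o.

Let mf : measurable_fun setT f.
Proof. by apply: measurable_indic; exact: measurable_itv. Qed.

Let f0 o : 0 <= f o. Proof. by rewrite /f indicE ler0n. Qed.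

Let f1 : (\int[lambda]_o (f o)%:E = 1)%E.
Proof.
rewrite /f integral_indic; [|exact: measurableT|exact: measurable_itv].
by rewrite setIT [LHS](@lebesgue_measure_itv R)/= lte_fin ltr01 oppr0 adde0.
Qed.

Let U : probability RR R := density_measure mf f0 f1.

Let UE a b : 0 <= a -> a <= b -> b <= 1 -> U (`[a, b[%classic) = (b - a)%:E.
Proof.
move=> a0 ab b1; rewrite /U/= /density_measure integral_indic//; [|exact: measurable_itv..].
rewrite (_ : _ `&` _ = `[a, b[%classic).
  rewrite [LHS](@lebesgue_measure_itv R)/= lte_fin.
  case: ifPn => [_|]; first by rewrite EFinB.
  by rewrite -leNgt => ba; rewrite (@le_anti _ _ a b) ?ab// subrr.
apply/seteqP; split=> x /=; rewrite !in_itv/=; first by move=> [].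
by move=> /andP[ax xb]; rewrite ax xb; split=> //; rewrite (le_trans a0 ax) (lt_le_trans xb).
Qed.

Let mpt t : measurable_fun setT (fun o : RR => branch_pt (t, o)).
Proof. by apply: measurableT_comp; [exact: measurable_branch_pt|exact: measurable_pair1]. Qed.

Let P (t : RR) : probability T R := law U (mpt t).

Let mP B : measurable B -> measurable_fun [set: RR] (fun t => P t B).
Proof.
move=> mB.
have mA : measurable (branch_pt @^-1` B).
  by rewrite -[X in measurable X]setTI; exact: measurable_branch_pt.
have := measurable_fun_xsection U mA.
congr measurable_fun; apply/funext => t; rewrite /P/= /law/= /image_measure/= /pushforward.
by congr (_ _); apply/seteqP; split=> o; rewrite /xsection/= inE.
Qed.

(* The law of the random branch driven by a uniform variable on [0, 1[. *)
Definition tree_kernel : Linfty_prob R d :=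
  @family_kernel _ _ (R : measurableType default_measure_display) T R P mP.

(** Up to the cell size, an integral against this kernel is the same finite sum of masses as for a
    probability with these cell masses, uniformly in [t]. Convergence of masses thus gives
    convergence of integrals. *)
Lemma tree_kernel_integral (chi : T -> R) (e C : R) m t : continuous chi ->
  (forall x y, `|chi x - chi y| <= e + C * tdist x y) -> 0 <= C ->
  `|\int[tree_kernel t]_x chi x - \sum_(w : m.-tuple bool) chi (word_pt R d w) * g t w| <=
    e + C * word_eps R d m.
Proof.
move=> cchi hchi C0; have [M M0 hM] := torus_bounded cchi.
have mchi := torus_continuous_measurable cchi.
rewrite [X in X - _](_ : _ = \int[U]_o chi (branch_pt (t, o)));
  last exact: (integral_law U (mpt t) mchi hM).
have mb w : measurable [set o : RR | branch (g t) o m = w].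
  pose F (_ : RR) v : R := (v == w)%:R.
  have mF : measurable_fun setT (fun o : RR => F t (branch (g t) o m)).
    apply: (@measurableT_comp _ _ _ _ _ _ (fun p : RR * RR => F p.1 (branch (g p.1) p.2 m)) _
      (fun o => (t, o))).
      by apply: measurable_branch => v; exact: measurable_cst.
    exact: measurable_pair1.
  rewrite -[X in measurable X]setTI.
  rewrite (_ : [set o | _] = (fun o : RR => F t (branch (g t) o m)) @^-1` [set 1]); first exact: mF.
  apply/seteqP; split=> o; rewrite /F/=; first by move=> ->; rewrite eqxx.
  by case: eqP => // _ /eqP; rewrite eq_sym oner_eq0.
rewrite (eq_bigr (fun w : m.-tuple bool => chi (word_pt R d w) * fine (U [set o : RR | branch (g
  t) o m = w]))).
  apply: (@word_integral_le _ _ _ U m (branch (g t) ^~ m) _ mb (fun w => chi (word_pt R d w))).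
  - by move=> o; exact: size_branch.
  - exact: measurableT_comp.
  move=> o; apply: le_trans (hchi _ _) _; rewrite lerD2l ler_wpM2l//.
  exact: (tdist_branch_pt (t, o)).
move=> w _; congr (_ * _).
have [l0 l1] := tree_left_itv w (tg t).
have gw : 0 <= g t w by have [_ /(_ w)[]] := tg t.
rewrite (_ : U _ = U `[tree_left (g t) w, tree_left (g t) w + g t w[%classic).
  by rewrite UE ?lerDl//= addrAC subrr add0r.
rewrite /U/= /density_measure !integral_indic//; [|exact: measurable_itv..].
congr (lambda _); apply/seteqP; split=> o /=; rewrite !in_itv/= => -[h1 h2]; split=> //.
  by rewrite -branchP// size_tuple; apply/eqP.
by apply/eqP; rewrite -[X in branch _ _ X](size_tuple w) branchP.
Qed.

End tree_kernel.

(** * Weak-* sequential compactness of probability kernels *)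

Lemma Rintegral_dominated_cvg d0 (X : measurableType d0) (R : realType)
    (mu : {measure set X -> \bar R}) (f_ : nat -> X -> R) (f g : X -> R) :
  (forall n, measurable_fun [set: X] (f_ n)) -> (forall x, f_ n x @[n --> \oo] --> f x) ->
  (forall n x, `|f_ n x| <= g x) -> mu.-integrable [set: X] (EFin \o g) ->
  \int[mu]_x f_ n x @[n --> \oo] --> \int[mu]_x f x.
Proof.
move=> mf ff fg ig.
have mlim : measurable_fun setT f by exact: (measurable_fun_cvg mf).
have fgx x : `|f x| <= g x.
  have cn : `|f_ n x| @[n --> \oo] --> `|f x| by exact: cvg_norm.
  rewrite -(cvg_lim _ cn)//; apply: limr_le; first by apply/cvg_ex; exists `|f x|.
  by exists 0%N => // n _; exact: fg.
have a1 : {ae mu, forall x, setT x -> (EFin \o f_ n) x @[n --> \oo] --> (EFin \o f) x}.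
  by apply: aeW => x _; apply/cvg_EFin; [exact: nearW|exact: ff].
have a2 : {ae mu, forall x n, setT x -> (`|(EFin \o f_ n) x| <= (EFin \o g) x)%E}.
  by apply: aeW => x n _; rewrite lee_fin fg.
have [_ _ h] := @dominated_convergence _ X R mu setT measurableT (fun n => EFin \o f_ n)
  (EFin \o f) (EFin \o g) (fun n => (measurable_EFinP _ _).2 (mf n)) ((measurable_EFinP _ _).2 mlim)
  a1 ig a2.
apply: fine_cvg; rewrite fineK; first exact: h.
by apply: integrable_fin_num => //; exact: (integrable_dominated mlim fgx ig).
Qed.

Section kernel_pairing.
Context (R : realType) (d : nat).
Local Notation lambda := (@lebesgue_measure R).
Local Notation RR := (measurableTypeR R).
Local Notation T := (torus R d).
Implicit Types (nu : Linfty_prob R d) (chi : T -> R) (P : probability T R).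

Lemma prob_int_integrable P chi : continuous chi -> P.-integrable setT (EFin \o chi).
Proof.
move=> cchi; have [M M0 hM] := torus_bounded cchi.
by apply: (prob_bounded_integrable P _ hM); exact: torus_continuous_measurable.
Qed.

Lemma prob_int_dist P chi chi' (e : R) : continuous chi -> continuous chi' ->
  (forall x, `|chi x - chi' x| <= e) -> `|\int[P]_x chi x - \int[P]_x chi' x| <= e.
Proof.
move=> c1 c2 h; have i1 := prob_int_integrable P c1; have i2 := prob_int_integrable P c2.
rewrite -[leRHS](prob_int_cst P); apply: Rintegral_dist_le => //.
by apply: (prob_bounded_integrable P (M := `|e|)).
Qed.

Lemma prob_int_sum P (I : Type) (s : seq I) (c : I -> R) (F : I -> T -> R) :
  (forall i, continuous (F i)) ->
  \int[P]_x (\sum_(i <- s) c i * F i x) = \sum_(i <- s) c i * \int[P]_x F i x.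
Proof.
move=> cF; rewrite Rintegral_sum => [|i].
  by apply: eq_bigr => i _; rewrite RintegralZl//; exact: prob_int_integrable.
by apply: integrableZ_EFin; exact: prob_int_integrable.
Qed.

Lemma prob_int_le P chi (M : R) : continuous chi -> (forall x, `|chi x| <= M) ->
  `|\int[P]_x chi x| <= M.
Proof.
move=> c1 h; have := @prob_int_dist P chi (fun=> 0) M c1 (@cst_continuous _ _ 0).
rewrite Rintegral_cst// mul0r subr0; apply => x; by rewrite subr0.
Qed.

Lemma bump_approx_continuous n chi : continuous (bump_approx n chi).
Proof.
by apply: continuous_bigsum => J _ x; apply: continuousM;
  [exact: cst_continuous|exact: bump_continuous].
Qed.

Lemma prob_int_bump_approx P n chi : \int[P]_x bump_approx n chi x =
  \sum_(J : grid_index d n) chi (grid_pt R J) * \int[P]_x bump J x.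
Proof. by apply: prob_int_sum => J; exact: bump_continuous. Qed.

Lemma kernel_int_measurable nu chi : continuous chi ->
  measurable_fun [set: RR] (fun t : RR => \int[nu t]_x chi x).
Proof.
move=> cchi; have [M M0 hM] := torus_bounded cchi.
have mchi := torus_continuous_measurable cchi.
(* Adding the bound [M] makes the integrand nonnegative, the case in which measurability of
   integrals against a kernel applies. *)
have E t : \int[nu t]_x chi x = fine (\int[nu t]_x (chi x + M)%:E)%E - M.
  have P1 : nu t setT = 1%E by exact: prob_kernel.
  have iB (f : T -> R) (N : R) : measurable_fun setT f -> (forall x, `|f x| <= N) ->
      (nu t).-integrable setT (EFin \o f).
    move=> mf fN; apply: measurable_bounded_integrable => //.
      by rewrite [X in (X < _)%E]P1 ltry.
    by exists N; split=> [|N' NN' x _ /=]; rewrite ?num_real// (le_trans (fN x))// ltW.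
  rewrite -[fine _]/(\int[nu t]_x (chi x + M)) RintegralD//.
  - by rewrite Rintegral_cst// [nu t _]P1 mulr1 addrK.
  - exact: (iB _ M).
  - exact: (iB _ `|M|).
rewrite (funext E); apply: measurable_funB => //.
apply: measurableT_comp => //.
apply: (@measurable_fun_integral_kernel _ _ RR T R nu) => [U mU|x|].
- exact: (measurable_kernel nu U mU).
- by rewrite lee_fin -lerBlDr sub0r; have /ler_normlP[] := hM x; rewrite lerNl.
- by apply/measurable_EFinP; exact: measurable_funD.
Qed.


(** The measure [nu t] under a name that carries the structure of a probability. *)
Definition kernel_at nu (t : R) : set T -> \bar R := nu t.

HB.instance Definition _ nu t := Measure.copy (kernel_at nu t) (nu t).

Let kernel_atT nu t : kernel_at nu t setT = 1%E. Proof. exact: prob_kernel. Qed.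

HB.instance Definition _ nu t :=
  @Measure_isProbability.Build _ T R (kernel_at nu t) (kernel_atT nu t).

Lemma kernel_int_le nu t chi (M : R) : continuous chi -> (forall x, `|chi x| <= M) ->
  `|\int[nu t]_x chi x| <= M.
Proof. exact: (@prob_int_le (kernel_at nu t)). Qed.

Lemma kernel_int_dist nu t chi chi' (e : R) : continuous chi -> continuous chi' ->
  (forall x, `|chi x - chi' x| <= e) -> `|\int[nu t]_x chi x - \int[nu t]_x chi' x| <= e.
Proof. exact: (@prob_int_dist (kernel_at nu t)). Qed.

Lemma kernel_int_bump_approx nu t n chi : \int[nu t]_x bump_approx n chi x =
  \sum_(J : grid_index d n) chi (grid_pt R J) * \int[nu t]_x bump J x.
Proof. exact: (@prob_int_bump_approx (kernel_at nu t)). Qed.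

Lemma kernel_int_bump nu t n (J : grid_index d n) : 0 <= \int[nu t]_x bump J x <= 1.
Proof.
apply/andP; split; first by apply: Rintegral_ge0 => x _; exact: bump_ge0.
apply: le_trans (ler_norm _) _; apply: kernel_int_le; first exact: bump_continuous.
by move=> x; rewrite ger0_norm ?bump_ge0// bump_le1.
Qed.

Lemma kernel_test_integrable nu (h : RR -> R) n (J : grid_index d n) :
  lambda.-integrable setT (EFin \o h) ->
  lambda.-integrable setT (EFin \o (fun t : RR => h t * \int[nu t]_x bump J x)).
Proof.
apply: integrable_unit_mul; split=> [|t]; last exact: kernel_int_bump.
by apply: kernel_int_measurable; exact: bump_continuous.
Qed.

Lemma L1_cont_eval_integrable (phi : L1_cont R d) x :
  lambda.-integrable setT (EFin \o (fun t : RR => sval phi t x)).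
Proof.
have [_ mphi [G iG hG]] := svalP phi.
exact: (@integrable_dominated _ RR R lambda (sval phi ^~ x) G (mphi x) (hG^~ x) iG).
Qed.

Lemma L1_cont_kernel_int_measurable nu (phi : L1_cont R d) :
  measurable_fun setT (fun t : RR => \int[nu t]_x sval phi t x).
Proof.
have [cphi mphi _] := svalP phi.
apply: (@measurable_fun_cvg _ _ _ _ (fun n (t : RR) => \int[nu t]_x bump_approx n (sval phi t) x)).
  move=> n; under eq_fun do rewrite kernel_int_bump_approx.
  apply: measurable_sum => J; apply: measurable_funM; first exact: mphi.
  by apply: kernel_int_measurable; exact: bump_continuous.
move=> t _; apply/cvgrPdist_le => e e0.
have [N _ hN] := bump_approx_cvg (cphi t) e0; exists N => // n /hN hn.
by apply: kernel_int_dist => //; exact: bump_approx_continuous.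
Qed.

Lemma L1_cont_kernel_int_integrable nu (phi : L1_cont R d) :
  lambda.-integrable setT (EFin \o (fun t : RR => \int[nu t]_x sval phi t x)).
Proof.
have [cphi mphi [G iG hG]] := svalP phi.
apply: (integrable_dominated (L1_cont_kernel_int_measurable nu phi) _ iG) => t.
by apply: kernel_int_le => // x; exact: hG.
Qed.

Hypothesis d_gt0 : (0 < d)%N.

(** The codes of [x] yield points [word_pt] arbitrarily close to [x], so these countably many points
    are dense. *)
Lemma continuous_dense_le chi (M : R) : continuous chi ->
  (forall w, `|chi (word_pt R d w)| <= M) -> forall x, `|chi x| <= M.
Proof.
move=> cchi hM x; apply/ler_addgt0Pr => e e0.
have e20 : 0 < e / 2 by rewrite divr_gt0.
have [C C0 hC] := continuous_tdist_le cchi e20.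
have e2C : 0 < e / 2 / (C + 1) by rewrite divr_gt0// ltr_wpDl.
have [m _ /(_ m (leqnn _))] := (cvgrPdist_le _ _).1 (@word_eps_cvg0 R d d_gt0) _ e2C.
rewrite sub0r normrN => /(le_trans (ler_norm _)) hm.
rewrite -[chi x](subrK (chi (word_pt R d (torus_code x m)))).
apply: le_trans (ler_normD _ _) _; rewrite addrC lerD//.
apply: le_trans (hC _ _) _; rewrite [leRHS](splitr e) lerD2l.
apply: le_trans (mul_frac_le C0 (ltW e20)).
by rewrite ler_wpM2l// (le_trans (tdist_code _ _)).
Qed.

(* The supremum over the torus of the approximation error is a supremum over the
   countable set of the [word_pt w], hence measurable in [t]. *)
Lemma L1_cont_bump (phi : L1_cont R d) (e : R) : 0 < e ->
  \forall n \near \oo, forall nu, `|Linfty_pairing nu phi -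
    \sum_(J : grid_index d n) \int[lambda]_t (sval phi t (grid_pt R J) * \int[nu t]_x bump J x)|
      <= e.
Proof.
move=> e0; have [cphi mphi [G iG hG]] := svalP phi.
pose q (j : nat) : T := word_pt R d (odflt [::] (unpickle j)).
pose D n (j : nat) (t : RR) := `|sval phi t (q j) - bump_approx n (sval phi t) (q j)|.
have DG n j t : D n j t <= 2 * G t.
  rewrite /D mulr_natl mulr2n; apply: le_trans (ler_normB _ _) _; rewrite lerD//.
  apply: le_trans (ler_norm_sum _ _ _) _.
  apply: (@le_trans _ _ (\sum_(J : grid_index d n) G t * bump J (q j))).
    by apply: ler_sum => J _; rewrite normrM [X in _ * X]ger0_norm ?bump_ge0// ler_wpM2r ?bump_ge0.
  by rewrite -mulr_sumr bump_sum1 mulr1.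
pose E n t := sups (D n ^~ t) 0.
have ubD n t : has_ubound (range (D n ^~ t)) by exists (2 * G t) => _ [j _ <-].
have DE n j t : D n j t <= E n t.
  by apply: ub_le_sup; [rewrite /sdrop; case: (ubD n t) => M hM; exists M => _ [k _ <-];
    apply: hM; exists k|exists j].
have E_le n t M : (forall j, D n j t <= M) -> E n t <= M.
  move=> h; apply: ge_sup => [|_ [k _ <-]//]; by exists (D n 0%N t); exists 0%N.
have E0 n t : 0 <= E n t by apply: le_trans (DE n 0%N t); exact: normr_ge0.
have mE n : measurable_fun setT (E n).
  apply: measurable_fun_sups => // j; apply: measurableT_comp => //.
  apply: measurable_funB; first exact: mphi.
  by apply: measurable_sum => J; apply: measurable_funM => //; exact: mphi.
have cE t : E n t @[n --> \oo] --> 0.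
  apply/cvgrPdist_le => e' e'0; have [N _ hN] := bump_approx_cvg (cphi t) e'0.
  by exists N => // n /hN hn; rewrite sub0r normrN ger0_norm// E_le// => j; exact: hn.
have hE n t x : `|sval phi t x - bump_approx n (sval phi t) x| <= E n t.
  move: x; apply: continuous_dense_le => [y|w].
    by apply: continuousB; [exact: cphi|exact: bump_approx_continuous].
  by have := DE n (pickle w) t; rewrite /D /q pickleK.
have cI : \int[lambda]_t E n t @[n --> \oo] --> \int[lambda]_t (0 : R).
  apply: (@Rintegral_dominated_cvg _ RR R lambda E (fun=> 0) (fun t => 2 * G t) mE cE);
    last exact: integrableZ_EFin.
  by move=> n t; rewrite ger0_norm// E_le.
rewrite Rintegral_cst// mul0r in cI.
have [N _ hN] := (cvgrPdist_le _ _).1 cI _ e0; exists N => // n /hN.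
rewrite sub0r normrN => /(le_trans (ler_norm _)) hn nu.
apply: le_trans hn.
have iJ (J : grid_index d n) := kernel_test_integrable nu J (L1_cont_eval_integrable phi
  (grid_pt R J)).
rewrite -Rintegral_sum//; apply: Rintegral_dist_le.
- exact: L1_cont_kernel_int_integrable.
- exact: integrable_sum_EFin.
- apply: (integrable_dominated (mE n) _ (integrableZ_EFin 2 iG)) => t.
  by rewrite ger0_norm// E_le.
move=> t; rewrite -kernel_int_bump_approx; apply: kernel_int_dist => //.
exact: bump_approx_continuous.
Qed.

(** The approximation in [L1_cont_bump] is uniform over kernels, so any test reduces to finitely
    many products of an integrable function of [t] and a bump. *)
Lemma pairing_cvg (nu_ : nat -> Linfty_prob R d) nu :
  (forall n (J : grid_index d n) (h : RR -> R), lambda.-integrable setT (EFin \o h) ->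
    \int[lambda]_t (h t * \int[nu_ k t]_x bump J x) @[k --> \oo] -->
    \int[lambda]_t (h t * \int[nu t]_x bump J x)) ->
  forall phi, Linfty_pairing (nu_ k) phi @[k --> \oo] --> Linfty_pairing nu phi.
Proof.
move=> h phi; apply/cvgrPdist_le => e e0.
have e30 : 0 < e / 3 by rewrite divr_gt0.
have [n _ /(_ n (leqnn _)) hn] := L1_cont_bump phi e30.
have c : \sum_(J : grid_index d n) \int[lambda]_t (sval phi t (grid_pt R J) * \int[nu_ k t]_x
  bump J x)
    @[k --> \oo] --> \sum_(J : grid_index d n) \int[lambda]_t (sval phi t (grid_pt R J) *
      \int[nu t]_x bump J x).
  by apply: cvg_bigsum => J _; apply: h; exact: L1_cont_eval_integrable.
have [N _ hN] := (cvgrPdist_le _ _).1 c _ e30; exists N => // k /hN hk.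
exact: dist_triangle3 (hn nu) hk (hn (nu_ k)).
Qed.

Lemma tensor_L1_cont (h : RR -> R) chi : lambda.-integrable setT (EFin \o h) -> continuous chi ->
  exists phi : L1_cont R d, sval phi = fun t x => h t * chi x.
Proof.
move=> ih cchi; have [M M0 hM] := torus_bounded cchi.
have mh : measurable_fun setT h by exact: (integrable_measurable ih).
suff P : [/\ forall t : R, continuous (fun x => h t * chi x),
  forall x, measurable_fun [set: R] (fun t => h t * chi x) &
  exists2 g : R -> R, lambda.-integrable [set: R] (EFin \o g) & forall t x, `|h t * chi x| <= g t].
  by pose phi : L1_cont R d := exist _ (fun (t : R) x => h t * chi x) P; exists phi.
split.
- by move=> t x; apply: continuousM; [exact: cst_continuous|exact: cchi].
- by move=> x; apply: (@measurable_funM _ RR R) => //.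
- exists (fun t => M * `|h t|).
    apply: (integrableZ_EFin M); have := integrable_norm ih.
    by apply: eq_integrable.
  by move=> t x; rewrite normrM mulrC ler_wpM2r.
Qed.

Theorem kernel_seq_compact (nu_ : nat -> Linfty_prob R d) :
  exists2 s : nat -> nat, forall k, (k <= s k)%N &
  exists nu, forall phi, Linfty_pairing (nu_ (s k)) phi @[k --> \oo] --> Linfty_pairing nu phi.
Proof.
pose a n (t : RR) w : R := fine (kernel_at (nu_ n) t (cell w)).
have ta n t : tree_mass (a n t) by exact: (cell_tree_mass (kernel_at (nu_ n) t)).
have ma n w : measurable_fun setT (fun t => a n t w).
  by apply: measurableT_comp => //; exact: (measurable_kernel (nu_ n) _ (cell_measurable w)).
have [s ks [g [tg mg cg]]] := tree_mass_compact ta ma.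
exists s => //; exists (tree_kernel d mg); apply: pairing_cvg => n J h ih.
have cb := @bump_continuous R d n J.
apply/cvgrPdist_le => e e0.
have mh : measurable_fun setT h by exact: (integrable_measurable ih).
have iah : lambda.-integrable setT (EFin \o (fun t : RR => `|h t|)).
  by have := integrable_norm ih; exact: eq_integrable.
pose K := \int[lambda]_t `|h t|.
have K0 : 0 <= K by exact: Rintegral_ge0.
(* An error [e'] at each time integrates against [|h|] to at most [e / 3]. *)
pose e' := e / 3 / (K + 1).
have K1 : 0 < K + 1 by rewrite ltr_wpDl.
have e'0 : 0 < e' by rewrite !divr_gt0.
have e'2 : 0 < e' / 2 by rewrite divr_gt0.
have [C C0 hC] := continuous_tdist_le cb e'2.
have e2C : 0 < e' / 2 / (C + 1) by rewrite divr_gt0// ltr_wpDl.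
have [m _ /(_ m (leqnn _))] := (cvgrPdist_le _ _).1 (@word_eps_cvg0 R d d_gt0) _ e2C.
rewrite sub0r normrN => /(le_trans (ler_norm _)) hm.
have hm' : e' / 2 + C * word_eps R d m <= e'.
  rewrite [leRHS](splitr e') lerD2l; apply: le_trans (mul_frac_le C0 (ltW e'2)).
  by rewrite ler_wpM2l.
(* The limit kernel and the kernels of the sequence are both compared with this sum over cells of
   depth [m], in which only the masses differ. *)
pose S (b : RR -> seq bool -> R) t := \sum_(w : m.-tuple bool) bump J (word_pt R d w) * b t w.
have iS b : (forall t, tree_mass (b t)) -> (forall w, measurable_fun setT (fun t => b t w)) ->
    forall w, lambda.-integrable setT (EFin \o (fun t : RR => h t * b t w)).
  move=> tb mb w; apply: integrable_unit_mul ih; split=> // t.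
  by rewrite tree_mass_le1// andbT; have [_ /(_ w)[]] := tb t.
have SE b : (forall t, tree_mass (b t)) -> (forall w, measurable_fun setT (fun t => b t w)) ->
    \int[lambda]_t (h t * S b t) =
    \sum_(w : m.-tuple bool) bump J (word_pt R d w) * \int[lambda]_t (h t * b t w) /\
    lambda.-integrable setT (EFin \o (fun t : RR => h t * S b t)).
  move=> tb mb.
  have E t : h t * S b t = \sum_(w : m.-tuple bool) bump J (word_pt R d w) * (h t * b t w).
    by rewrite mulr_sumr; apply: eq_bigr => w _; rewrite mulrCA.
  have iw (w : m.-tuple bool) : lambda.-integrable setT
      (EFin \o (fun t : RR => bump J (word_pt R d w) * (h t * b t w))).
    by apply: integrableZ_EFin; exact: iS.
  split; last by rewrite (funext E); exact: integrable_sum_EFin.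
  rewrite (funext E) Rintegral_sum//; apply: eq_bigr => w _.
  by rewrite RintegralZl//; exact: iS.
have close nu b : (forall t, tree_mass (b t)) -> (forall w, measurable_fun setT (fun t => b t w)) ->
    (forall t, `|\int[nu t]_x bump J x - S b t| <= e') ->
    `|\int[lambda]_t (h t * \int[nu t]_x bump J x) - \int[lambda]_t (h t * S b t)| <= e / 3.
  move=> tb mb hb; have [_ ib] := SE b tb mb; have iJ := kernel_test_integrable nu J ih.
  apply: (@le_trans _ _ (\int[lambda]_t (e' * `|h t|))).
    apply: Rintegral_dist_le => // [|t]; first exact: integrableZ_EFin.
    by rewrite -mulrBr normrM mulrC ler_wpM2r.
  by rewrite RintegralZl// -/K /e' mulrC mul_frac_le// ltW// divr_gt0.
have c : \sum_(w : m.-tuple bool) bump J (word_pt R d w) * \int[lambda]_t (h t * a (s k) t w)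
    @[k --> \oo] --> \sum_(w : m.-tuple bool) bump J (word_pt R d w) * \int[lambda]_t (h t * g t w).
  by apply: cvg_bigsum => w _; apply: cvgM; [exact: cvg_cst|exact: cg].
have e30 : 0 < e / 3 by rewrite divr_gt0.
have [N _ hN] := (cvgrPdist_le _ _).1 c _ e30; exists N => // k /hN.
rewrite -(SE _ tg mg).1 -(SE _ (ta (s k)) (ma (s k))).1 => hk.
have h1 := close (tree_kernel d mg) g tg mg (fun t => le_trans (tree_kernel_integral tg mg m t
  cb hC C0) hm').
have h2 : `|\int[lambda]_t (h t * \int[nu_ (s k) t]_x bump J x) - \int[lambda]_t (h t * S (a (s
  k)) t)| <= e / 3.
  apply: close => // t; apply: le_trans hm'.
  have -> : S (a (s k)) t = \sum_(w : m.-tuple bool) bump J (word_pt R d w) *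
      fine (kernel_at (nu_ (s k)) t [set x | torus_code x m = w]).
    by apply: eq_bigr => w _; rewrite /a /cell size_tuple.
  apply: (@word_integral_le _ _ _ (kernel_at (nu_ (s k)) t) m (fun x => torus_code x m) _ _
    (fun w => bump J (word_pt R d w))).
  - by move=> x; rewrite size_mkseq.
  - move=> w; have [wm|wm] := eqVneq (size w) m; first by rewrite -wm; exact: cell_measurable.
    rewrite (_ : [set x | _] = set0)//; apply/seteqP; split=> x //= xw.
    by case/eqP: wm; rewrite -xw size_mkseq.
  - exact: torus_continuous_measurable.
  - move=> x; apply: le_trans (hC _ _) _; rewrite lerD2l ler_wpM2l//.
    exact: tdist_code.
exact: dist_triangle3 h1 hk h2.
Qed.

End kernel_pairing.

(** * Propagated waves *)

Section waves.
Context (R : realType) (d : nat).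
Local Notation lambda := (@lebesgue_measure R).
Local Notation RR := (measurableTypeR R).
Local Notation T := (torus R d).
Local Notation dx := (@torus_measure R d).
Implicit Types (u v w : T -> R[i]) (chi : T -> R).

Lemma expi_dist (a b : R) : normc (expi a - expi b) ^+ 2 = 2 - 2 * cos (a - b).
Proof.
rewrite normc_sqr ReD ImD ReN ImN /= cosB.
have := cos2Dsin2 a; have := cos2Dsin2 b; lra.
Qed.

Lemma expi_dist_le (a b : R) : normc (expi a - expi b) ^+ 2 <= 2 * `|a - b|.
Proof.
rewrite expi_dist; have := cos_dist_le 0 (a - b); rewrite cos0 sub0r normrN.
by move=> /ler_normlP[_]; lra.
Qed.

Lemma normcM_sqr (x y : R[i]) : normc (x * y) ^+ 2 = normc x ^+ 2 * normc y ^+ 2.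
Proof. by rewrite !normc_sqr ReM ImM; ring. Qed.

Section phases.
Variables (u : T -> R[i]) (a : 'rV[int]_d -> R) (v : R -> T -> R[i]).
Hypotheses (hu : sqintC dx u) (hv : forall t, sqintC dx (v t))
  (vE : forall t k, fourier_coef (v t) k = expi (t * a k) * fourier_coef u k).

Lemma phases_energy t : energy dx (v t) = energy dx u.
Proof.
apply: energy_eq_coef => // k; rewrite vE.
by rewrite normcM normc_expi mul1r.
Qed.

(** Finitely many frequencies carry all the energy but [e / 8]. There the phases are Lipschitz in
    time; elsewhere the difference of two phases has squared modulus at most 4, which costs [e / 2].
    The resulting [dl] depends on [u] and on [a]. *)
Lemma phases_uniformly_continuous (e : R) : 0 < e ->
  exists2 dl : R, 0 < dl & forall s t, `|s - t| <= dl ->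
    energy dx (fun x => v s x - v t x) <= e.
Proof.
move=> e0; have e8 : 0 < e / 8 by rewrite divr_gt0.
have [K uK hK] := energy_coef_energy hu e8.
pose C := \sum_(k <- K) (torus_vol R d)^-1 * (2 * `|a k| * normc (fourier_coef u k) ^+ 2).
have V0 := torus_vol_gt0 R d.
have C0 : 0 <= C by apply: sumr_ge0 => k _;
  rewrite mulr_ge0 ?invr_ge0 ?(ltW V0)// mulr_ge0 ?sqr_ge0// mulr_ge0.
exists (e / 2 / (C + 1)); first by rewrite !divr_gt0// ltr_wpDl.
move=> s t st; have hw := sqintCB (hv s) (hv t).
set w := fun x => v s x - v t x.
have wE k : fourier_coef w k = (expi (s * a k) - expi (t * a k)) * fourier_coef u k.
  by rewrite fourier_coefB// !vE mulrBl.
rewrite (fourier_proj_pythagoras uK hw) (splitr e) lerD//.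
  apply: (@le_trans _ _ (`|s - t| * C)).
    rewrite mulr_sumr; apply: ler_sum => k _; rewrite wE normcM_sqr.
    rewrite [leRHS]mulrCA; apply: ler_wpM2l; first by rewrite invr_ge0 ltW.
    rewrite [leRHS]mulrA; apply: ler_wpM2r; first exact: sqr_ge0.
    by apply: le_trans (expi_dist_le _ _) _; rewrite -mulrBl normrM mulrCA.
  apply: (@le_trans _ _ (e / 2 / (C + 1) * C)); first by rewrite ler_wpM2r.
  by rewrite mulrC mul_frac_le// divr_ge0// ltW.
have : energy dx (fun x => w x - fourier_proj K w x) <= 4 * energy dx (fun x => u x -
  fourier_proj K u x).
  apply: energy_le_coef => //.
  - exact: (sqintCB hw (fourier_proj_sqint K w)).
  - exact: (sqintCB hu (fourier_proj_sqint K u)).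
  move=> k; rewrite (fourier_coefB k hw (fourier_proj_sqint K w)).
  rewrite (fourier_coefB k hu (fourier_proj_sqint K u)) !fourier_coef_proj//.
  case: ifPn => _; first by rewrite !subrr ler_peMl ?sqr_ge0// ler1n.
  rewrite !subr0 wE normcM_sqr ler_wpM2r ?sqr_ge0// expi_dist.
  by have := cos_geN1 (s * a k - t * a k); lra.
have X8 : energy dx (fun x => u x - fourier_proj K u x) <= e / 8.
  by rewrite -(lerD2l (coef_energy K u)) -fourier_proj_pythagoras.
move=> h; apply: le_trans h _; apply: le_trans (ler_wpM2l _ X8) _ => //.
by rewrite le_eqVlt; apply/orP; left; apply/eqP; field.
Qed.

End phases.

Lemma wave_int_integrable chi w (M : R) : measurable_fun setT chi -> (forall x, `|chi x| <= M) ->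
  sqintC dx w -> dx.-integrable setT (EFin \o (fun x => chi x * normc (w x) ^+ 2)).
Proof.
move=> mchi hM hw; have ie := integrable_energy hw.
apply: (@integrable_dominated _ _ _ dx _ (fun x => M * (complex.Re (w x) ^+ 2 + complex.Im (w x)
  ^+ 2))).
- apply: measurable_funM => //; under eq_fun do rewrite normc_sqr.
  by exact: (integrable_measurable ie).
- by move=> x; rewrite normrM normc_sqr [X in _ * X]ger0_norm ?addr_ge0 ?sqr_ge0// ler_wpM2r
  ?addr_ge0 ?sqr_ge0.
- exact: integrableZ_EFin.
Qed.

(** The inequality [|a^2 - b^2| <= (a - b)^2 / (2 dl) + dl (a^2 + b^2)] stands in for
    Cauchy-Schwarz; unit energies turn its last term into [2 dl], and [dl] is left free. *)
Lemma wave_int_dist chi v w (M dl : R) : measurable_fun setT chi ->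
  (forall x, `|chi x| <= M) -> 0 < dl ->
  sqintC dx v -> sqintC dx w -> energy dx v = 1 -> energy dx w = 1 ->
  `|\int[dx]_x (chi x * normc (v x) ^+ 2) - \int[dx]_x (chi x * normc (w x) ^+ 2)| <=
    M * (energy dx (fun x => v x - w x) / (2 * dl) + 2 * dl).
Proof.
move=> mchi hM dl0 hv hw v1 w1.
have i1 := wave_int_integrable mchi hM hv; have i2 := wave_int_integrable mchi hM hw.
pose e (z : T -> R[i]) x := complex.Re (z x) ^+ 2 + complex.Im (z x) ^+ 2.
pose F x := M * ((2 * dl)^-1 * e (fun x => v x - w x) x + (dl * e v x + dl * e w x)).
have ie z : sqintC dx z -> dx.-integrable setT (EFin \o e z) := @integrable_energy _ _ _ _ z.
have hvw := sqintCB hv hw.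
have iF : dx.-integrable setT (EFin \o F).
  by apply: integrableZ_EFin; apply: integrableD_EFin; [|apply: integrableD_EFin];
    apply: integrableZ_EFin; exact: ie.
have -> : M * (energy dx (fun x => v x - w x) / (2 * dl) + 2 * dl) = \int[dx]_x F x.
  rewrite RintegralZl//; last first.
    by apply: integrableD_EFin; [|apply: integrableD_EFin]; apply: integrableZ_EFin; exact: ie.
  rewrite RintegralD//; last 2 first.
    by apply: integrableZ_EFin; exact: ie.
    by apply: integrableD_EFin; apply: integrableZ_EFin; exact: ie.
  rewrite RintegralD//; try by apply: integrableZ_EFin; exact: ie.
  rewrite !RintegralZl//; try exact: ie.
  rewrite -/(energy dx v) -/(energy dx w) -/(energy dx _) v1 w1; congr (_ * _).
  rewrite /energy /e mulrC; congr (_ + _); ring.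
apply: Rintegral_dist_le => // x.
  rewrite -mulrBr normrM /F; apply: ler_pM => //.
  rewrite !normc_sqr /e ReD ImD ReN ImN.
  have q (a b : R) : `|a ^+ 2 - b ^+ 2| <= (2 * dl)^-1 * (a - b) ^+ 2 + (dl * a ^+ 2 + dl * b ^+ 2).
    have k1 (z : R) : z = 1 \/ z = -1 -> z * (a ^+ 2 - b ^+ 2) <= (2 * dl)^-1 * (a - b) ^+ 2 +
      (dl * a ^+ 2 + dl * b ^+ 2).
      (* Expand this square for the sign [z], then use [(a + b)^2 <= 2 (a^2 + b^2)]. *)
      move=> zz; have : 0 <= (2 * dl)^-1 * ((a - b) - z * dl * (a + b)) ^+ 2.
        by rewrite mulr_ge0 ?sqr_ge0// invr_ge0 mulr_ge0// ltW.
      have -> : (2 * dl)^-1 * ((a - b) - z * dl * (a + b)) ^+ 2 =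
        (2 * dl)^-1 * (a - b) ^+ 2 - z * (a ^+ 2 - b ^+ 2) + z ^+ 2 * (dl / 2 * (a + b) ^+ 2).
        by field; rewrite gt_eqF.
      have -> : z ^+ 2 = 1 by case: zz => ->; rewrite ?sqrrN expr1n.
      have : 0 <= dl / 2 * (a - b) ^+ 2 by rewrite mulr_ge0 ?sqr_ge0// divr_ge0// ltW.
      by move=> h1 h2; lra.
    have h1 := k1 1 (or_introl erefl); have h2 := k1 (-1) (or_intror erefl).
    by rewrite ler_norml; apply/andP; split; lra.
  have := q (complex.Re (v x)) (complex.Re (w x)); have := q (complex.Im (v x)) (complex.Im (w x)).
  set A := complex.Re (v x) ^+ 2 - _; set B := complex.Im (v x) ^+ 2 - _ => h1 h2.
  have -> : complex.Re (v x) ^+ 2 + complex.Im (v x) ^+ 2 - (complex.Re (w x) ^+ 2 + complex.Im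
    (w x) ^+ 2) = A + B.
    by rewrite /A /B; ring.
  apply: le_trans (ler_normD _ _) _; apply: le_trans (lerD h2 h1) _.
  by rewrite le_eqVlt; apply/orP; left; apply/eqP; ring.
Qed.

End waves.

(** * Densities of waves as probability kernels *)

Section wave_kernels.
Context (R : realType) (d : nat).
Local Notation lambda := (@lebesgue_measure R).
Local Notation RR := (measurableTypeR R).
Local Notation T := (torus R d).
Local Notation dx := (@torus_measure R d).
Implicit Types (u v w : T -> R[i]) (chi : T -> R).

Section wave_prob.
Variable w : T -> R[i].
Hypotheses (hw : sqintC dx w) (w1 : energy dx w = 1).

Lemma wave_density_measurable : measurable_fun setT (fun x => normc (w x) ^+ 2).
Proof.
under eq_fun do rewrite normc_sqr.
by apply/measurable_EFinP; exact: measurable_int (integrable_energy hw).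
Qed.

Lemma wave_density_ge0 x : 0 <= normc (w x) ^+ 2.
Proof. exact: sqr_ge0. Qed.

Lemma wave_density_int : (\int[dx]_x (normc (w x) ^+ 2)%:E = 1)%E.
Proof.
under eq_integral do rewrite normc_sqr.
rewrite -[RHS]/(1%:E) -w1 /energy /Rintegral fineK//.
by apply: integrable_fin_num => //; exact: (integrable_energy hw).
Qed.

Definition wave_prob : probability T R :=
  density_measure wave_density_measurable wave_density_ge0 wave_density_int.

Lemma wave_prob_int chi : continuous chi ->
  \int[wave_prob]_x chi x = \int[dx]_x (chi x * normc (w x) ^+ 2).
Proof.
move=> cchi; have [M M0 hM] := torus_bounded cchi.
have mchi := torus_continuous_measurable cchi.
by have [] := @integral_density _ _ _ dx wave_prob _ wave_density_measurable wave_density_ge0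
  (fun B _ => erefl) chi mchi (wave_int_integrable mchi hM hw).
Qed.

Lemma wave_probE B : measurable B ->
  wave_prob B = (\int[dx]_x (\1_B x * normc (w x) ^+ 2))%:E.
Proof.
move=> mB; rewrite /wave_prob/= /density_measure integral_mkcond/=.
have i : dx.-integrable setT (EFin \o (fun x => \1_B x * normc (w x) ^+ 2)).
  apply: (wave_int_integrable (M := 1)) => //.
  by move=> x; rewrite indicE; case: (_ \in _); rewrite ?normr1 ?normr0.
rewrite /Rintegral fineK; last exact: integrable_fin_num.
apply: eq_integral => x _; rewrite /patch indicE.
by case: ifPn => _; rewrite ?mul1r ?mul0r.
Qed.

End wave_prob.

Variable v : R -> T -> R[i].
Hypotheses (hv : forall t, sqintC dx (v t)) (v1 : forall t, energy dx (v t) = 1).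
Hypothesis cv : forall e : R, 0 < e -> exists2 dl : R, 0 < dl &
  forall s t, `|s - t| <= dl -> energy dx (fun x => v s x - v t x) <= e.

Lemma wave_int_uniformly_continuous chi (M e : R) : measurable_fun setT chi ->
  (forall x, `|chi x| <= M) -> 0 < e ->
  exists2 dl : R, 0 < dl & forall s t, `|s - t| <= dl ->
    `|\int[dx]_x (chi x * normc (v s x) ^+ 2) - \int[dx]_x (chi x * normc (v t x) ^+ 2)| <= e.
Proof.
move=> mchi hM e0; have M0 : 0 <= M by exact: le_trans (hM point).
have M1 : 0 < M + 1 by rewrite ltr_wpDl.
(* With parameter [b] and a difference of energy at most [4 b^2], the bound of [wave_int_dist] is
   [4 M b], hence at most [e]. *)
pose b := e / (M + 1) / 4; have b0 : 0 < b by rewrite !divr_gt0.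
have bb : 0 < 4 * b ^+ 2 by rewrite mulr_gt0// exprn_gt0.
have [dl dl0 hdl] := cv bb; exists dl => // s t /hdl hst.
apply: le_trans (wave_int_dist mchi hM b0 (hv s) (hv t) (v1 s) (v1 t)) _.
apply: (@le_trans _ _ (M * (4 * b))).
  apply: ler_wpM2l => //; have -> : 4 * b = 4 * b ^+ 2 / (2 * b) + 2 * b.
    by field; rewrite gt_eqF.
  by rewrite lerD2r ler_wpM2r// invr_ge0 mulr_ge0// ltW.
rewrite /b mulrCA [4 * _]mulrC mulrA divfK// mulrC -mulrA ler_piMr ?(ltW e0)//.
by rewrite mulrC ler_pdivrMr// mul1r lerDl.
Qed.

(** Bounded measurable [chi] are allowed so as to include indicators: the mass of each Borel set is
    then continuous in [t], which makes the densities a kernel. *)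
Lemma wave_int_continuous chi (M : R) : measurable_fun setT chi ->
  (forall x, `|chi x| <= M) -> continuous (fun t : R => \int[dx]_x (chi x * normc (v t x) ^+ 2)).
Proof.
move=> mchi hM t; apply/cvgrPdist_le => e e0.
have [dl dl0 h] := wave_int_uniformly_continuous mchi hM e0.
apply/nbhs_ballP; exists dl => //= s ts; apply: h.
by move: ts; rewrite /ball/= => /ltW.
Qed.

Let mP B : measurable B -> measurable_fun [set: R] (fun t => wave_prob (hv t) (v1 t) B).
Proof.
move=> mB; under eq_fun do rewrite wave_probE//.
apply/measurable_EFinP.
have m1 : measurable_fun setT (\1_B : T -> R) by exact: measurable_indic.
have b1 x : `|(\1_B : T -> R) x| <= 1 by rewrite indicE; case: (_ \in _); rewrite ?normr1 ?normr0.
have := continuous_measurable_fun (wave_int_continuous m1 b1); exact.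
Qed.

Definition wave_kernel : Linfty_prob R d :=
  @family_kernel _ _ (R : measurableType default_measure_display) T R _ mP.

Lemma wave_kernel_int t chi : continuous chi ->
  \int[wave_kernel t]_x chi x = \int[dx]_x (chi x * normc (v t x) ^+ 2).
Proof. exact: wave_prob_int. Qed.

End wave_kernels.

Lemma limn_esup_subseq (R : realType) (f g : nat -> \bar R) (s : nat -> nat) :
  (forall k, (k <= s k)%N) -> (forall k, g k = f (s k)) -> (limn_esup g <= limn_esup f)%E.
Proof.
move=> ks gf; rewrite !limn_esup_lim; apply: lee_lim; [exact: is_cvg_esups|exact: is_cvg_esups|].
apply: nearW => n; apply: ereal_sup_le => _ [k /= nk <-].
by exists (s k) => /=; [exact: leq_trans (ks k)|rewrite gf].
Qed.

Lemma limn_esup_ge0 (R : realType) (f : nat -> \bar R) :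
  (forall n, 0 <= f n)%E -> (0 <= limn_esup f)%E.
Proof.
move=> f0; rewrite limn_esup_lim; apply: lime_ge; first exact: is_cvg_esups.
apply: nearW => n; apply: le_trans (f0 n) _; apply: ereal_sup_ubound.
by exists n => /=.
Qed.

(** * High-frequency parts and subsequences *)

Section subsequences.
Context (R : realType) (d : nat).
Local Notation T := (torus R d).
Local Notation dx := (@torus_measure R d).
Implicit Types (u v w : T -> R[i]) (k : 'rV[int]_d).

(** The coordinates of a low frequency are at most [N] in absolute value, so it is found among the
    points of an index box shifted by [N]. *)
Lemma low_freq_seq (h r : R) : 0 < h -> exists2 K : seq 'rV[int]_d, uniq K &
  forall k, (k \in K) = ~~ (r <= \sum_(i < d) scaled_freq h k ord0 i ^+ 2).
Proof.
move=> h0; pose N := (Num.trunc (r / h ^+ 2)).+1.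
pose F (J : {ffun 'I_d -> 'I_(N + N).+1}) : 'rV[int]_d := \row_i ((J i : nat)%:Z - N%:Z).
pose K := [seq k <- undup [seq F J | J <- enum {ffun 'I_d -> 'I_(N + N).+1}] |
  ~~ (r <= \sum_(i < d) scaled_freq h k ord0 i ^+ 2)].
exists K => [|k]; first by rewrite filter_uniq// undup_uniq.
rewrite mem_filter; have [|rk] := leP r _ => //=.
rewrite mem_undup; apply/mapP.
have kN i : (`|k ord0 i| <= N)%N.
  rewrite leqNgt; apply/negP => Nk.
  have h1 : h ^+ 2 * ((k ord0 i)%:~R ^+ 2) < r.
    apply: le_lt_trans rk; rewrite (bigD1 i)//= mxE exprMn lerDl.
    by apply: sumr_ge0 => j _; exact: sqr_ge0.
  have : r / h ^+ 2 < r / h ^+ 2.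
    apply: (@lt_trans _ _ (N%:R)); first exact: truncnS_gt.
    apply: (@lt_le_trans _ _ ((k ord0 i)%:~R ^+ 2)); last first.
      by rewrite ler_pdivlMr ?exprn_gt0// mulrC ltW.
    rewrite -rmorphXn/= -[N%:R]/((N%:Z)%:~R) ltr_int.
    have -> : k ord0 i ^+ 2 = (`|k ord0 i|%N%:Z) ^+ 2 by rewrite abszE real_normK ?num_real.
    by rewrite expr2; move: Nk; set n := absz _; clearbody n N; nia.
  by rewrite ltxx.
exists [ffun i => inord (absz (k ord0 i + N%:Z)%R)]; first by rewrite mem_enum.
apply/rowP => i; rewrite mxE ffunE inordK; last by have := kN i; lia.
rewrite [k 0 i](_ : _ = k ord0 i); last by congr (k _ _); exact: val_inj.
by have := kN i; move: (k ord0 i) => z; clearbody N; lia.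
Qed.

(** As the low frequencies are finitely many, the high-frequency part is [u] minus a finite Fourier
    sum. *)
Lemma high_freq_exists (h r : R) u : 0 < h -> sqintC dx u -> exists w, is_high_freq h r u w.
Proof.
move=> h0 hu; have [K uK hK] := low_freq_seq r h0.
have hp := fourier_proj_sqint K u.
exists (fun x => u x - fourier_proj K u x); split.
  by apply/is_L2P; exact: sqintCB.
move=> k; rewrite (fourier_coefB k hu hp) fourier_coef_proj// hK.
by case: (leP r _) => _ /=; rewrite ?subr0 ?mul1r// subrr mul0r.
Qed.

(** The norm of a high-frequency part depends only on the moduli of the coefficients, so the
    property passes to subsequences and to evolved data; the high-frequency parts of [u'] themselves
    are supplied anew. *)
Lemma oscillating_subseq (h h' : nat -> R) (u u' : nat -> T -> R[i]) (s : nat -> nat) :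
  (forall j, (j <= s j)%N) -> (forall j, h' j = h (s j)) -> (forall j, 0 < h' j) ->
  (forall j, sqintC dx (u' j)) ->
  (forall j k, normc (fourier_coef (u' j) k) = normc (fourier_coef (u (s j)) k)) ->
  oscillating h u -> oscillating h' u'.
Proof.
move=> js hh h0 hu' uu [w [hw cw]].
have /choice[w' hw'] (p : R * nat) : exists w', is_high_freq (h' p.2) p.1 (u' p.2) w'.
  exact: high_freq_exists.
exists (fun r n => w' (r, n)); split; first by move=> r n; exact: (hw' (r, n)).
have E r j : normL2 (w' (r, j)) = normL2 (w r (s j)).
  have [/is_L2P h1 c1] := hw' (r, j); have [/is_L2P h2 c2] := hw r (s j).
  rewrite (normL2E h1) (normL2E h2); congr (_ `^ _)%:E; apply: (energy_eq_coef h1 h2) => k.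
  by rewrite c1 c2 !normcM uu /= hh.
apply: (squeeze_cvge _ (cvg_cst 0%E) cw); apply: nearW => r; apply/andP; split.
  by apply: limn_esup_ge0 => n; exact: Lnorm_ge0.
by apply: limn_esup_subseq js _ => j; exact: E.
Qed.

End subsequences.

(** * Limits of eigenfunctions *)

Section eigenfunction_limits.
Context (R : realType) (d : nat).
Local Notation lambda := (@lebesgue_measure R).
Local Notation RR := (measurableTypeR R).
Local Notation T := (torus R d).
Local Notation dx := (@torus_measure R d).
Implicit Types (chi : T -> R) (P : probability T R).

Lemma prob_cvg_bump (P_ : nat -> probability T R) P :
  (forall n (J : grid_index d n), \int[P_ k]_x bump J x @[k --> \oo] --> \int[P]_x bump J x) ->
  forall chi, continuous chi -> \int[P_ k]_x chi x @[k --> \oo] --> \int[P]_x chi x.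
Proof.
move=> h chi cchi; apply/cvgrPdist_le => e e0.
have e30 : 0 < e / 3 by rewrite divr_gt0.
have [n _ /(_ n (leqnn _)) hn] := bump_approx_cvg cchi e30.
have hP (Q : probability T R) : `|\int[Q]_x chi x - \sum_(J : grid_index d n) chi (grid_pt R J)
  * \int[Q]_x bump J x| <= e / 3.
  by rewrite -prob_int_bump_approx; exact: (prob_int_dist Q cchi (@bump_approx_continuous R d n
    chi) hn).
have c : \sum_(J : grid_index d n) chi (grid_pt R J) * \int[P_ k]_x bump J x @[k --> \oo] -->
    \sum_(J : grid_index d n) chi (grid_pt R J) * \int[P]_x bump J x.
  by apply: cvg_bigsum => J _; apply: cvgM; [exact: cvg_cst|exact: h].
have [N _ hN] := (cvgrPdist_le _ _).1 c _ e30; exists N => // k /hN hk.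
exact: dist_triangle3 (hP P) hk (hP (P_ k)).
Qed.

Lemma prob_pairing_nbhs (mu : weak_star_prob R d) chi (e : R) : continuous chi -> 0 < e ->
  nbhs mu [set P : weak_star_prob R d | `|\int[P]_x chi x - \int[mu]_x chi x| < e].
Proof.
move=> cchi e0.
pose c : continuousType T R := mkcts cchi.
have c1 := @initial_continuous _ _ (@prob_pairing R d) mu.
have c2 := @proj_continuous (continuousType T R) (fun=> R^o) c (prob_pairing mu).
have c3 := @cvg_comp _ _ _ (@prob_pairing R d) (fun f : {ptws continuousType T R ->
  R} => f c) (nbhs mu) (nbhs (prob_pairing mu)) _ c1 c2.
have := (@cvgrPdist_lt _ _ _ (nbhs mu) _ _ _).1 c3 e e0.
by move=> /(_ (nbhs_filter mu)); apply: (@filterS _ (nbhs mu) (nbhs_filter mu)) => P;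
  rewrite distrC.
Qed.

Lemma M_infty_sub (H : 'rV[R]_d -> R) (tau : R -> R) :
  @const_Linfty R d @` M_infty H `<=` M_set H tau.
Proof.
move=> _ [mu [h [u [e [rho [h0 hcvg hu osc [rhoE cl]]]]]] <-].
have hL n : sqintC dx (u n) /\ energy dx (u n) = 1 by apply/normalisedP; have [] := hu n.
have rhoi n chi : continuous chi -> \int[rho n]_x chi x = \int[dx]_x (chi x * normc (u n x) ^+ 2).
  move=> cchi; have [M M0 hM] := torus_bounded cchi.
  have mchi := torus_continuous_measurable cchi.
  have [_] := @integral_density _ _ _ dx (rho n) _ (wave_density_measurable (hL n).1)
    (@wave_density_ge0 R d (u n)) (rhoE n) chi mchi (wave_int_integrable mchi hM (hL n).1).
  exact.
pose I := {n & grid_index d n}.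
pose b (i : I) : T -> R := bump (tagged i).
have bc i : continuous (b i) by exact: bump_continuous.
(* Bumps determine weak-* convergence and are countably many, so the cluster point becomes a limit
   along a subsequence. *)
have [s ks hs] : exists2 s : nat -> nat, forall k, (k <= s k)%N &
    forall i : I, \int[rho (s k)]_x b i x @[k --> \oo] --> \int[mu]_x b i x.
  apply: (subseq_of_cluster (x := fun i n => \int[rho n]_x b i x)) => J e' N e'0.
  pose A := [set P : weak_star_prob R d | exists2 n, (N <= n)%N & P = rho n].
  have FA : ((rho : nat -> weak_star_prob R d) @ \oo) A by exists N => // n /= Nn; exists n.
  pose B := [set P : weak_star_prob R d | {in J, forall i, `|\int[P]_x b i x - \int[mu]_x b i x|
    < e'}].
  have nB : nbhs (mu : weak_star_prob R d) B.
    rewrite /B; elim: J {B} => [|i J IH];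
      first by apply: (@filterS _ (nbhs _) (nbhs_filter _) setT); [|exact: filterT].
    have hi := prob_pairing_nbhs (mu : weak_star_prob R d) (bc i) e'0.
    apply: (@filterS2 _ (nbhs _) (nbhs_filter _) _ _ _ _ hi IH) => P h1 h2 j.
    by rewrite inE => /orP[/eqP ->//|]; exact: h2.
  have [P [[n Nn ->] PB]] := cl _ _ FA nB.
  by exists n => // i iJ; rewrite distrC; exact: PB.
have cs : forall chi, continuous chi -> \int[rho (s k)]_x chi x @[k --> \oo] --> \int[mu]_x chi x.
  by apply: prob_cvg_bump => n J; exact: (hs (Tagged (grid_index d) J)).
(* The evolution multiplies an eigenfunction by this phase of modulus 1, which leaves its density
   unchanged. *)
pose c n t : R[i] := expi (- (tau (h n) * t / h n) * e n).
have nc n t : normc (c n t) = 1 by exact: normc_expi.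
exists (h \o s), (u \o s), (fun n t x => c (s n) t * u (s n) x); split.
- by move=> n; exact: h0.
- exact: (cvg_comp_subseq ks hcvg).
- by move=> n; have [] := hu (s n).
- exact: (oscillating_subseq ks (fun _ => erefl) (fun j => h0 (s j)) (fun j => (hL (s j)).1)
    (fun _ _ => erefl) osc).
split=> [n t|a b' chi ab cchi].
  have [hL2 _] := hL (s n); have [_ [_ eig]] := hu (s n).
  split; first by apply/is_L2P; exact: sqintCZ.
  move=> k; rewrite fourier_coefZ//.
  (* A coefficient of an eigenfunction vanishes unless [H] at the scaled frequency is the
     eigenvalue. *)
  have := eig k; rewrite fourier_coefZ// => /eqP; rewrite -subr_eq0 -mulrBl mulf_eq0.
  move=> /orP[|/eqP ->]; last by rewrite !mulr0.
  by rewrite subr_eq0 => /eqP[eH]; rewrite /c eH.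
rewrite (_ : (fun n => _) = fun n => (\int[rho (s n)]_x chi x) * fine (lambda `[a, b']));
  last first.
  apply/funext => n; rewrite -Rintegral_cst; last exact: measurable_itv.
  apply: eq_Rintegral => t _; rewrite rhoi//; apply: eq_Rintegral => x _ /=.
  by rewrite normcM nc mul1r.
rewrite (_ : \int[lambda]_(t in _) _ = (\int[mu]_x chi x) * fine (lambda `[a, b'])); last first.
  by rewrite -Rintegral_cst//; exact: measurable_itv.
by apply: cvgM; [exact: cs|exact: cvg_cst].
Qed.

End eigenfunction_limits.

(** * Averages along a slower time scale *)

Lemma lebesgue_indic_integrable (R : realType) (a b : R) :
  (@lebesgue_measure R).-integrable setT
    (EFin \o (\1_(`[a, b]%classic : set (measurableTypeR R)) : measurableTypeR R -> R)).
Proof.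
have mab : @measurable _ (measurableTypeR R) `[a, b] by exact: measurable_itv.
apply/integrableP; split; first by apply/measurable_EFinP; exact: measurable_indic.
under eq_integral do rewrite /= ger0_norm ?indicE ?ler0n// -indicE.
rewrite integral_indic// setIT [X in (X < _)%E](@lebesgue_measure_itv R)/=.
by case: ifPn => _; rewrite ?ltry// -EFinD ltry.
Qed.

Section propagated_families.
Context (R : realType) (d : nat).
Local Notation lambda := (@lebesgue_measure R).
Local Notation RR := (measurableTypeR R).
Local Notation T := (torus R d).
Local Notation dx := (@torus_measure R d).
Implicit Types (H : 'rV[R]_d -> R) (tau : R -> R) (h : nat -> R) (u : nat -> T -> R[i]).

Definition is_wave_kernel (v : R -> T -> R[i]) (K : Linfty_prob R d) :=
  forall s chi, continuous chi -> \int[K s]_x chi x = \int[dx]_x (chi x * normc (v s x) ^+ 2).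

(** The data behind an element of [M_set], before any limit of densities is taken. *)
Definition propagated H tau h u (v : nat -> R -> T -> R[i]) :=
  [/\ forall n, 0 < h n, h @ \oo --> 0, forall n, normalised (u n), oscillating h u &
    forall n t, is_propagator H (h n) (tau (h n) * t) (u n) (v n t)].

Lemma propagatorP H tau h u v : propagated H tau h u v -> forall n,
  [/\ sqintC dx (u n), energy dx (u n) = 1, forall t, sqintC dx (v n t) &
    forall t k, fourier_coef (v n t) k =
      expi (t * (- (tau (h n) / h n) * H (scaled_freq (h n) k))) * fourier_coef (u n) k].
Proof.
move=> [_ _ hu _ hv] n; have /normalisedP[h1 h2] := hu n; split=> // t.
  by apply/is_L2P; have [] := hv n t.
move=> k; have [_ ->] := hv n t; congr (expi _ * _).
by set x := (h n)^-1; ring.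
Qed.

Lemma propagated_energy H tau h u v : propagated H tau h u v ->
  forall n t, energy dx (v n t) = 1.
Proof.
by move=> /propagatorP p n t; have [h1 h2 h3 h4] := p n; rewrite (phases_energy h1 h3 h4).
Qed.

Lemma propagated_uniformly_continuous H tau h u v : propagated H tau h u v ->
  forall n (e : R), 0 < e -> exists2 dl : R, 0 < dl & forall s t, `|s - t| <= dl ->
    energy dx (fun x => v n s x - v n t x) <= e.
Proof.
by move=> /propagatorP p n e e0; have [h1 h2 h3 h4] := p n;
  exact: (phases_uniformly_continuous h1 h3 h4).
Qed.

Lemma propagated_kernel H tau h u v : propagated H tau h u v ->
  forall n, exists K, is_wave_kernel (v n) K.
Proof.
move=> p n; have [_ _ h3 _] := propagatorP p n.
exists (wave_kernel h3 (propagated_energy p n) (propagated_uniformly_continuous p n)) => s chi cchi.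
exact: wave_kernel_int.
Qed.

(** Group law: [tau (t + (tau' / tau) s) = tau t + tau' s], so zooming around a base time gives an
    evolution at the scale [tau']. The base time [t k] may vary freely with [k]. *)
Lemma propagated_subseq H tau tau' h u v (m : nat -> nat) (t : nat -> R) :
  time_scale tau -> (forall k, (k <= m k)%N) -> propagated H tau h u v ->
  propagated H tau' (h \o m) (fun k => v (m k) (t k))
    (fun k s => v (m k) (t k + tau' (h (m k)) / tau (h (m k)) * s)).
Proof.
move=> ts km p; have pE := propagated_energy p; have pP := propagatorP p.
have [h0 hcvg hu osc hv] := p.
have hL k r : sqintC dx (v k r) by have [] := pP k.
have nE k r l : normc (fourier_coef (v k r) l) = normc (fourier_coef (u k) l).
  by have [_ _ _ ->] := pP k; rewrite normcM normc_expi mul1r.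
split.
- by move=> n; exact: h0.
- exact: (cvg_comp_subseq km hcvg).
- by move=> n; apply/normalisedP.
- exact: (oscillating_subseq km (fun _ => erefl) (fun j => h0 (m j)) (fun j => hL _ _) (fun _ _
  => nE _ _ _) osc).
move=> n s; split; first by apply/is_L2P; exact: hL.
move=> k; have [_ _ _ E] := pP (m n); rewrite !E mulrA -expiD; congr (expi _ * _).
rewrite -[RHS]addrC /= mulrDl; congr (_ + _).
rewrite !mulrA; congr (_ * _); have := ts _ (h0 (m n)) => t0.
by field; rewrite gt_eqF//= gt_eqF.
Qed.

Lemma Linfty_pairing_step (K : Linfty_prob R d) (phi : L1_cont R d) (a b : R) chi :
  sval phi = (fun t x => \1_(`[a, b]%classic : set RR) t * chi x) -> continuous chi ->
  Linfty_pairing K phi = \int[lambda]_(t in `[a, b]) \int[K t]_x chi x.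
Proof.
move=> E cchi; rewrite /Linfty_pairing E [RHS]Rintegral_mkcond.
apply: (@eq_Rintegral _ RR R lambda setT) => t _.
rewrite patchE /= indicE; case: ifPn => _; last first.
  by under eq_Rintegral do rewrite mul0r; rewrite Rintegral_cst// mul0r.
by under eq_Rintegral do rewrite mul1r.
Qed.

Hypothesis d_gt0 : (0 < d)%N.

(** Products of the indicator of an interval and a continuous function are admissible tests, so a
    weak-* limit of the densities satisfies the definition of [M_set]. *)
Lemma M_set_compact H tau h u v (K : nat -> Linfty_prob R d) :
  propagated H tau h u v -> (forall n, is_wave_kernel (v n) (K n)) ->
  exists2 s : nat -> nat, forall k, (k <= s k)%N &
  exists2 nu, M_set H tau nu & forall phi, Linfty_pairing (K (s k)) phi @[k --> \oo] -->
    Linfty_pairing nu phi.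
Proof.
move=> p hK; have [h0 hcvg hu osc hv] := p.
have [s ks [nu hnu]] := kernel_seq_compact d_gt0 K.
exists s => //; exists nu => //; exists (h \o s), (u \o s), (v \o s); split.
- by move=> n; exact: h0.
- exact: (cvg_comp_subseq ks hcvg).
- by move=> n; exact: hu.
- exact: (oscillating_subseq ks (fun _ => erefl) (fun j => h0 (s j))
    (fun j => ((normalisedP _).1 (hu (s j))).1) (fun _ _ => erefl) osc).
split=> [n t|a b chi ab cchi]; first exact: hv.
have iab := lebesgue_indic_integrable a b.
have [phi hphi] := tensor_L1_cont iab cchi.
have := hnu phi; rewrite (Linfty_pairing_step _ hphi cchi).
under eq_fun do rewrite (Linfty_pairing_step _ hphi cchi).
rewrite (_ : (fun n => _) = fun n => \int[lambda]_(t in `[a, b]) \int[dx]_x (chi x * normc ((v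
  \o s) n t x) ^+ 2))//.
by apply/funext => n; apply: eq_Rintegral => t _; exact: hK.
Qed.

(* Otherwise there would be arbitrarily large [n], times [t] and kernels [K] far
   from [M_set H tau'], against [M_set_compact]. *)
Lemma wave_kernel_near_M_set H tau tau' h u v (r : nat) (phi : 'I_r -> L1_cont R d) (e : R) :
  time_scale tau -> propagated H tau h u v -> 0 < e ->
  exists N, forall n, (N <= n)%N -> forall t K,
    is_wave_kernel (fun s => v n (t + tau' (h n) / tau (h n) * s)) K ->
    exists2 nu, M_set H tau' nu & forall i, `|Linfty_pairing K (phi i) - Linfty_pairing nu (phi
      i)| <= e.
Proof.
move=> ts p e0; apply: contrapT => /forallNP hN.
have /choice[f hf] (N : nat) : exists q : nat * R * Linfty_prob R d, [/\ (N <= q.1.1)%N,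
    is_wave_kernel (fun s => v q.1.1 (q.1.2 + tau' (h q.1.1) / tau (h q.1.1) * s)) q.2 &
    forall nu, M_set H tau' nu ->
      ~ forall i, `|Linfty_pairing q.2 (phi i) - Linfty_pairing nu (phi i)| <= e].
  have /existsNP[n /not_implyP[Nn /existsNP[t /existsNP[K /not_implyP[hK h2]]]]] := hN N.
  exists (n, t, K); split=> // nu hnu h3; apply: h2; by exists nu.
have f1 N : (N <= (f N).1.1)%N by have [] := hf N.
have f2 N := let: And3 _ a _ := hf N in a.
have pf := propagated_subseq tau' (fun k => (f k).1.2) ts f1 p.
have [s ks [nu hnu cnu]] := M_set_compact pf f2.
have : \forall k \near \oo, forall i, `|Linfty_pairing (f (s k)).2 (phi i) - Linfty_pairing nu
  (phi i)| <= e.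
  apply: filter_forall => i; have [N _ h1] := (cvgrPdist_le _ _).1 (cnu (phi i)) _ e0.
  by exists N => // k /h1; rewrite distrC.
by move=> [N _ /(_ N (leqnn N))]; have [_ _] := hf (s N); exact.
Qed.

End propagated_families.

(** * Riemann sums and averages over intervals *)

Section interval_averages.
Context (R : realType).
Local Notation lambda := (@lebesgue_measure R).
Local Notation RR := (measurableTypeR R).
Implicit Types (F h : RR -> R) (a b c : R).

Lemma itv_measure a b : a <= b -> fine (lambda `[a, b]) = b - a.
Proof.
move=> ab; rewrite (@lebesgue_measure_itv R)/= lte_fin.
by case: ltgtP ab => [//|//|->] _ /=; rewrite subrr.
Qed.

Lemma itv_measurable a b : @measurable _ RR `[a, b].
Proof. exact: measurable_itv. Qed.

Lemma unit_itv_integrable F a b : unit_valued F ->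
  lambda.-integrable `[a, b] (EFin \o F).
Proof.
move=> [mF F01]; apply: measurable_bounded_integrable.
- exact: itv_measurable.
- by rewrite [X in (X < _)%E](@lebesgue_measure_itv R)/=; case: ifPn => _;
  rewrite ?ltry// -EFinD ltry.
- exact: measurable_funTS.
- exists 1; split=> [|N N1 x _ /=]; first exact: num_real.
  by have /andP[h0 h1] := F01 x; rewrite ger0_norm// (le_trans h1)// ltW.
Qed.

Lemma unit_itv_split F a b c : unit_valued F -> a <= b -> b <= c ->
  \int[lambda]_(t in `[a, c]) F t =
  \int[lambda]_(t in `[a, b]) F t + \int[lambda]_(t in `[b, c]) F t.
Proof.
move=> uF ab bc; have iF x y := unit_itv_integrable x y uF.
rewrite -(@Rintegral_itv_obnd_cbnd R b (BRight c) F); last first.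
  by apply: (integrableS _ _ _ (iF b c)); [exact: itv_measurable|exact: measurable_itv|
    apply: subset_itvr; rewrite bnd_simp].
rewrite -(@Rintegral_itvB R F (BLeft a) (BRight c) b (iF a c)) ?bnd_simp//.
by rewrite addrC subrK.
Qed.

Lemma unit_itv_bound F a b : unit_valued F -> a <= b ->
  0 <= \int[lambda]_(t in `[a, b]) F t <= b - a.
Proof.
move=> uF ab; apply/andP; split.
  by apply: Rintegral_ge0 => x _; have [_ /(_ x)/andP[]] := uF.
rewrite -(itv_measure ab) -[leRHS]mul1r -Rintegral_cst; last exact: itv_measurable.
apply: le_Rintegral.
- exact: itv_measurable.
- exact: unit_itv_integrable.
- by apply: (unit_itv_integrable (F := fun=> 1)); split=> [|x];
  [exact: measurable_cst|rewrite ler01 lexx].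
- by move=> x _; have [_ /(_ x)/andP[]] := uF.
Qed.

(** Shifting the window exchanges two pieces of length [|c|], on which [F] lies in [0, 1]. *)
Lemma unit_itv_shift F a c (eta : R) : unit_valued F -> 0 <= eta ->
  `|\int[lambda]_(t in `[(a + c), (a + c + eta)]) F t - \int[lambda]_(t in `[a, (a + eta)]) F t|
    <= `|c|.
Proof.
move=> uF eta0; wlog c0 : a c / 0 <= c.
  move=> H; have [/H//|/ltW c0] := leP 0 c.
  have := H (a + c) (- c); rewrite addrK oppr_ge0 normrN distrC; exact.
rewrite (ger0_norm c0).
have E : \int[lambda]_(t in `[a, (a + c)]) F t + \int[lambda]_(t in `[(a + c), (a + c + eta)]) F t =
    \int[lambda]_(t in `[a, (a + eta)]) F t + \int[lambda]_(t in `[(a + eta), (a + c + eta)]) F t.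
  by rewrite -!unit_itv_split// ?lerDl// addrAC lerDl.
have /andP[x0 x1] : 0 <= \int[lambda]_(t in `[a, (a + c)]) F t <= a + c - a.
  by apply: unit_itv_bound => //; rewrite lerDl.
have /andP[y0 y1] : 0 <= \int[lambda]_(t in `[(a + eta), (a + c + eta)]) F t <= a + c + eta - (a
  + eta).
  by apply: unit_itv_bound => //; rewrite addrAC lerDl.
by rewrite ler_norml; apply/andP; split; lra.
Qed.

Lemma riemann_step F b (z e : R) : unit_valued F -> 0 <= z ->
  (forall s t, `|s - t| <= z -> `|F s - F t| <= e) ->
  `|z * F b - \int[lambda]_(t in `[b, (b + z)]) F t| <= z * e.
Proof.
move=> uF z0 hF; have bz : b <= b + z by rewrite lerDl.
have mz : fine (lambda `[b, (b + z)]) = z by rewrite itv_measure// addrAC subrr add0r.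
have cst_int (c : R) : \int[lambda]_(t in `[b, (b + z)]) c = z * c.
  by rewrite Rintegral_cst; [rewrite mz mulrC|exact: itv_measurable].
have mI := itv_measurable b (b + z).
have iI := unit_itv_integrable b (b + z) uF.
have ic (c : R) : lambda.-integrable `[b, (b + z)] (EFin \o (fun=> c)).
  have i1 : lambda.-integrable `[b, (b + z)] (EFin \o (fun=> 1)).
    by apply: (unit_itv_integrable (F := fun=> 1)); split=> [|x];
      [exact: measurable_cst|rewrite ler01 lexx].
  have := integrableZl mI c i1; apply: eq_integrable => // x _ /=.
  by rewrite mule1.
rewrite -!cst_int -RintegralB//.
apply: le_trans (le_normr_Rintegral _ _) _ => //.
  exact: (integrableB mI (ic _) iI).
have hle t : t \in `[b, (b + z)] -> `|F b - F t| <= e.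
  rewrite in_itv/= => /andP[bt tb]; apply: hF; rewrite distrC ger0_norm ?subr_ge0//.
  by rewrite lerBlDl.
apply: le_Rintegral => //.
have := integrableB mI (ic (F b)) iI => /(integrable_norm).
by apply: eq_integrable.
Qed.

Lemma riemann_sum F a (z e : R) N : unit_valued F -> 0 <= z ->
  (forall s t, `|s - t| <= z -> `|F s - F t| <= e) ->
  `|\sum_(i < N) z * F (a + z * i%:R) - \int[lambda]_(t in `[a, (a + z * N%:R)]) F t| <= N%:R *
    (z * e).
Proof.
move=> uF z0 hF; elim: N => [|N IH].
  by rewrite big_ord0 mulr0 addr0 mul0r set_itv1 Rintegral_set1 subrr normr0.
have zN : 0 <= z * N%:R by rewrite mulr_ge0.
rewrite big_ord_recr/= (@unit_itv_split _ a (a + z * N%:R))//; last 2 first.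
  by rewrite lerDl.
  by rewrite lerD2l ler_wpM2l// ler_nat.
rewrite opprD addrACA -[N.+1%:R]natr1 mulrDl mul1r.
apply: le_trans (ler_normD _ _) _; apply: lerD => //.
by rewrite mulrDr mulr1 addrA; exact: riemann_step.
Qed.

(** The mesh costs the oscillation [e] of [F]. The shift costs [|c|] on the integral over a window
    of length [eta], hence [|c| / eta] on the average. *)
Lemma shifted_average F a c (eta e : R) N : unit_valued F -> 0 < eta ->
  (forall s t, `|s - t| <= eta / N.+1%:R -> `|F s - F t| <= e) ->
  `|N.+1%:R^-1 * \sum_(i < N.+1) F (a + eta / N.+1%:R * i%:R + c) -
    eta^-1 * \int[lambda]_(t in `[a, (a + eta)]) F t| <= e + `|c| / eta.
Proof.
move=> uF eta0 hF; pose z := eta / N.+1%:R.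
have z0 : 0 <= z by rewrite divr_ge0// ltW.
have N0 : 0 < N.+1%:R :> R by rewrite ltr0n.
have zN : z * N.+1%:R = eta by rewrite divfK ?gt_eqF.
have h1 := riemann_sum (a + c) N.+1 uF z0 hF; rewrite zN in h1.
have h2 := unit_itv_shift a c uF (ltW eta0).
have -> : N.+1%:R^-1 * \sum_(i < N.+1) F (a + z * i%:R + c) =
    eta^-1 * \sum_(i < N.+1) z * F (a + c + z * i%:R).
  rewrite -mulr_sumr mulrA [eta^-1 * z](_ : _ = N.+1%:R^-1).
    by congr (_ * _); apply: eq_bigr => i _; rewrite addrAC.
  by rewrite /z mulrA mulVf ?mul1r// gt_eqF.
rewrite -mulrBr normrM ger0_norm ?invr_ge0 ?(ltW eta0)//.
set A := \sum_(i < _) _ in h1 *; set B := Rintegral _ _ _ in h1 h2 *;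
  set C := Rintegral _ _ _ in h2 *.
have -> : A - C = (A - B) + (B - C) by ring.
rewrite mulrC ler_pdivrMr//; apply: le_trans (ler_normD _ _) _.
rewrite mulrDl divfK ?gt_eqF//; apply: lerD => //.
by apply: le_trans h1 _; rewrite mulrA [N.+1%:R * z]mulrC zN mulrC.
Qed.

(** The threshold for [N] depends on [n], as the modulus of continuity of [F n] does. The shift
    [dl n * s] is not small uniformly in [s]; its cost vanishes only after integration against
    [h]. *)
Lemma averaged_test (F : nat -> RR -> R) h (dl : nat -> R) a (eta A e : R) :
  (forall n, unit_valued (F n)) ->
  (forall n (e' : R), 0 < e' -> exists2 z : R, 0 < z & forall s t, `|s - t| <= z ->
    `|F n s - F n t| <= e') ->
  dl n @[n --> \oo] --> 0 -> 0 < eta ->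
  eta^-1 * \int[lambda]_(t in `[a, (a + eta)]) F n t @[n --> \oo] --> A ->
  lambda.-integrable setT (EFin \o h) -> 0 < e ->
  \forall n \near \oo, \forall N \near \oo,
    `|\int[lambda]_s (h s * (N.+1%:R^-1 * \sum_(i < N.+1) F n (a + eta / N.+1%:R * i%:R + dl n *
      s))) -
      \int[lambda]_s (h s * A)| <= e.
Proof.
move=> uF cF dl0 eta0 FA ih e0.
have mh : measurable_fun setT h by exact: (integrable_measurable ih).
have iah : lambda.-integrable setT (EFin \o (fun t : RR => `|h t|)).
  by have := integrable_norm ih; exact: eq_integrable.
pose K := \int[lambda]_t `|h t|.
have K0 : 0 <= K by exact: Rintegral_ge0.
have K1 : 0 < K + 1 by rewrite ltr_wpDl.
pose e' := e / 3 / (K + 1); have e'0 : 0 < e' by rewrite !divr_gt0.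
(* Cost of the shift, truncated at 1 because the averages lie in [0, 1]; the truncation lets [|h|]
   dominate, so that [B n] tends to 0. *)
pose m n (s : RR) : R := Num.min 1 (`|dl n * s| / eta).
have m01 n s : 0 <= m n s <= 1.
  by rewrite /m le_min ler01 divr_ge0 ?(ltW eta0)//= ge_min lexx.
have mm n : measurable_fun setT (m n).
  apply: measurable_minr => //; apply: measurable_funM => //.
  by apply: measurableT_comp => //; exact: measurable_funM.
pose B n := \int[lambda]_s (`|h s| * m n s).
have cB : B n @[n --> \oo] --> 0.
  rewrite -[X in _ --> X](_ : \int[lambda]_s (0 : R) = 0); last by rewrite Rintegral_cst// mul0r.
  apply: (@Rintegral_dominated_cvg _ RR R lambda _ (fun=> 0) (fun t => `|h t|)) => //.
  - by move=> n; apply: measurable_funM => //; exact: measurableT_comp.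
  - move=> s; have c1 : `|h s| * (`|dl n * s| / eta) @[n --> \oo] --> 0.
      rewrite -[X in _ --> X](_ : `|h s| * (`|0 * s| / eta) = 0);
        last by rewrite mul0r normr0 mul0r mulr0.
      apply: cvgM; first exact: cvg_cst.
      by apply: cvgM; [apply: cvg_norm; apply: cvgM => //; exact: cvg_cst|exact: cvg_cst].
    apply: (squeeze_cvgr _ (cvg_cst 0) c1); apply: nearW => n.
    have /andP[h1 h2] := m01 n s; rewrite mulr_ge0//= ler_wpM2l//.
    by rewrite ge_min lexx orbT.
  - move=> n s; have /andP[h1 h2] := m01 n s.
    by rewrite normrM normr_id (ger0_norm h1) ler_piMr.
have e30 : 0 < e / 3 by rewrite divr_gt0.
have [N1 _ hN1] := (cvgrPdist_le _ _).1 cB _ e30.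
have [N2 _ hN2] := (cvgrPdist_le _ _).1 FA _ e'0.
exists (maxn N1 N2) => // n /=; rewrite geq_max => /andP[/hN1 h1 /hN2 h2].
rewrite sub0r normrN in h1; move/(le_trans (ler_norm _)) : h1 => h1.
have [z z0 hz] := cF n _ e'0.
exists (Num.trunc (eta / z)).+1 => // N /= hN.
have zN : eta / N.+1%:R <= z.
  rewrite ler_pdivrMr// mulrC -ler_pdivrMr//.
  apply: (@le_trans _ _ ((Num.trunc (eta / z)).+1%:R)); first by rewrite ltW// truncnS_gt.
  by rewrite ler_nat (leq_trans hN).
pose G (s : RR) : R := N.+1%:R^-1 * \sum_(i < N.+1) F n (a + eta / N.+1%:R * i%:R + dl n * s).
set I := eta^-1 * _ in h2.
have I01 : 0 <= I <= 1.
  have aeta : a <= a + eta by rewrite lerDl ltW.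
  have /andP[x0 x1] := unit_itv_bound (uF n) aeta.
  rewrite /I mulr_ge0 ?invr_ge0 ?(ltW eta0)//= ler_pdivrMl// mulr1.
  by apply: le_trans x1 _; rewrite addrAC subrr add0r.
have G01 s : 0 <= G s <= 1.
  have F0 i s' : 0 <= F n (i + s') <= 1 by have [_] := uF n.
  rewrite /G mulr_ge0 ?invr_ge0//=; last by apply: sumr_ge0 => i _;
    have /andP[] := F0 (a + eta / N.+1%:R * i%:R) (dl n * s).
  rewrite ler_pdivrMl// mulr1; apply: (@le_trans _ _ (\sum_(i < N.+1) 1)).
    by apply: ler_sum => i _; have /andP[] := F0 (a + eta / N.+1%:R * i%:R) (dl n * s).
  by rewrite sumr_const card_ord.
have GI s : `|G s - A| <= 2 * e' + m n s.
  have hI : `|I - A| <= e' by rewrite distrC.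
  have : `|G s - I| <= e' + m n s.
    have h3 := shifted_average a (dl n * s) (uF n) eta0 (fun s t st => hz s t (le_trans st zN)).
    rewrite /m minEle; case: ifPn => _; last exact: h3.
    have /andP[g0 g1] := G01 s; have /andP[i0 i1] := I01.
    by rewrite ler_norml; apply/andP; split; lra.
  rewrite -[G s - A](subrKA I) => h3.
  by apply: le_trans (ler_normD _ _) _; apply: le_trans (lerD h3 hI) _; lra.
have mG : measurable_fun setT G.
  apply: measurable_funM => //; apply: measurable_sum => i.
  have [mFn _] := uF n; apply: (measurableT_comp mFn).
  by apply: measurable_funD => //; exact: measurable_funM.
have iG : lambda.-integrable setT (EFin \o (fun s : RR => h s * G s)).
  by apply: integrable_unit_mul.
have iA : lambda.-integrable setT (EFin \o (fun s : RR => h s * A)).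
  by have := integrableZ_EFin A ih; apply: eq_integrable => // s _ /=; rewrite mulrC.
have im : lambda.-integrable setT (EFin \o (fun s : RR => `|h s| * m n s)).
  by apply: integrable_unit_mul.
apply: (@le_trans _ _ (\int[lambda]_s (2 * e' * `|h s| + `|h s| * m n s))).
  apply: Rintegral_dist_le => // [|s].
    by apply: integrableD_EFin => //; exact: integrableZ_EFin.
  rewrite -mulrBr normrM; apply: (@le_trans _ _ (`|h s| * (2 * e' + m n s))).
    by apply: ler_wpM2l => //; exact: GI.
  by rewrite mulrDr [`|h s| * (2 * e')]mulrC.
rewrite RintegralD//; last exact: integrableZ_EFin.
rewrite RintegralZl// -/K -/(B n).
have : e' * K <= e / 3 by rewrite mulrC mul_frac_le// ltW.
by move=> h3; lra.
Qed.

End interval_averages.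

Section lebesgue_points.
Context (R : realType).
Local Notation lambda := (@lebesgue_measure R).
Local Notation RR := (measurableTypeR R).

Lemma unit_locally_integrable (F : RR -> R) : unit_valued F ->
  locally_integrable setT (F : R -> R).
Proof.
move=> [mF F01]; split; [exact: mF|exact: openT|move=> K _ cK].
have mK : measurable K by apply: closed_measurable; apply: compact_closed.
apply: (@le_lt_trans _ _ (\int[lambda]_(x in K) 1)%E).
  apply: ge0_le_integral => //.
  - by apply/measurable_EFinP; apply: measurableT_comp => //; exact: measurable_funTS.
  - by move=> x _; rewrite lee_fin; have /andP[h0 h1] := F01 x; rewrite ger0_norm.
rewrite integral_cst// mul1e.
exact: compact_finite_measure.
Qed.

Let E (x : R) (n : nat) : set R := [set` `[x, x + n.+1%:R^-1]].

Let muE x n : lambda (E x n) = (n.+1%:R^-1)%:E.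
Proof.
rewrite [LHS](@lebesgue_measure_itv R)/= lte_fin ltrDl invr_gt0 ltr0n/=.
by rewrite -EFinD addrAC subrr add0r.
Qed.

Let E_nice x : nicely_shrinking x (E x).
Proof.
split; first by move=> n; exact: measurable_itv.
(* The interval lies in the ball of radius [2 / (n + 1)] about [x], whose measure is 4 times that of
   the interval. *)
exists (2 + 2, fun n => (n.+1%:R^-1 *+ 2)%:pos); split=> //=.
- rewrite -[X in _ --> X](_ : 0 *+ 2 = 0); last by rewrite mul0rn.
  rewrite (_ : (fun n => _) = fun n => 2 * n.+1%:R^-1); last first.
    by apply/funext => n; rewrite mulr_natl.
  rewrite mul0rn -[X in _ --> X](mulr0 2); apply: cvgM; first exact: cvg_cst.
  exact: cvg_harmonic.
- move=> n y; rewrite /E /ball/= in_itv/= => /andP[xy yx].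
  have n0 : 0 < n.+1%:R^-1 :> R by rewrite invr_gt0.
  apply: (@le_lt_trans _ _ n.+1%:R^-1); last by rewrite mulr2n ltrDl.
  by rewrite ler0_norm ?subr_le0// opprB lerBlDl.
- move=> n; have n0 : 0 < n.+1%:R^-1 :> R by rewrite invr_gt0.
  have n20 : 0 <= n.+1%:R^-1 *+ 2 :> R by rewrite mulrn_wge0// ltW.
  rewrite (@lebesgue_measure_ball R)//.
  by rewrite muE -EFinM lee_fin mulrDl mulr_natl [leLHS]mulr2n.
Qed.

Lemma unit_lebesgue_points (F : RR -> R) : unit_valued F ->
  {ae lambda, forall x, n.+1%:R * \int[lambda]_(t in `[x, (x + n.+1%:R^-1)]) F t @[n --> \oo]
    --> F x}.
Proof.
move=> uF; have locF := unit_locally_integrable uF.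
apply: (@filterS _ _ (@ae_filter_ringOfSetsType _ RR R lambda) _ _ _ (lebesgue_differentiation
  locF)) => x xF.
have := nice_lebesgue_differentiation E_nice locF xF => h.
have : fine ((lambda (E x n))^-1 * \int[lambda]_(y in E x n) (F y)%:E)%E @[n --> \oo] --> F x.
  by apply: fine_cvg.
rewrite (_ : (fun n => fine _) = fun n => n.+1%:R * \int[lambda]_(t in `[x, (x + n.+1%:R^-1)]) F
  t)//.
apply/funext => n; have iF := unit_itv_integrable x (x + n.+1%:R^-1) uF.
have fF := integrable_fin_num (itv_measurable x (x + n.+1%:R^-1)) iF.
by rewrite muE inver invr_eq0 pnatr_eq0/= invrK fineM.
Qed.

End lebesgue_points.

Section mixtures.
Context d0 (X : measurableType d0) (R : realType).
Variables (P : nat -> probability X R) (N : nat).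

Let w_ge0 : 0 <= N.+1%:R^-1 :> R. Proof. by rewrite invr_ge0. Qed.

Definition mixture : set X -> \bar R := mscale (NngNum w_ge0) (msum P N.+1).

HB.instance Definition _ := Measure.copy mixture (mscale (NngNum w_ge0) (msum P N.+1)).

Lemma mixtureE B : mixture B = (\sum_(i < N.+1) (N.+1%:R^-1)%:E * P i B)%E.
Proof. by rewrite /mixture /mscale /msum ge0_sume_distrr. Qed.

Let mixtureT : mixture setT = 1%E.
Proof.
rewrite mixtureE; under eq_bigr do rewrite probability_setT mule1.
by rewrite sumEFin sumr_const card_ord -[_ *+ _]mulr_natr mulVf.
Qed.

HB.instance Definition _ := @Measure_isProbability.Build _ X R mixture mixtureT.

Lemma mixture_int (g : X -> R) (M : R) : measurable_fun setT g -> (forall x, `|g x| <= M) ->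
  \int[mixture]_x g x = N.+1%:R^-1 * \sum_(i < N.+1) \int[P i]_x g x.
Proof.
move=> mg gM.
(* Adding [M] reduces the claim to a nonnegative integrand, for which integrals against sums and
   multiples of measures decompose. *)
have M0 x : 0 <= g x + M by have /ler_normlP[] := gM x; rewrite lerNl -subr_ge0 opprK addrC.
have mM : measurable_fun setT (fun x => g x + M) by exact: measurable_funD.
have bM x : `|g x + M| <= M + M by rewrite ger0_norm// lerD2r (le_trans (ler_norm _)).
have E (Q : probability X R) : \int[Q]_x (g x + M) = \int[Q]_x g x + M.
  rewrite RintegralD//; [|exact: prob_bounded_integrable gM|exact: (prob_bounded_integrable Q (M
    := `|M|))].
  by rewrite prob_int_cst.
have : \int[mixture]_x (g x + M) = N.+1%:R^-1 * \sum_(i < N.+1) \int[P i]_x (g x + M).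
  rewrite [LHS]/Rintegral /mixture ge0_integral_mscale//; last 2 first.
  - exact/measurable_EFinP.
  - by move=> x _; rewrite lee_fin.
  rewrite ge0_integral_measure_sum//; last 2 first.
  - by move=> x _; rewrite lee_fin.
  - exact/measurable_EFinP.
  rewrite (eq_bigr (fun i : 'I_N.+1 => (\int[P i]_x (g x + M))%:E)) => [|i _]; last first.
    rewrite /Rintegral fineK//; apply: integrable_fin_num => //.
    exact: (prob_bounded_integrable (P i) mM bM).
  by rewrite sumEFin -EFinM.
rewrite E; under eq_bigr do rewrite E.
rewrite big_split/= sumr_const card_ord mulrDr -[M *+ _]mulr_natl mulKf//.
exact: addIr.
Qed.

End mixtures.

Section closed_hull.
Context (R : realType) (d : nat).
Local Notation lambda := (@lebesgue_measure R).
Local Notation RR := (measurableTypeR R).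
Local Notation T := (torus R d).

Section kernel_mixture.
Variables (nu : nat -> Linfty_prob R d) (N : nat).

Let P t : probability T R := mixture (fun i => kernel_at (nu i) t) N.

Let mP B : measurable B -> measurable_fun [set: R] (fun t => P t B).
Proof.
move=> mB; rewrite (_ : (fun t => _) = fun t : R => (\sum_(i < N.+1) (N.+1%:R^-1)%:E * nu i t
  B)%E); last first.
  by apply/funext => t; exact: mixtureE.
apply: emeasurable_sum => i; apply: measurable_funeM.
exact: (measurable_kernel (nu i) B mB).
Qed.

Definition kernel_mixture : Linfty_prob R d :=
  @family_kernel _ _ (R : measurableType default_measure_display) T R P mP.

Lemma kernel_mixture_hull (A : set (Linfty_prob R d)) :
  (forall i, A (nu i)) -> convex_hull A kernel_mixture.
Proof.
move=> Anu; exists N.+1, (fun=> N.+1%:R^-1), (fun i => nu i); split => //.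
- by rewrite sumr_const card_ord -[_ *+ _]mulr_natr mulVf.
- by apply: aeW => t B mB; exact: mixtureE.
Qed.

Lemma kernel_mixture_pairing phi : Linfty_pairing kernel_mixture phi =
  N.+1%:R^-1 * \sum_(i < N.+1) Linfty_pairing (nu i) phi.
Proof.
have [cphi _ _] := svalP phi.
rewrite -Rintegral_sum => [|i]; last exact: L1_cont_kernel_int_integrable.
rewrite -RintegralZl//; last first.
  by apply: integrable_sum_EFin => i; exact: L1_cont_kernel_int_integrable.
apply: eq_Rintegral => t _; have [M M0 hM] := torus_bounded (cphi t).
exact: (mixture_int _ _ (torus_continuous_measurable (cphi t)) hM).
Qed.

End kernel_mixture.

(** The topology is the pointwise one pulled back by the pairing, so finitely many tests and one
    tolerance describe a basis of neighbourhoods. *)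
Lemma closed_hullP (A : set (Linfty_prob R d)) (nu : Linfty_prob R d) :
  (forall (r : nat) (phi : 'I_r -> L1_cont R d) (e : R), 0 < e ->
    exists2 mu, convex_hull A mu & forall i, `|Linfty_pairing mu (phi i) - Linfty_pairing nu
      (phi i)| <= e) ->
  closed_convex_hull A nu.
Proof.
move=> h; pose pt : {ptws L1_cont R d -> R} := Linfty_pairing nu.
(* [F] consists of the sets containing a basic one. Its convergence to [pt] says that every
   neighbourhood of [pt] contains a basic set. *)
pose F : set_system {ptws L1_cont R d -> R} := [set B | exists r (phi : 'I_r ->
  L1_cont R d) (e : R),
  0 < e /\ forall f : L1_cont R d -> R, (forall i, `|f (phi i) - pt (phi i)| <= e) -> B f].
have FF : Filter F.
  split.
  - by exists 0%N, (fun i : 'I_0 => match i with Ordinal m ltm => False_rect _ (notF ltm) end), 1.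
  - move=> B C [r [phi [e [e0 hB]]]] [r' [phi' [e' [e'0 hC]]]].
    pose psi (i : 'I_(r + r')) := match fintype.split i with inl j => phi j | inr j => phi' j end.
    exists (r + r')%N; exists psi; exists (Num.min e e').
    rewrite lt_min e0 e'0; split=> // f hf; split.
      apply: hB => i; have := hf (lshift r' i); rewrite /psi (unsplitK (inl i)) => /le_trans; apply.
      by rewrite ge_min lexx.
    apply: hC => i; have := hf (rshift r i); rewrite /psi (unsplitK (inr i)) => /le_trans; apply.
    by rewrite ge_min lexx orbT.
  - move=> B C BC [r [phi [e [e0 hB]]]]; exists r, phi, e; split=> // f hf.
    by apply: BC; exact: hB.
have Fpt : F --> pt.
  apply/cvg_sup => phi U [V] [[W] oW <-] WfN WU.
  have : nbhs (pt phi) W by apply: open_nbhs_nbhs.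
  move=> /nbhs_ballP[e /= e0 eW]; exists 1%N, (fun=> phi), (e / 2); split;
    first by rewrite divr_gt0.
  move=> f /(_ ord0) hf; apply: WU; apply: eW; rewrite /ball/= distrC.
  by apply: le_lt_trans hf _; rewrite ltr_pdivrMr// ltr_pMr// ltr1n.
move=> B; rewrite nbhsE => -[B' [[C oC CB'] B'nu] B'B].
have FC : F C.
  apply: Fpt; apply: open_nbhs_nbhs; split=> //.
  by have : B' nu by []; rewrite -CB'.
have [r [phi [e [e0 hC]]]] := FC.
have [mu hmu hpair] := h r phi e e0.
by exists mu; split=> //; apply: B'B; rewrite -CB'; exact: hC.
Qed.

End closed_hull.

Lemma average_dist (R : realType) (N : nat) (a b : nat -> R) (e : R) :
  (forall j, `|a j - b j| <= e) ->
  `|N.+1%:R^-1 * \sum_(j < N.+1) a j - N.+1%:R^-1 * \sum_(j < N.+1) b j| <= e.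
Proof.
move=> h; rewrite -mulrBr -sumrB normrM ger0_norm ?invr_ge0// ler_pdivrMl//.
apply: le_trans (ler_norm_sum _ _ _) _.
apply: (@le_trans _ _ (\sum_(j < N.+1) e)); first by apply: ler_sum => j _; exact: h.
by rewrite sumr_const card_ord mulr_natl.
Qed.

Section final.
Context (R : realType) (d : nat) (d_gt0 : (0 < d)%N).
Local Notation lambda := (@lebesgue_measure R).
Local Notation RR := (measurableTypeR R).
Local Notation T := (torus R d).
Local Notation dx := (@torus_measure R d).
Variables (H : 'rV[R]_d -> R) (tau tau' : R -> R).
Hypotheses (ts : time_scale tau) (tau'_tau : tau' h / tau h @[h --> 0^'+] --> 0).

Section hull_point.
Variables (h : nat -> R) (u : nat -> T -> R[i]) (v : nat -> R -> T -> R[i]).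
Hypothesis p : propagated H tau h u v.
Variable nu : Linfty_prob R d.
Hypothesis conv : forall (a b : R) (chi : T -> R), a < b -> continuous chi ->
  \int[lambda]_(t in `[a, b]) (\int[dx]_x (chi x * normc (v n t x) ^+ 2)) @[n --> \oo] -->
  \int[lambda]_(t in `[a, b]) (\int[nu t]_x chi x).
Variable t0 : R.
Hypothesis leb : forall q (J : grid_index d q),
  k.+1%:R * \int[lambda]_(t in `[t0, (t0 + k.+1%:R^-1)]) (\int[nu t]_x bump J x) @[k --> \oo] -->
  \int[nu t0]_x bump J x.

Let dl n := tau' (h n) / tau (h n).

Let dl0 : dl n @[n --> \oo] --> 0.
Proof.
have [h0 hcvg _ _ _] := p.
by have /cvg_at_rightP := tau'_tau; apply.
Qed.

Let F n q (J : grid_index d q) (t : RR) : R := \int[dx]_x (bump J x * normc (v n t x) ^+ 2).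

Let hL n t : sqintC dx (v n t). Proof. by have [] := propagatorP p n. Qed.

Let bump1 q (J : grid_index d q) (x : T) : `|bump J x| <= 1.
Proof. by rewrite ger0_norm ?bump_ge0// bump_le1. Qed.

Let F_uc n q (J : grid_index d q) (e : R) : 0 < e ->
  exists2 z : R, 0 < z & forall s t, `|s - t| <= z -> `|F n J s - F n J t| <= e.
Proof.
move=> e0; apply: (wave_int_uniformly_continuous (hL n) (propagated_energy p n)
  (propagated_uniformly_continuous p n) _ (@bump1 q J) e0).
by apply: torus_continuous_measurable; exact: bump_continuous.
Qed.

Let F_unit n q (J : grid_index d q) : unit_valued (F n J).
Proof.
have [K hK] := propagated_kernel p n.
have E t : F n J t = \int[K t]_x bump J x by rewrite hK//; exact: bump_continuous.
rewrite (funext E); split=> [|t]; last exact: kernel_int_bump.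
by apply: kernel_int_measurable; exact: bump_continuous.
Qed.

Let shifted_kernel n t : exists K, is_wave_kernel (fun s => v n (t + dl n * s)) K.
Proof.
have pf := propagated_subseq tau' (m := id) (fun=> t) ts (fun k => leqnn k) p.
exact: (propagated_kernel pf n).
Qed.

(* The five terms of the final estimate are the distance to [M_set H tau'], the
   approximation of the tests by [bump_approx], the Riemann sums and the shift by
   [dl n * s], the Lebesgue point, and the approximation of the tests again. *)
Lemma const_closed_hull :
  closed_convex_hull (M_set H tau') (const_Linfty (kernel_at nu t0 : probability T R)).
Proof.
apply: closed_hullP => r phi e e0; pose e1 := e / 5; have e10 : 0 < e1 by rewrite divr_gt0.
have [q hq] : exists q, forall i nu', `|Linfty_pairing nu' (phi i) -
    \sum_(J : grid_index d q) \int[lambda]_t (sval (phi i) t (grid_pt R J) * \int[nu' t]_x bump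
      J x)| <= e1.
  by apply: near_oo_ex; apply: filter_forall => i; exact: (L1_cont_bump d_gt0 (phi i) e10).
pose c (J : grid_index d q) := \int[nu t0]_x bump J x.
pose g i (J : grid_index d q) (s : RR) := sval (phi i) s (grid_pt R J).
have ig i J : lambda.-integrable setT (EFin \o g i J) := L1_cont_eval_integrable (phi i)
  (grid_pt R J).
(* [S] bounds the total weight of the error made in replacing the averages [A J] by the values [c J]
   at [t0], whence [e2]. *)
pose S := \sum_i \sum_J `|\int[lambda]_s g i J s|.
have S0 : 0 <= S by apply: sumr_ge0 => i _; apply: sumr_ge0.
have S1 : 0 < S + 1 by rewrite ltr_wpDl.
pose e2 := e1 / (S + 1); have e20 : 0 < e2 by rewrite divr_gt0.
have [k hk] : exists k, forall J : grid_index d q,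
    `|c J - k.+1%:R * \int[lambda]_(t in `[t0, (t0 + k.+1%:R^-1)]) (\int[nu t]_x bump J x)| <= e2.
  apply: near_oo_ex; apply: filter_forall => J.
  by have [m _ hm] := (cvgrPdist_le _ _).1 (@leb q J) _ e20; exists m.
(* The window is chosen before [n]: its averages are already close to the values at [t0], and the
   averages of [F n] over it converge by [conv]. *)
pose eta : R := k.+1%:R^-1; have eta0 : 0 < eta by rewrite invr_gt0.
pose A (J : grid_index d q) := eta^-1 * \int[lambda]_(t in `[t0, (t0 + eta)]) (\int[nu t]_x bump
  J x).
have hA J : `|c J - A J| <= e2 by have := hk J; rewrite /A /eta invrK.
have FA (J : grid_index d q) : eta^-1 * \int[lambda]_(t in `[t0, (t0 + eta)]) F n J t @[n -->
  \oo] --> A J.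
  apply: cvgM; first exact: cvg_cst.
  by apply: conv; [rewrite ltrDl|exact: bump_continuous].
(* One error [e3] is made for each bump, so the cardinal of the grid divides. *)
pose e3 := e1 / (#|{: grid_index d q}|%:R + 1).
have e30 : 0 < e3 by rewrite divr_gt0// ltr_wpDl.
have [N1 _ hN1] : \forall n \near \oo, forall i J, \forall N \near \oo,
    `|\int[lambda]_s (g i J s * (N.+1%:R^-1 * \sum_(j < N.+1) F n J (t0 + eta / N.+1%:R * j%:R +
      dl n * s))) -
      \int[lambda]_s (g i J s * A J)| <= e3.
  apply: filter_forall => i; apply: filter_forall => J.
  exact: (averaged_test (fun n => F_unit n J) (fun n => @F_uc n q J) dl0 eta0 (FA J) (ig i J) e30).
have [N2 hN2] := wave_kernel_near_M_set d_gt0 tau' phi ts p e10.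
(* From here [n] is fixed; [N] is chosen after it, for the finitely many tests and bumps
   together. *)
pose n := maxn N1 N2.
have {}hN1 := hN1 n (leq_maxl _ _).
have {}hN2 := hN2 n (leq_maxr _ _).
have [N hN] : exists N, forall i J,
    `|\int[lambda]_s (g i J s * (N.+1%:R^-1 * \sum_(j < N.+1) F n J (t0 + eta / N.+1%:R * j%:R +
      dl n * s))) -
      \int[lambda]_s (g i J s * A J)| <= e3.
  by apply: near_oo_ex; apply: filter_forall => i; apply: filter_forall => J; exact: hN1.
pose t (j : nat) := t0 + eta / N.+1%:R * j%:R.
have /choice[K hK] (j : nat) := shifted_kernel n (t j).
have /choice[nus hnus] (j : nat) : exists mu, M_set H tau' mu /\
    forall i, `|Linfty_pairing (K j) (phi i) - Linfty_pairing mu (phi i)| <= e1.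
  by have [mu h1 h2] := hN2 _ _ (hK j); exists mu.
exists (kernel_mixture nus N).
  by apply: kernel_mixture_hull => j; have [] := hnus j.
move=> i; rewrite kernel_mixture_pairing.
pose X1 := N.+1%:R^-1 * \sum_(j < N.+1) Linfty_pairing (K j) (phi i).
have d1 : `|N.+1%:R^-1 * \sum_(j < N.+1) Linfty_pairing (nus j) (phi i) - X1| <= e1.
  apply: (average_dist N (a := fun j => Linfty_pairing (nus j) (phi i))
    (b := fun j => Linfty_pairing (K j) (phi i))) => j.
  by rewrite distrC; have [_] := hnus j.
pose b j := \sum_(J : grid_index d q) \int[lambda]_s (g i J s * \int[K j s]_x bump J x).
pose X2 := N.+1%:R^-1 * \sum_(j < N.+1) b j.
have d2 : `|X1 - X2| <= e1.
  by apply: (average_dist N (a := fun j => Linfty_pairing (K j) (phi i)) (b := b)) => j; exact: hq.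
have X2E : X2 = \sum_(J : grid_index d q)
    \int[lambda]_s (g i J s * (N.+1%:R^-1 * \sum_(j < N.+1) F n J (t j + dl n * s))).
  rewrite /X2 exchange_big/= mulr_sumr; apply: eq_bigr => J _.
  have iJ j := kernel_test_integrable (K j) J (ig i J).
  rewrite -Rintegral_sum// -RintegralZl//; last exact: integrable_sum_EFin.
  apply: eq_Rintegral => s _; rewrite [RHS]mulrCA; congr (_ * _); rewrite mulr_sumr.
  by apply: eq_bigr => j _; rewrite hK//; exact: bump_continuous.
pose X3 := \sum_(J : grid_index d q) \int[lambda]_s (g i J s * A J).
have d3 : `|X2 - X3| <= e1.
  rewrite X2E -sumrB; apply: le_trans (ler_norm_sum _ _ _) _.
  apply: (@le_trans _ _ (\sum_(J : grid_index d q) e3)); first by apply: ler_sum => J _; exact: hN.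
  by rewrite sumr_const -[leLHS]mulr_natl mul_frac_le// ltW.
pose X4 := \sum_(J : grid_index d q) \int[lambda]_s (g i J s * c J).
have d4 : `|X3 - X4| <= e1.
  rewrite -sumrB; apply: le_trans (ler_norm_sum _ _ _) _.
  apply: (@le_trans _ _ (\sum_(J : grid_index d q) e2 * `|\int[lambda]_s g i J s|)).
    apply: ler_sum => J _; rewrite !RintegralZr// -mulrBr normrM mulrC ler_wpM2r//.
    by rewrite distrC.
  rewrite -mulr_sumr; apply: (@le_trans _ _ (e2 * S)).
    rewrite ler_wpM2l ?(ltW e20)// /S (bigD1 i)//= lerDl.
    by apply: sumr_ge0 => i' _; apply: sumr_ge0.
  by rewrite mulrC mul_frac_le// ltW.
have d5 := hq i (const_Linfty (kernel_at nu t0 : probability T R)).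
have {}d5 : `|X4 - Linfty_pairing (const_Linfty (kernel_at nu t0 : probability T R)) (phi i)| <= e1.
  by rewrite distrC; exact: d5.
set Y := Linfty_pairing (const_Linfty _) _ in d5 *.
set Z := _^-1 * _ in d1 *.
have -> : Z - Y = (Z - X1) + (X1 - X2) + (X2 - X3) + (X3 - X4) + (X4 - Y) by ring.
have -> : e = e1 + e1 + e1 + e1 + e1 by rewrite /e1; field.
by do 4!(apply: le_trans (ler_normD _ _) _; apply: lerD => //).
Qed.

End hull_point.

Lemma M_set_sub : M_set H tau `<=` Linfty_valued_in (M_av H tau').
Proof.
move=> nu [h [u [v [h0 hcvg hu osc [hv conv]]]]].
have p : propagated H tau h u v by split.
pose I := {q & grid_index d q}.
pose Q (l : nat) (t0 : RR) : Prop := if @unpickle I l is Some i then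
  k.+1%:R * \int[lambda]_(t in `[t0, (t0 + k.+1%:R^-1)]) (\int[nu t]_x bump (tagged i) x) @[k
    --> \oo] -->
  \int[nu t0]_x bump (tagged i) x else True.
(* The bumps are countably many, so almost every time is a Lebesgue point for all of them at
   once. *)
have aeQ : {ae lambda, forall t, forall l, Q l t}.
  apply: (@ae_foralln _ _ _ lambda Q) => l; rewrite /Q; case: (@unpickle I l) => [i|];
    last exact: aeW.
  apply: (unit_lebesgue_points (F := fun t : RR => \int[nu t]_x bump (tagged i) x)).
  split=> [|t]; last exact: kernel_int_bump.
  by apply: kernel_int_measurable; exact: bump_continuous.
apply: filterS aeQ => t0 hQ; exists (kernel_at nu t0 : probability T R) => //.
(* A constant family is its own average over [0, 1], so it remains to place it in the closed convex
   hull. *)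
exists (const_Linfty (kernel_at nu t0 : probability T R)).
  apply: (const_closed_hull p conv) => q J.
  by have := hQ (pickle (Tagged (grid_index d) J : I)); rewrite /Q pickleK.
move=> B mB; rewrite integral_cst; last exact: itv_measurable.
by rewrite [X in (_ * X)%E](@lebesgue_measure_itv R)/= lte_fin ltr01 oppr0 adde0 mule1.
Qed.

End final.

Theorem proposition1p12 (R : realType) (d : nat) (d_gt0 : (0 < d)%N)
    (H : 'rV[R]_d -> R) (H_smooth : smooth H) (tau tau' : R -> R)
    (tau_scale : time_scale tau) (tau'_scale : time_scale tau')
    (tau_oo : tau h @[h --> 0^'+] --> +oo)
    (tau'_oo : tau' h @[h --> 0^'+] --> +oo)
    (tau'_tau : tau' h / tau h @[h --> 0^'+] --> 0) :
  @const_Linfty R d @` M_infty H `<=` M_set H tau /\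
  M_set H tau `<=` Linfty_valued_in (M_av H tau').
Proof.
by split; [exact: M_infty_sub|exact: (M_set_sub d_gt0 tau_scale tau'_tau)].
Qed.
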